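(* Let $P>0$ and $T>0$. Assume that $f:\mathbb{R}\to\mathbb{R}$ satisfies condition (F) and that the $2P$-periodic kernel $K$ satisfies condition (K) (both stated in the context). Let $u,v$ be entropy weak solutions of the spatially periodic Cauchy problem $$u_t+f(u)_x=\mathbf{G}_{\mathrm{per}}[u],\qquad u(0,\cdot)=\bar u,$$ with the same initial data $u(0,\cdot)=v(0,\cdot)=\bar u\in L^2_{\mathrm{per}}(\mathbb{R})$. If the total variation of both $u(t,\cdot)$ and $v(t,\cdot)$ over $[-P,P]$ remains uniformly bounded for $t\in[0,T]$, then $u$ and $v$ coincide on $[0,T]\times\mathbb{R}$.
   Context: Condition (F): $f$ is $\mathcal{C}^1$ and strictly convex, and for some constant $C_f>0$ and exponents $1\le p_1\le p_2<p_1+2$ one has $|f'(s)|\le C_f(1+|s|)^{p_2}$ for all $s\in\mathbb{R}$; $\ \inf_{a\in\mathbb{R},\,s>0}\frac{f'(a+s)-f'(a)}{s^{p_1}}\ge C_f$; and for every $M>0$, $\ \sup_{|u|,|v|\le M,\,u\ne v}\frac{|f(u)-f(v)|}{|f'(u)-f'(v)|}<\infty$. Condition (K): $K\in\mathcal{C}^1(\mathbb{R}\setminus2P\mathbb{Z})$ is an odd $2P$-periodic function and, for some constant $C_K>0$, $|K^{(i)}(x)|\le C_K/|x|^{i+1}$ for $x\in[-P,P]\setminus\{0\}$, $i=0,1$. $L^2_{\mathrm{per}}(\mathbb{R})$ is the space of $2P$-periodic functions that are square integrable over $[-P,P]$, with norm $\|g\|=\big(\int_{-P}^P|g(x)|^2dx\big)^{1/2}$.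 The bounded linear operator $\mathbf{G}_{\mathrm{per}}:L^2_{\mathrm{per}}(\mathbb{R})\to L^2_{\mathrm{per}}(\mathbb{R})$ is $$\mathbf{G}_{\mathrm{per}}[g](x)=\lim_{\varepsilon\to0+}\int_{(-P,P)\setminus(-\varepsilon,\varepsilon)}K(y)\,g(x-y)\,dy.$$ Entropy weak solution of the periodic Cauchy problem: a function $u\in L^1_{loc}([0,\infty)\times\mathbb{R})$ such that (i) the map $t\mapsto u(t,\cdot)$ is continuous with values in $L^2_{\mathrm{per}}(\mathbb{R})$ and satisfies the initial condition $u(0,\cdot)=\bar u$; (ii) for any $k\in\mathbb{R}$ and every nonnegative $\phi\in\mathcal{C}^1_c((0,\infty)\times\mathbb{R})$, $$\iint\Big[|u-k|\phi_t+(f(u)-f(k))\,\mathrm{sign}(u-k)\,\phi_x+\mathbf{G}_{\mathrm{per}}[u](x)\,\mathrm{sign}(u-k)\,\phi\Big]\,dx\,dt\ge0.$$ *)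

(* Defs.v *)
From HB Require Import structures.
From mathcomp Require Import all_boot all_order all_algebra.
#[warning="-notation-overridden,-notation-incompatible-prefix"]
From mathcomp Require Import all_classical all_reals all_analysis.

Set Implicit Arguments.
Unset Strict Implicit.
Unset Printing Implicit Defensive.

Import Order.TTheory GRing.Theory Num.Theory.
Import numFieldNormedType.Exports.

Local Open Scope classical_set_scope.
Local Open Scope ring_scope.

Section Defs.
Context {R : realType}.
Local Notation mu := (@lebesgue_measure R).

Definition strictly_convex (f : R -> R) : Prop :=
  forall x y s : R, x != y -> 0 < s < 1 ->
    f (s * x + (1 - s) * y) < s * f x + (1 - s) * f y.

Definition condF (f : R -> R) : Prop :=
  [/\ forall s, derivable f s 1,
      continuous (derive1 f),
      strictly_convex f &
      exists Cf p1 p2 : R,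
        [/\ 0 < Cf,
            [/\ 1 <= p1, p1 <= p2 & p2 < p1 + 2],
            forall s, `|derive1 f s| <= Cf * (1 + `|s|) `^ p2,
            (Cf%:E <= ereal_inf
               [set ((derive1 f (p.1 + p.2) - derive1 f p.1)
                     / p.2 `^ p1)%R%:E | p in [set p : R * R | 0 < p.2]%R])%E &
            forall M : R, 0 < M ->
              (ereal_sup
                 [set (`|f p.1 - f p.2| / `|derive1 f p.1 - derive1 f p.2|)%R%:E
                   | p in [set p : R * R |
                       [/\ `|p.1| <= M, `|p.2| <= M & p.1 != p.2]]%R]
               < +oo)%E]].

(* R \ 2PZ.  A kernel is a total function, but nothing is required of its
   values outside this set. *)
Definition kernel_domain (P : R) : set R :=
  [set x | forall n : int, x != 2 * P * n%:~R].

Definition condK (P : R) (K : R -> R) : Prop :=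
  [/\ forall x, kernel_domain P x ->
        derivable K x 1 /\ {for x, continuous (derive1 K)},
      forall x, kernel_domain P x -> K (- x) = - K x,
      forall x, kernel_domain P x -> K (x + 2 * P) = K x &
      exists CK : R, 0 < CK /\
        forall (i : nat) (x : R), (i <= 1)%N -> - P <= x <= P -> x != 0 ->
          `|derive1n i K x| <= CK / `|x| ^+ i.+1].

Definition L2per_norm (P : R) (g : R -> R) : \bar R :=
  'N[mu]_2%:E[EFin \o (g \_ `[- P, P])].

(* The elements of L2_per(R) are represented by functions; equality in the
   space is equality almost everywhere. *)
Definition L2per (P : R) (g : R -> R) : Prop :=
  [/\ measurable_fun [set: R] g, periodic g (2 * P) &
      (L2per_norm P g < +oo)%E].

(* The limit exists for almost every x when g is in L2_per(R). *)
Definition Gper (P : R) (K g : R -> R) (x : R) : R :=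
  lim ((fun e : R =>
          \int[mu]_(y in `]- P, P[ `\` `]- e, e[) (K y * g (x - y))) @ 0^'+).

Definition locally_integrable_halfplane (w : R * R -> R) : Prop :=
  forall A : set (R * R), compact A -> A `<=` `[0, +oo[ `*` [set: R] ->
    (mu \x mu)%E.-integrable A (EFin \o w).

(* Points of R * R are pairs (t, x). *)
Definition dt (phi : R * R -> R) : R * R -> R := 'D_(1, 0) phi.
Definition dx (phi : R * R -> R) : R * R -> R := 'D_(0, 1) phi.

(* C^1_c((0,oo) x R), each function being extended by 0 to R * R. *)
Definition test_function (phi : R * R -> R) : Prop :=
  [/\ forall z, derivable phi z (1, 0) /\ derivable phi z (0, 1),
      continuous phi, continuous (dt phi), continuous (dx phi) &
      let supp := closure [set z | phi z != 0] in
      compact supp /\ supp `<=` `]0, +oo[ `*` [set: R]].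

(* Only the values u t x with t >= 0 matter.  As t |-> u t is continuous into
   L2_per(R), a solution given as an L^1_loc class has a jointly measurable
   representative whose slice at every t >= 0 is a 2P-periodic representative
   of the L2_per class of u(t, .); u stands for such a representative.
   The integral in the last clause is extended-real valued and is -oo when
   neither the positive nor the negative part is integrable, so the inequality
   fails there. *)
Definition entropy_weak_solution (P : R) (f K ubar : R -> R) (u : R -> R -> R)
    : Prop :=
  [/\ locally_integrable_halfplane (fun z => u z.1 z.2),
      forall t, 0 <= t -> L2per P (u t),
      forall t, 0 <= t ->
        L2per_norm P (u s \- u t) @[s --> within `[0, +oo[ (nbhs t)] --> 0%E,
      {ae mu, forall x, u 0 x = ubar x} &
      forall (k : R) (phi : R * R -> R), test_function phi ->
        (forall z, 0 <= phi z) ->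
        (0 <= \int[mu \x mu]_(z in `]0%R, +oo[ `*` [set: R])
           (`|u z.1 z.2 - k| * dt phi z
            + (f (u z.1 z.2) - f k) * Num.sg (u z.1 z.2 - k) * dx phi z
            + Gper P K (u z.1) z.2 * Num.sg (u z.1 z.2 - k) * phi z)%R%:E)%E].

(* Total variation of an a.e. class: the least total variation of its
   representatives on [a, b]. *)
Definition ess_total_variation (a b : R) (g : R -> R) : \bar R :=
  ereal_inf [set total_variation a b h | h in
    [set h : R -> R | {ae mu, forall x, a <= x <= b -> g x = h x}]].

End Defs.

(* Main.v *)
Require Import Defs.
From mathcomp Require Import all_boot all_order all_algebra.
From mathcomp Require Import all_classical all_reals all_analysis.
From mathcomp Require Import measurable_realfun.
From mathcomp Require Import ring lra.
Import Order.TTheory GRing.Theory Num.Theory.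
Import numFieldNormedType.Exports.
Local Open Scope classical_set_scope.
Local Open Scope ring_scope.
Set Implicit Arguments. Unset Strict Implicit. Unset Printing Implicit Defensive.

(** Kruzhkov's doubling of variables compares two solutions in L1.  The
    obstacle is the source: the singular operator G is not bounded on L1.
    Bounded variation almost repairs this.  If a 2P-periodic w has L1 norm L
    over a period and its translates by h move by at most D |h| in L1, then for
    every m > 0

      || G w ||_1 <= C (D e^{-m} + m L)             ([integral_abs_singular_le]).

    Indeed, as K is odd, G w (x) is the integral of K(y) (w(x - y) - w(x)), to
    be split at |y| = P e^{-m}: below, the singularity |K(y)| <= CK / |y| is
    absorbed by the modulus of continuity; above, the integral of 1 / |y| is m
    on each side.  For w = u - v, with m about log (1 / L), this is a
    log-Lipschitz bound, and Osgood's criterion gives uniqueness.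

    Functions of bounded variation have such a modulus of continuity
    ([bv_modulus]) and are bounded ([bv_sup]).  So each solution has a bounded,
    jointly measurable representative ([clipped]) for which G is given by an
    absolutely convergent integral at almost every point, and which satisfies
    the entropy inequalities for products F(t) H(x) of bumps
    ([clipped_entropic]).

    Products suffice for the doubling.  The kernel X(t) om(t - s) et(x - y) is
    for each (s, y) a product in (t, x), and conversely.  The inequality for u
    is integrated over one period in y, that for v over one period in x; in the
    coordinates (t, s, x - y, x) both become the same functional ([doubled]),
    and the derivatives of om and et cancel ([doubled_entropy_inequality]).  As
    the bumps shrink, the modulus of continuity of v in space and time yields

      W' <= A e^{-m} + K m W,      W(t) = int_{-P}^{P} |u(t, x) - v(t, x)| dx,

    for every m > 0, tested against nonnegative C1 functions of time
    ([weak_inequality]).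

    Instead of optimising m pointwise in time, Gronwall's argument is run with
    m fixed: if W(t1) = 0, then W(t2) <= e^{K m (t2 - t1)} A T e^{-m}, which
    tends to 0 as m grows when K (t2 - t1) <= 1/4.  So W = 0 propagates by time
    steps of a fixed length ([osgood_step], [osgood_vanish]). *)

(** Syntax-directed measurability of real expressions: the head symbol of the
    body selects the closure lemma, which keeps unification first-order. *)
Ltac mstep :=
  lazymatch goal with
  | |- measurable_fun _ (fun x => x) => exact: measurable_id
  | |- measurable_fun _ (fun x => EFin (@?f x)) =>
      apply: (proj2 (measurable_EFinP _ f))
  | |- measurable_fun _ (fun x => GRing.mul (@?f x) (@?g x)) =>
      apply: (@measurable_funM _ _ _ _ f g)
  | |- measurable_fun _ (fun x => Algebra.add (@?f x) (@?g x)) =>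
      apply: (@measurable_funD _ _ _ _ f g)
  | |- measurable_fun _ (fun x => Algebra.opp (@?f x)) =>
      apply: (@measurable_funN _ _ _ _ f)
  | |- measurable_fun _ (fun x => Num.norm (@?f x)) =>
      apply: (@measurableT_comp _ _ _ _ _ _ _ _ f (@normr_measurable _ setT))
  | |- measurable_fun _ (fun x => (@?f x, @?g x)) =>
      apply: (@measurable_fun_pair _ _ _ _ _ _ f g)
  | |- measurable_fun _ (fun x => fst (@?f x)) =>
      apply: (@measurableT_comp _ _ _ _ _ _ _ _ f measurable_fst)
  | |- measurable_fun _ (fun x => snd (@?f x)) =>
      apply: (@measurableT_comp _ _ _ _ _ _ _ _ f measurable_snd)
  | |- measurable_fun _ (fun x => @Order.lt _ _ (@?f x) (@?g x)) =>
      apply: (@measurable_fun_ltr _ _ _ _ f g)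
  | |- measurable_fun _ (fun x => @Order.le _ _ (@?f x) (@?g x)) =>
      apply: (@measurable_fun_ler _ _ _ _ f g)
  | |- measurable_fun _ (fun x => andb (@?f x) (@?g x)) =>
      apply: (@measurable_and _ _ _ f g)
  | |- measurable_fun _ (fun x => ?f (@?g x)) =>
      apply: (@measurableT_comp _ _ _ _ _ _ f _ g); [assumption|]
  | |- measurable_fun _ (fun x => ?c) => exact: measurable_cst
  end.
Ltac mfun := repeat first [assumption | mstep].

(** * Translations and reflections of the line *)

Section translation.
Context {R : realType}.
Local Notation mu := (@lebesgue_measure R).

Lemma measurable_addr (c : R) : measurable_fun [set: R] (fun x : R => x + c).
Proof. exact: measurable_funD. Qed.

Lemma lebesgue_measure_translation (c : R) (A : set R) : measurable A ->
  pushforward mu ((fun x => x + c) : _ -> measurableTypeR R) A = mu A.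
Proof.
move=> mA; apply/esym/lebesgue_measure_unique => //=.
  exact: measurable_addr.
move=> ? _ [[a b]] _ <-.
rewrite /pushforward /=.
have -> : (fun x => x + c) @^-1` `]a, b] = `]a - c, b - c]%classic.
  by apply/seteqP; split => x /=; rewrite !in_itv/= => /andP[? ?]; apply/andP; split; lra.
rewrite !lebesgue_measure_itv /= !lte_fin ltrD2r.
by case: ifP => // _; rewrite -!EFinD; congr EFin; lra.
Qed.

Lemma ge0_integral_translation (c : R) (f : R -> \bar R) :
  measurable_fun setT f -> (forall x, (0 <= f x)%E) ->
  (\int[mu]_x f (x + c)%R = \int[mu]_x f x)%E.
Proof.
move=> mf f0.
have h : [set: R] = ((fun x => x + c) : _ -> measurableTypeR R) @^-1` setT by [].
rewrite [in LHS]h -ge0_integral_pushforward//=; last exact: measurable_addr.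
by apply: eq_measure_integral => //=; first exact: measurable_addr;
  move=> ? A mA AS; exact: lebesgue_measure_translation.
Qed.

Lemma ge0_integral_reflection (f : R -> \bar R) :
  measurable_fun setT f -> (forall x, (0 <= f x)%E) ->
  (\int[mu]_x f (- x)%R = \int[mu]_x f x)%E.
Proof.
move=> mf f0.
have h : [set: R] = (-%R : _ -> measurableTypeR R) @^-1` setT by [].
rewrite [in LHS]h -ge0_integral_pushforward//=.
by apply: eq_measure_integral => //= A mA AS; exact: lebesgue_measureN.
Qed.

End translation.

(** * Tonelli and periodic integrands *)

Section tonelli.
Local Open Scope ereal_scope.
Context d1 d2 (T1 : measurableType d1) (T2 : measurableType d2) (R : realType).
Variables (m1 : {sigma_finite_measure set T1 -> \bar R})
          (m2 : {sigma_finite_measure set T2 -> \bar R}).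
Implicit Types (h : T1 * T2 -> \bar R).

Lemma measurable_partial_integral h (B : set T2) : measurable B ->
  measurable_fun setT h -> (forall z, 0 <= h z) ->
  measurable_fun setT (fun x => \int[m2]_(y in B) h (x, y)).
Proof.
move=> mB mh h0.
have E : (fun x => \int[m2]_(y in B) h (x, y)) =
         fubini_F m2 (h \_ (setT `*` B)).
  apply/funext => x; rewrite /fubini_F [LHS]integral_mkcond; apply: eq_integral => y _.
  by rewrite /patch in_setX in_setT.
rewrite E; apply: measurable_fun_fubini_tonelli_F => //.
  apply/(measurable_restrictT _ _).1 => //; first exact: measurableX.
  exact: measurable_funTS.
by move=> x; apply: erestrict_ge0.
Qed.

Lemma tonelli_on h (A : set T1) (B : set T2) : measurable A -> measurable B ->
  measurable_fun setT h -> (forall z, 0 <= h z) ->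
  \int[m1]_(x in A) \int[m2]_(y in B) h (x, y) =
  \int[m2]_(y in B) \int[m1]_(x in A) h (x, y).
Proof.
move=> mA mB mh h0.
pose h' := h \_ (A `*` B).
have mh' : measurable_fun setT h'.
  apply/(measurable_restrictT _ _).1 => //; first exact: measurableX.
  exact: measurable_funTS.
have h'0 z : 0 <= h' z by apply: erestrict_ge0.
transitivity (\int[m1]_x \int[m2]_y h' (x, y)).
  rewrite integral_mkcond; apply: eq_integral => x _.
  rewrite /patch; case: ifPn => xA.
    rewrite integral_mkcond; apply: eq_integral => y _.
    rewrite /h' /patch; congr (if _ then _ else _).
    by rewrite in_setX xA.
  rewrite integral0_eq// => y _.
  by rewrite /h' /patch in_setX (negbTE xA).
rewrite fubini_tonelli//.
rewrite [RHS]integral_mkcond; apply: eq_integral => y _.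
rewrite /patch; case: ifPn => yB.
  rewrite [RHS]integral_mkcond; apply: eq_integral => x _.
  rewrite /h' /patch; congr (if _ then _ else _).
  by rewrite in_setX yB andbT.
rewrite integral0_eq// => x _.
by rewrite /h' /patch in_setX (negbTE yB) andbF.
Qed.

End tonelli.

Section periodic.
Local Open Scope ereal_scope.
Context {R : realType}.
Local Notation mu := (@lebesgue_measure R).
Implicit Types (g : R -> \bar R) (P : R).

(** Half-open, so that its translates by multiples of 2P tile the line. *)
Definition cell P : set R := [set x | (- P <= x < P)%R].

Lemma cell_itv P : cell P = `[(- P)%R, P[%classic.
Proof. by apply/seteqP; split => x; rewrite /cell /= in_itv. Qed.

Lemma measurable_cell P : measurable (cell P).
Proof. by rewrite cell_itv. Qed.

Lemma ge0_integral_translation_on (c : R) (A : set R) g : measurable A ->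
  measurable_fun setT g -> (forall x, 0 <= g x) ->
  \int[mu]_(x in [set x | A (x + c)%R]) g (x + c)%R = \int[mu]_(x in A) g x.
Proof.
move=> mA mg g0; rewrite integral_mkcond [RHS]integral_mkcond.
rewrite -(@ge0_integral_translation _ c (g \_ A)).
- apply: eq_integral => x _; rewrite /patch /=; congr (if _ then _ else _).
- by apply/(measurable_restrictT _ _).1 => //; exact: measurable_funTS.
- by move=> x; apply: erestrict_ge0.
Qed.

(** The translate sticks out of the cell by an interval of length z, which
    periodicity carries back to the other end. *)
Lemma integral_period_shift_small P g (z : R) : (0 <= z <= 2 * P)%R ->
  measurable_fun setT g -> (forall x, 0 <= g x) ->
  (forall x, g (x + 2 * P)%R = g x) ->
  \int[mu]_(x in cell P) g (x + z)%R = \int[mu]_(x in cell P) g x.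
Proof.
move=> /andP[z0 z2] mg g0 gP.
have E : cell P = [set x | (`[(- P + z)%R, (P + z)%R[%classic : set R) (x + z)%R].
  by apply/seteqP; split => x; rewrite /cell /= !in_itv/=; lra.
rewrite [in LHS]E ge0_integral_translation_on//.
have -> : (`[(- P + z)%R, (P + z)%R[%classic : set R) = `[(- P + z)%R, P[ `|` `[P, (P + z)%R[.
  by apply/seteqP; split => x /=; rewrite !in_itv/=; lra.
have -> : cell P = `[(- P + z)%R, P[ `|` `[(- P)%R, (- P + z)%R[.
  by apply/seteqP; split => x; rewrite /cell /= !in_itv/=; lra.
rewrite !ge0_integral_setU//=; try exact: measurable_funTS; last 2 first.
- by rewrite disj_set2E; apply/eqP/seteqP; split => x //=; rewrite !in_itv/=; lra.
- by rewrite disj_set2E; apply/eqP/seteqP; split => x //=; rewrite !in_itv/=; lra.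
congr (_ + _).
have H : [set x | (`[P, (P + z)%R[%classic : set R) (x + 2 * P)%R] = `[(- P)%R, (- P + z)%R[%classic.
  by apply/seteqP; split => x /=; rewrite !in_itv/= => /andP[? ?]; apply/andP; split; lra.
rewrite -[LHS](@ge0_integral_translation_on (2 * P)%R)// H.

by apply: eq_integral => x _; rewrite gP.
Qed.

(** A long translation is an iterate of short ones. *)
Lemma integral_period_shift P g (z : R) : (0 < P)%R ->
  measurable_fun setT g -> (forall x, 0 <= g x) ->
  (forall x, g (x + 2 * P)%R = g x) ->
  \int[mu]_(x in cell P) g (x + z)%R = \int[mu]_(x in cell P) g x.
Proof.
move=> P0.
have mshift (c : R) (g' : R -> \bar R) : measurable_fun setT g' ->
    measurable_fun [set: R] (fun x : R => g' (x + c)%R).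
  by move=> mg'; apply: measurableT_comp => //; exact: measurable_addr.
have nn (n : nat) (y : R) : (0 <= y <= 2 * P)%R -> forall g',
    measurable_fun setT g' -> (forall x, 0 <= g' x) ->
    (forall x, g' (x + 2 * P)%R = g' x) ->
    \int[mu]_(x in cell P) g' (x + n%:R * y)%R = \int[mu]_(x in cell P) g' x.
  move=> y0; elim: n => [|n IH] g' mg' g0' gP'.
    by apply: eq_integral => x _; rewrite mul0r addr0.
  rewrite -[RHS](integral_period_shift_small y0)// -[RHS](IH (fun x => g' (x + y)%R)).
  - by apply: eq_integral => x _; congr (g' _); rewrite -natr1; ring.
  - exact: mshift.
  - by [].
  - by move=> x; rewrite addrAC gP'.
have pos (y : R) : (0 <= y)%R -> forall g',
    measurable_fun setT g' -> (forall x, 0 <= g' x) ->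
    (forall x, g' (x + 2 * P)%R = g' x) ->
    \int[mu]_(x in cell P) g' (x + y)%R = \int[mu]_(x in cell P) g' x.
  move=> y0 g' mg' g0' gP'.
  pose n := (Num.truncn (y / (2 * P))).+1.
  have n0 : (0 < n%:R :> R)%R by rewrite ltr0n.
  rewrite -[RHS](nn n (y / n%:R)%R)//.
    by apply: eq_integral => x _; congr (g' (_ + _)%R); field; rewrite gt_eqF.
  rewrite divr_ge0 ?ler0n//= ler_pdivrMr//.
  have := truncnS_gt (y / (2 * P)); rewrite -/n ltr_pdivrMr; last lra.
  by move/ltW; rewrite mulrC.
move=> mg g0 gP; have [z0|z0] := leP 0%R z; first exact: pos.
rewrite -(@pos (- z)%R _ (fun x => g (x + z)%R)).
- by apply: eq_integral => x _; rewrite addrNK.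
- lra.
- exact: mshift.
- by [].
- by move=> x; rewrite addrAC gP.
Qed.

End periodic.

#[global] Hint Extern 0 (measurable (cell _)) =>
  solve [exact: measurable_cell] : core.

(** * Doubled variables in diagonal coordinates *)

Section tonelli_product.
Local Open Scope ereal_scope.
Context d1 d2 (T1 : measurableType d1) (T2 : measurableType d2) (R : realType).
Variables (m1 : {sigma_finite_measure set T1 -> \bar R})
          (m2 : {sigma_finite_measure set T2 -> \bar R}).
Implicit Types (h : T1 * T2 -> \bar R).

Lemma integral_product_on h (A : set T1) (B : set T2) : measurable A -> measurable B ->
  measurable_fun setT h -> (forall z, 0 <= h z) ->
  \int[m1 \x m2]_(z in A `*` B) h z = \int[m1]_(x in A) \int[m2]_(y in B) h (x, y).
Proof.
move=> mA mB mh h0.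
rewrite [LHS]integral_mkcond fubini_tonelli1//; last 2 first.
  apply/(measurable_restrictT _ _).1 => //; first exact: measurableX.
  exact: measurable_funTS.
  by move=> x; apply: erestrict_ge0.
rewrite [RHS]integral_mkcond; apply: eq_integral => x _.
rewrite /fubini_F /patch; case: ifPn => xA.
  rewrite [RHS]integral_mkcond; apply: eq_integral => y _.
  rewrite /patch; congr (if _ then _ else _).
  by rewrite in_setX xA.
by rewrite integral0_eq// => y _; rewrite in_setX (negbTE xA).
Qed.

End tonelli_product.

(** Integrating out one coordinate at a time reduces the integral over a
    product to two partial integrals. *)
Lemma measurable_integral_product2 d1 d2 d3 (T1 : measurableType d1) (T2 : measurableType d2)
    (T3 : measurableType d3) (R : realType)
    (m2 : {sigma_finite_measure set T2 -> \bar R})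
    (m3 : {sigma_finite_measure set T3 -> \bar R}) (F : T1 * (T2 * T3) -> \bar R) :
  measurable_fun setT F -> (forall z, 0 <= F z)%E ->
  measurable_fun setT (fun p => \int[m2 \x m3]_q F (p, q))%E.
Proof.
move=> mF F0.
have -> : (fun p => \int[m2 \x m3]_q F (p, q))%E =
    (fun p => \int[m2]_s \int[m3]_y F (p, (s, y)))%E.
  apply/funext => p; rewrite -setXTT.
  apply: (@integral_product_on _ _ _ _ _ m2 m3 (fun q => F (p, q))) => //.
  by apply: measurableT_comp.
apply: (@measurable_partial_integral _ _ _ _ _ m2 (fun w : T1 * T2 => \int[m3]_y F (w.1, (w.2, y)))%E) => //.
  apply: (@measurable_partial_integral _ _ _ _ _ m3 (fun w : (T1 * T2) * T3 => F (w.1.1, (w.1.2, w.2)))) => //.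
  apply: measurableT_comp => //; repeat apply: measurable_fun_pair => //=;
  repeat apply: measurableT_comp => //.
by move=> w; apply: integral_ge0.
Qed.

Section tonelli4.
Local Open Scope ereal_scope.
Context d1 d2 d3 d4 (T1 : measurableType d1) (T2 : measurableType d2)
  (T3 : measurableType d3) (T4 : measurableType d4) (R : realType).
Variables (m1 : {sigma_finite_measure set T1 -> \bar R})
          (m2 : {sigma_finite_measure set T2 -> \bar R})
          (m3 : {sigma_finite_measure set T3 -> \bar R})
          (m4 : {sigma_finite_measure set T4 -> \bar R}).
Variable F : (T1 * T2) * (T3 * T4) -> \bar R.
Hypothesis mF : measurable_fun setT F.
Hypothesis F0 : forall z, 0 <= F z.

(** The times are moved outside: for fixed times only a double integral in
    space is left to rearrange. *)
Lemma tonelli4_left (A : set T2) : measurable A ->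
  \int[m1 \x m2]_(p in setT `*` A) \int[m3 \x m4]_q F (p, q) =
  \int[m1]_t \int[m3]_s \int[m2]_(x in A) \int[m4]_y F ((t, x), (s, y)).
Proof.
move=> mA.
etransitivity.
  apply: (@integral_product_on _ _ _ _ _ m1 m2 (fun p => \int[m3 \x m4]_q F (p, q))) => //.
  - exact: measurable_integral_product2.
  - by move=> p; apply: integral_ge0.
apply: eq_integral => t _.
have mFt : measurable_fun setT (fun w : (T2 * T3) * T4 => F ((t, w.1.1), (w.1.2, w.2))).
  apply: measurableT_comp; first exact: mF.
  repeat apply: measurable_fun_pair => //=.
    by apply: measurableT_comp.
  by apply: measurableT_comp.
transitivity (\int[m2]_(x in A) \int[m3]_s \int[m4]_y F ((t, x), (s, y))).
  apply: eq_integral => x _.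
  rewrite -setXTT.
  apply: (@integral_product_on _ _ _ _ _ m3 m4 (fun q => F ((t, x), q))) => //.
  by apply: measurableT_comp.
apply: (@tonelli_on _ _ _ _ _ m2 m3 (fun w => \int[m4]_y F ((t, w.1), (w.2, y)))) => //.
- exact: (measurable_partial_integral m4 _ mFt).
- by move=> w; apply: integral_ge0.
Qed.

Lemma tonelli4_right (B : set T4) : measurable B ->
  \int[m3 \x m4]_(q in setT `*` B) \int[m1 \x m2]_p F (p, q) =
  \int[m1]_t \int[m3]_s \int[m4]_(y in B) \int[m2]_x F ((t, x), (s, y)).
Proof.
move=> mB.
have mF' : measurable_fun setT (fun w => F (w.2, w.1)).
  by apply: measurableT_comp => //; exact: measurable_swap.
etransitivity.
  apply: (@integral_product_on _ _ _ _ _ m3 m4 (fun q => \int[m1 \x m2]_p F (p, q))) => //.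
  - exact: (measurable_integral_product2 m1 m2 mF').
  - by move=> p; apply: integral_ge0.
have mF1 : measurable_fun setT (fun w : ((T3 * T1) * T4) * T2 => F ((w.1.1.2, w.2), (w.1.1.1, w.1.2))).
  apply: measurableT_comp => //; repeat apply: measurable_fun_pair => //=;
  repeat apply: measurableT_comp => //.
transitivity (\int[m3]_s \int[m1]_t \int[m4]_(y in B) \int[m2]_x F ((t, x), (s, y))).
  apply: eq_integral => s _.
  transitivity (\int[m4]_(y in B) \int[m1]_t \int[m2]_x F ((t, x), (s, y))).
    apply: eq_integral => y _.
    rewrite -setXTT.
    apply: (@integral_product_on _ _ _ _ _ m1 m2 (fun p => F (p, (s, y)))) => //.
    by apply: measurableT_comp.
  apply: (@tonelli_on _ _ _ _ _ m4 m1 (fun w => \int[m2]_x F ((w.2, x), (s, w.1)))) => //.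
  - apply: (measurable_partial_integral m2 (h := fun w : (T4 * T1) * T2 => F ((w.1.2, w.2), (s, w.1.1)))) => //.
    apply: measurableT_comp => //; repeat apply: measurable_fun_pair => //=;
    repeat apply: measurableT_comp => //.
  - by move=> w; apply: integral_ge0.
apply: (@tonelli_on _ _ _ _ _ m3 m1 (fun w => \int[m4]_(y in B) \int[m2]_x F ((w.2, x), (w.1, y)))) => //.
- apply: (measurable_partial_integral m4 (h := fun w : (T3 * T1) * T4 => \int[m2]_x F ((w.1.2, x), (w.1.1, w.2)))) => //.
    exact: (measurable_partial_integral m2 _ mF1).
  by move=> w; apply: integral_ge0.
- by move=> w; apply: integral_ge0 => *; apply: integral_ge0.
Qed.

End tonelli4.

Section diagonal.
Local Open Scope ereal_scope.
Context {R : realType}.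
Local Notation mu := (@lebesgue_measure R).
Implicit Types (h : R * R -> \bar R) (P : R).

Lemma integral_diagonal_left P h : measurable_fun setT h -> (forall z, 0 <= h z) ->
  \int[mu]_(x in cell P) \int[mu]_y h (x, y) =
  \int[mu]_z \int[mu]_(x in cell P) h (x, x - z)%R.
Proof.
move=> mh h0.
etransitivity; last first.
  apply: (@tonelli_on _ _ _ _ _ mu mu (fun w => h (w.1, w.1 - w.2)%R)) => //.
  apply: measurableT_comp => //; apply: measurable_fun_pair => //=.
  by apply: measurable_funB.
apply: eq_integral => x _.
rewrite -(@ge0_integral_reflection _ (fun z => h (x, x - z)%R))//; last first.
  apply: measurableT_comp => //; apply: measurable_fun_pair => //=.
  by apply: measurable_funB.
rewrite -(@ge0_integral_translation _ x (fun y => h (x, y)%R))//; last first.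
  by apply: measurableT_comp.
by apply: eq_integral => z _; rewrite opprK addrC.
Qed.

(** Substituting x = y + z leaves the x-integral over a cell shifted by z;
    periodicity along the diagonal brings it back. *)
Lemma integral_diagonal_right P h : (0 < P)%R -> measurable_fun setT h ->
  (forall z, 0 <= h z) ->
  (forall x y, h (x + 2 * P, y + 2 * P)%R = h (x, y)) ->
  \int[mu]_(y in cell P) \int[mu]_x h (x, y) =
  \int[mu]_z \int[mu]_(x in cell P) h (x, x - z)%R.
Proof.
move=> P0 mh h0 hP.
transitivity (\int[mu]_(y in cell P) \int[mu]_z h (y + z, y)%R).
  apply: eq_integral => y _.
  rewrite -(@ge0_integral_translation _ y (fun x => h (x, y)%R))//; last first.
    by apply: measurableT_comp.
  by apply: eq_integral => z _; rewrite addrC.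
etransitivity.
  apply: (@tonelli_on _ _ _ _ _ mu mu (fun w => h (w.1 + w.2, w.1)%R)) => //.
  apply: measurableT_comp => //; apply: measurable_fun_pair => //=.
  by apply: measurable_funD.
apply: eq_integral => z _ /=.
rewrite -(@integral_period_shift _ P (fun x => h (x, x - z)%R) z)//.
- by apply: eq_integral => x _; rewrite addrK.
- apply: measurableT_comp => //; apply: measurable_fun_pair => //=.
  by apply: measurable_funB.
- by move=> x; rewrite addrAC hP.
Qed.

Local Notation mu2 := (mu \x mu).

(** Integration over one period of the doubled variables in the coordinates t,
    s, z = x - y and x. The variables x and y play the same part: either one
    may be confined to the cell ([doubled_left], [doubled_right]). *)
Definition doubled P (F : (R * R) * (R * R) -> \bar R) : \bar R :=
  \int[mu]_t \int[mu]_s \int[mu]_z \int[mu]_(x in cell P) F ((t, x), (s, x - z)%R).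

Lemma doubled_left P F : measurable_fun setT F -> (forall z, 0 <= F z) ->
  \int[mu2]_(p in setT `*` cell P) \int[mu2]_q F (p, q) = doubled P F.
Proof.
move=> mF F0; etransitivity.
  by apply: (@tonelli4_left _ _ _ _ _ _ _ _ _ mu mu mu mu F mF F0).
apply: eq_integral => t _; apply: eq_integral => s _.
apply: (@integral_diagonal_left _ (fun w => F ((t, w.1), (s, w.2)))) => //.
by apply: measurableT_comp => //; repeat apply: measurable_fun_pair => //=.
Qed.

Lemma doubled_right P F : (0 < P)%R -> measurable_fun setT F -> (forall z, 0 <= F z) ->
  (forall t x s y, F ((t, x + 2 * P), (s, y + 2 * P))%R = F ((t, x), (s, y))) ->
  \int[mu2]_(q in setT `*` cell P) \int[mu2]_p F (p, q) = doubled P F.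
Proof.
move=> P0 mF F0 FP; etransitivity.
  by apply: (@tonelli4_right _ _ _ _ _ _ _ _ _ mu mu mu mu F mF F0).
apply: eq_integral => t _; apply: eq_integral => s _.
apply: (@integral_diagonal_right _ (fun w => F ((t, w.1), (s, w.2)))) => //.
- by apply: measurableT_comp => //; repeat apply: measurable_fun_pair => //=.
- by move=> x y; exact: FP.
Qed.

End diagonal.

(** * The singular operator on functions with an L1 modulus of continuity *)

Section inverse.
Context {R : realType}.
Local Notation mu := (@lebesgue_measure R).

Lemma integral_inv_itv (c a b : R) : 0 < a -> a < b ->
  (\int[mu]_(y in `[a, b]) (c / y)%:E = (c * (ln b - ln a))%:E)%E.
Proof.
move=> a0 ab.
have b0 : 0 < b by exact: lt_trans ab.
have dF (y : R) : 0 < y -> is_derive y 1 (fun y => c * ln y) (c * y^-1).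
  by move=> y0; apply: is_deriveZ; exact: is_derive1_ln.
rewrite (@continuous_FTC2 _ (fun y => c / y) (fun y => c * ln y))//.
- by rewrite -EFinB mulrBr.
- apply: continuous_in_subspaceT => y; rewrite inE/= in_itv/= => /andP[ay _].
  apply: cvgM; first exact: cvg_cst.
  by apply: cvgV => //; rewrite gt_eqF//; exact: lt_le_trans ay.
- have dc (y : R) : 0 < y -> {for y, continuous (fun y => c * ln y)}.
    move=> y0; apply: differentiable_continuous; apply/derivable1_diffP.
    by have [] := dF y y0.
  split.
  + move=> y; rewrite in_itv/= => /andP[ay _].
    by have [] := dF y (lt_trans a0 ay).
  + by apply: cvg_at_right_filter; exact: dc.
  + by apply: cvg_at_left_filter; exact: dc.
- move=> y; rewrite in_itv/= => /andP[ay _].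
  by rewrite derive1E; have [_ ->] := dF y (lt_trans a0 ay).
Qed.

Lemma measurable_inv_itv (a b : R) : 0 < a -> measurable_fun `[a, b] (fun y : R => y^-1).
Proof.
move=> a0; apply: (@measurable_funS _ _ _ _ (`]0, b + 1[%classic : set R)) => //.
  by move=> y /=; rewrite !in_itv/= => /andP[? ?]; apply/andP; split; lra.
apply: open_continuous_measurable_fun; first exact: itv_open.
move=> y; rewrite inE/= in_itv/= => /andP[y0 _].
by apply: inv_continuous; rewrite gt_eqF.
Qed.

End inverse.

Section kernel.
Context {R : realType}.
Local Notation mu := (@lebesgue_measure R).
Variables (P : R) (K : R -> R) (CK : R).
Hypothesis P0 : 0 < P.
Hypothesis K1 : forall x, kernel_domain P x -> derivable K x 1 /\ {for x, continuous (derive1 K)}.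
Hypothesis Kodd : forall x, kernel_domain P x -> K (- x) = - K x.
Hypothesis CK0 : 0 < CK.
Hypothesis Kbd : forall (i : nat) (x : R), (i <= 1)%N -> - P <= x <= P -> x != 0 ->
          `|derive1n i K x| <= CK / `|x| ^+ i.+1.

(** A convolution kernel on the whole line which contributes exactly one
    punctured period of K. *)
Definition cut_kernel (y : R) : R := if (0 < `|y|) && (`|y| < P) then K y else 0.

Lemma kernel_domain_small (y : R) : 0 < `|y| -> `|y| < P -> kernel_domain P y.
Proof.
move=> y0 yP n; apply/eqP => yE; move: y0 yP.
rewrite yE; have [->|n0] := eqVneq n 0; first by rewrite mulr0 normr0 ltxx.
move=> _; apply/negP; rewrite -leNgt normrM.
have n1 : 1 <= `|n%:~R : R| by rewrite -intr_norm ler1z -gtz0_ge1 normr_gt0.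
have -> : `|2 * P| = 2 * P by apply: gtr0_norm; rewrite mulr_gt0.
move: n1; move: `|n%:~R : R| => z z1.
by have := ler_wpM2l (ltW P0) z1; rewrite mulr1 -mulrA; have := P0; lra.
Qed.

Lemma cut_kernel0 : cut_kernel 0 = 0. Proof. by rewrite /cut_kernel normr0 ltxx. Qed.

Lemma cut_kernelN y : cut_kernel (- y) = - cut_kernel y.
Proof.
rewrite /cut_kernel normrN; case: ifP => [/andP[y0 yP]|]; last by rewrite oppr0.
by rewrite Kodd//; exact: kernel_domain_small.
Qed.

Lemma cut_kernel_bound y : `|cut_kernel y| * `|y| <= CK.
Proof.
rewrite /cut_kernel; case: ifP => [/andP[y0 yP]|_]; last by rewrite normr0 mul0r ltW.
have yn0 : y != 0 by rewrite -normr_gt0.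
have := @Kbd 0 y isT; rewrite /= expr1 => /(_ _ yn0) H.
rewrite -ler_pdivlMr//; apply: H.
by rewrite -ler_norml ltW.
Qed.

Lemma cut_kernel_out y : P <= `|y| -> cut_kernel y = 0.
Proof. by rewrite /cut_kernel (ltNge `|y| P) => ->; rewrite andbF. Qed.

Lemma measurable_cut_kernel : measurable_fun [set: R] cut_kernel.
Proof.
pose D : set R := [set y | 0 < `|y| < P].
have oD : open D.
  have -> : D = `]0, P[ `|` `]- P, 0[.
    apply/seteqP; split => y; rewrite /D /= !in_itv/=.
      move=> /andP[y0 yP]; have [yp|yn] := ltP 0 y; [left|right].
        by rewrite gtr0_norm in yP.
      by move: y0 yP; rewrite ler0_norm// => ? ?; apply/andP; split; lra.
    move=> [|] /andP[? ?]; first by rewrite gtr0_norm//; apply/andP; split; lra.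
    by rewrite ltr0_norm//; apply/andP; split; lra.
  by apply: openU; exact: itv_open.
have mD : measurable D by exact: open_measurable.
have -> : cut_kernel = K \_ D.
  by apply/funext => y; rewrite /cut_kernel /patch mem_setE.
apply/(measurable_restrictT _ _).1 => //.
apply: open_continuous_measurable_fun => // y; rewrite inE /D/= => /andP[y0 yP].
apply: differentiable_continuous; apply/derivable1_diffP.
exact: (proj1 (K1 (kernel_domain_small y0 yP))).
Qed.

(** Since K is odd, subtracting w x does not change the symmetric truncations,
    and it makes the integral absolutely convergent wherever [abs_singular] is
    finite. *)
Definition singular (w : R -> R) (x : R) : R := \int[mu]_y (cut_kernel y * (w (x - y) - w x)).

Definition abs_singular (w : R -> R) (x : R) : \bar R :=
  (\int[mu]_y (`|cut_kernel y| * `|w (x - y) - w x|)%:E)%E.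

Lemma integrable_singular w x : measurable_fun [set: R] w -> (abs_singular w x < +oo)%E ->
  mu.-integrable setT (fun y => (cut_kernel y * (w (x - y) - w x))%:E).
Proof.
move=> mw wx; apply/integrableP; split.
  have mK := measurable_cut_kernel.
  by mfun.
rewrite (_ : (\int[_]_(_ in _) _)%E = abs_singular w x)//.
by apply: eq_integral => y _; rewrite /= normrM.
Qed.

Lemma singular_sub_le w1 w2 x : measurable_fun [set: R] w1 -> measurable_fun [set: R] w2 ->
  (abs_singular w1 x < +oo)%E -> (abs_singular w2 x < +oo)%E ->
  (`|singular w1 x - singular w2 x|%:E <= abs_singular (fun y => w1 y - w2 y)%R x)%E.
Proof.
move=> mw1 mw2 h1 h2.
have i1 := integrable_singular mw1 h1; have i2 := integrable_singular mw2 h2.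
rewrite /singular -RintegralB//.
have i12 : mu.-integrable setT (EFin \o (fun y => cut_kernel y * (w1 (x - y) - w1 x) - cut_kernel y * (w2 (x - y) - w2 x))).
  exact: (integrableB _ i1 i2).
apply: (@le_trans _ _ (\int[mu]_y `|cut_kernel y * (w1 (x - y) - w1 x) - cut_kernel y * (w2 (x - y) - w2 x)|)%:E).
  by rewrite lee_fin; exact: le_normr_Rintegral.
rewrite /Rintegral fineK; last first.
  apply: integrable_fin_num => //.
  exact: (integrable_norm i12).
rewrite le_eqVlt; apply/orP; left; apply/eqP; apply: eq_integral => y _.
by rewrite -mulrBr normrM; congr (_ * `|_|)%:E; ring.
Qed.

(** The y-integral is split at |y| = P e^{-m}. Below, the modulus of
    continuity cancels the singularity CK / |y|; above, w (x - y) and w x each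
    cost L, and the integral of 1 / |y| is m on each side. The parameter m
    stays free; m = log (1 / L) would give a bound of order L log (1 / L). *)
Lemma integral_abs_singular_le (w : R -> R) (D L m : R) :
  measurable_fun [set: R] w -> (forall x, w (x + 2 * P) = w x) ->
  (forall h, `|h| <= P -> (\int[mu]_(x in cell P) `|w (x + h) - w x|%:E <= (D * `|h|)%:E)%E) ->
  0 <= D -> 0 < m -> (\int[mu]_(x in cell P) `|w x|%:E <= L%:E)%E ->
  (\int[mu]_(x in cell P) abs_singular w x <=
    (2 * CK * D * P * expR (- m) + 4 * CK * L * m)%:E)%E.
Proof.
move=> mw wP wD D0 m0 wL.
have mK := measurable_cut_kernel.
have L0 : 0 <= L.
  by rewrite -lee_fin (le_trans _ wL)//; apply: integral_ge0 => x _; rewrite lee_fin.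
(* With this cut-off the integral of 1 / y over [d, P] is m. *)
pose d := P * expR (- m).
have d0 : 0 < d by rewrite mulr_gt0// expR_gt0.
have dP : d < P by rewrite /d gtr_pMr// expR_lt1 oppr_lt0.
rewrite /abs_singular.
rewrite (@tonelli_on _ _ _ _ _ mu mu (fun z => (`|cut_kernel z.2| * `|w (z.1 - z.2) - w z.1|)%:E))//; last first.
  by mfun.
pose f1 : R -> \bar R := (cst (CK * D)%:E) \_ `]- d, d[.
pose g : R -> \bar R := (fun y => (2 * L * CK / y)%:E) \_ `[d, P].
have mf1 : measurable_fun [set: R] f1 by apply/(measurable_restrictT _ _).1.
have mg : measurable_fun [set: R] g.
  apply/(measurable_restrictT _ _).1 => //; apply/measurable_EFinP.
  mstep; first exact: measurable_cst.
  exact: measurable_inv_itv.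
have f10 y : (0 <= f1 y)%E.
  by apply: erestrict_ge0 => ? _; rewrite lee_fin mulr_ge0// ltW.
have g0 y : (0 <= g y)%E.
  apply: erestrict_ge0 => x /=; rewrite in_itv/= => /andP[dx _].
  rewrite lee_fin; apply: divr_ge0; last exact: ltW (lt_le_trans d0 dx).
  by rewrite !mulr_ge0// ltW.
have mgN : measurable_fun [set: R] (fun y => g (- y)).
  by apply: measurableT_comp => //; exact: oppr_measurable.
apply: (@le_trans _ _ (\int[mu]_y (f1 y + (g y + g (- y)%R)))%E).
  apply: ge0_le_integral => //.
  - by move=> y _; apply: integral_ge0 => x _; rewrite lee_fin mulr_ge0.
  - apply: (@measurable_partial_integral _ _ _ _ _ mu (fun z => (`|cut_kernel z.1| * `|w (z.2 - z.1) - w z.2|)%:E)) => //.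
    by mfun.
  - by apply: emeasurable_funD => //; exact: emeasurable_funD.
  move=> y _.
  under eq_integral do rewrite /= EFinM.
  rewrite ge0_integralZl_EFin//=; last first.
    by apply/measurable_EFinP; apply: measurable_funTS; mfun.
  have [yd|dy] := ltP `|y| d.
    apply: (@le_trans _ _ (f1 y)); last by rewrite leeDl// adde_ge0.
    rewrite /f1 /patch ifT; last by rewrite inE/= in_itv/= -ltr_norml.
    apply: (@le_trans _ _ (`|cut_kernel y|%:E * (D * `|y|)%:E)%E).
      rewrite lee_wpmul2l//; have := wD (- y); rewrite normrN; apply.
      by rewrite ltW// (lt_trans yd).
    rewrite -EFinM lee_fin mulrCA [leRHS]mulrC ler_wpM2l//.
    by apply: cut_kernel_bound.
  have [yP|Py] := ltP `|y| P; last first.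
    by rewrite cut_kernel_out// normr0 mul0e !adde_ge0.
  have y0 : 0 < `|y| by exact: lt_le_trans dy.
  have gE : (2 * L * CK / `|y|)%:E = (g y + g (- y)%R)%E.
    rewrite /g /patch; have [yp|yn] := ltP 0 y.
      rewrite (gtr0_norm yp) in dy yP *.
      rewrite ifT; last by rewrite inE/= in_itv/= dy ltW.
      rewrite ifF ?adde0//; apply/negbTE/negP; rewrite inE/= in_itv/=; lra.
    rewrite (ler0_norm yn) in dy yP *.
    rewrite ifF ?add0e; last by apply/negbTE/negP; rewrite inE/= in_itv/=; lra.
    by rewrite ifT// inE/= in_itv/= dy ltW.
  rewrite -gE.
  apply: (@le_trans _ _ (2 * L * CK / `|y|)%:E); last by rewrite leeDr.
  apply: (@le_trans _ _ (`|cut_kernel y|%:E * (2 * L)%:E)%E).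
    rewrite lee_wpmul2l//.
    apply: (@le_trans _ _ (\int[mu]_(x in cell P) (`|w (x - y)|%:E + `|w x|%:E))%E).
      apply: ge0_le_integral => //.
      - by apply/measurable_EFinP; apply: measurable_funTS; mfun.
      - by apply: emeasurable_funD; apply/measurable_EFinP; apply: measurable_funTS; mfun.
      - by move=> x _; rewrite -EFinD lee_fin; exact: ler_normB.
    rewrite ge0_integralD//; last 2 first.
      by apply/measurable_EFinP; apply: measurable_funTS; mfun.
      by apply/measurable_EFinP; apply: measurable_funTS; mfun.
    rewrite (@integral_period_shift _ P (fun x => `|w x|%:E) (- y))//; last 2 first.
      by apply/measurable_EFinP; mfun.
      by move=> x; rewrite wP.
    by rewrite mulr_natl mulr2n EFinD leeD.
  rewrite -EFinM lee_fin ler_pdivlMr// mulrAC mulrC ler_wpM2l ?mulr_ge0//.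
  by apply: cut_kernel_bound.
rewrite ge0_integralD//; last 2 first.
  by move=> y _; rewrite adde_ge0.
  exact: emeasurable_funD.
rewrite ge0_integralD// (ge0_integral_reflection mg g0).
have I1 : (\int[mu]_y f1 y = (CK * D * (2 * d))%:E)%E.
  rewrite /f1 -integral_mkcond integral_cst//= lebesgue_measure_itv/= lte_fin ifT; last lra.
  by rewrite -EFinD -EFinM; congr (_ * _)%:E; ring.
rewrite I1 /g -!integral_mkcond integral_inv_itv//.
rewrite -!EFinD lee_fin /d lnM ?posrE ?expR_gt0// expRK.
by rewrite le_eqVlt; apply/orP; left; apply/eqP; ring.
Qed.

(** The integrand changes sign, so its positive and negative parts are
    integrated separately. *)
Lemma measurable_singular (uu : R * R -> R) : measurable_fun [set: R * R] uu ->
  measurable_fun [set: R * R] (fun z => singular (fun y => uu (z.1, y)) z.2).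
Proof.
move=> mu_.
have mK := measurable_cut_kernel.
pose h (w : (R * R) * R) : \bar R := (cut_kernel w.2 * (uu (w.1.1, w.1.2 - w.2) - uu (w.1.1, w.1.2)))%:E.
have mh : measurable_fun setT h by rewrite /h; mfun.
have -> : (fun z => singular (fun y => uu (z.1, y)) z.2) =
   fine \o (fun z => \int[mu]_y h^\+ (z, y) - \int[mu]_y h^\- (z, y))%E.
  by apply/funext => -[t x]; rewrite /= /singular /Rintegral [in LHS]integralE; congr (fine (_ - _)); apply: eq_integral => y _; rewrite ?funeposE ?funenegE.
have mf : measurable_fun [set: \bar R] (@fine R) by exact: fine_measurable.
apply: (measurableT_comp mf).
apply: emeasurable_funB.
  apply: (measurable_partial_integral mu measurableT) => //.
  exact: measurable_funepos.
apply: (measurable_partial_integral mu measurableT) => //.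
exact: measurable_funeneg.
Qed.

Local Notation A e := (`]- P, P[ `\` `]- e, e[)%classic.

Let AE e y : (A e) y <-> e <= `|y| < P.
Proof.
rewrite /= !in_itv/=; split.
  move=> [/andP[? ?] /negP]; rewrite -ltr_norml -leNgt => ->/=.
  by rewrite ltr_norml; apply/andP; split.
by move=> /andP[ey]; rewrite ltr_norml => ->; split => //; rewrite -ltr_norml; apply/negP; rewrite -leNgt.
Qed.

Let mA e : measurable (A e). Proof. exact: measurableD. Qed.

Lemma integral_odd_annulus e : (\int[mu]_(y in A e) cut_kernel y)%R = 0.
Proof.
have mK := measurable_cut_kernel.
rewrite /Rintegral integralE.
have -> : (\int[mu]_(x in A e) (fun x0 => (cut_kernel x0)%:E)^\- x =
           \int[mu]_(x in A e) (fun x0 => (cut_kernel x0)%:E)^\+ x)%E.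
  rewrite integral_mkcond [RHS]integral_mkcond -ge0_integral_reflection.
  - apply: eq_integral => y _; rewrite /patch.
    have -> : (- y \in A e) = (y \in A e).
      by apply/idP/idP; rewrite !inE => /AE; rewrite ?normrN => H; apply/AE; rewrite ?normrN.
    by case: ifP => // _; rewrite funeposE funenegE cut_kernelN// EFinN oppeK.
  - apply/(measurable_restrictT _ _).1 => //; apply: measurable_funTS.
    by apply: measurable_funeneg; apply/measurable_EFinP.
  - by move=> y; apply: erestrict_ge0.
by case: (integral _ _ _) => //= r; rewrite subrr.
Qed.

(** The subtracted term is w x times the integral of an odd function over a
    symmetric annulus. *)
Lemma truncated_singular (w : R -> R) x B e : measurable_fun [set: R] w -> (forall y, `|w y| <= B) ->
  0 < e ->
  \int[mu]_(y in A e) (K y * w (x - y)) =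
  \int[mu]_(y in A e) (cut_kernel y * (w (x - y) - w x)).
Proof.
move=> mw wB e0.
have mK := measurable_cut_kernel.
have B0 : 0 <= B by exact: le_trans (wB 0).
have Kb y : (A e) y -> `|cut_kernel y| <= CK / e.
  move=> /AE/andP[ey yP]; have y0 : 0 < `|y| by exact: lt_le_trans ey.
  apply: (@le_trans _ _ (CK / `|y|)); first by rewrite ler_pdivlMr//; apply: cut_kernel_bound.
  by rewrite ler_pM2l// lef_pV2.
have Afin : (mu (A e) < +oo)%E.
  apply: (@le_lt_trans _ _ (mu `]- P, P[)).
    by apply: le_measure; [rewrite inE; exact: mA|rewrite inE|exact: subDsetl].
  by rewrite /= lebesgue_measure_itv/=; case: ifP => _; rewrite ?ltry// -EFinD ltry.
have bint (g : R -> R) : measurable_fun setT g -> (forall y, (A e) y -> `|g y| <= CK / e * (2 * B + 1)) ->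
    mu.-integrable (A e) (EFin \o g).
  move=> mg gb; apply: measurable_bounded_integrable; [exact: mA|exact: Afin|exact: measurable_funTS|].
  exists (CK / e * (2 * B + 1)); split; first exact: num_real.
  by move=> M /ltW MB y Ay /=; exact: le_trans (gb _ Ay) MB.
have CKe : 0 <= CK / e by rewrite divr_ge0 ?ltW.
have i1 : mu.-integrable (A e) (EFin \o (fun y => cut_kernel y * (w (x - y) - w x))).
  apply: bint; first by mfun.
  move=> y Ay; rewrite normrM ler_pM//; first exact: Kb.
  have := ler_normB (w (x - y)) (w x); have := wB (x - y); have := wB x; lra.
have i2 : mu.-integrable (A e) (EFin \o cut_kernel).
  apply: bint => // y Ay; apply: le_trans (Kb _ Ay) _.
  by rewrite ler_peMr//; lra.
transitivity (\int[mu]_(y in A e) (cut_kernel y * (w (x - y) - w x) + w x * cut_kernel y)).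
  apply: eq_Rintegral => y; rewrite inE => /AE/andP[ey yP].
  have -> : cut_kernel y = K y by rewrite /cut_kernel yP (lt_le_trans e0 ey).
  by ring.
have i3 : mu.-integrable (A e) (EFin \o (fun y => w x * cut_kernel y)).
  rewrite (_ : EFin \o _ = (fun y => (w x)%:E * (EFin \o cut_kernel) y)%E)//.
  by apply: integrableZl; [exact: mA|exact: i2].
rewrite RintegralD; [|exact: mA|exact: i1|exact: i3].
rewrite RintegralZl; [|exact: mA|exact: i2].
by rewrite integral_odd_annulus mulr0 addr0.
Qed.

(** Dominated convergence: the truncated integrals share the integrand of
    [abs_singular] as a majorant. *)
Lemma Gper_singular (w : R -> R) x B : measurable_fun [set: R] w -> (forall y, `|w y| <= B) ->
  (abs_singular w x < +oo)%E -> Gper P K w x = singular w x.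
Proof.
move=> mw wB wx.
have mK := measurable_cut_kernel.
have iH := integrable_singular mw wx.
pose H y := cut_kernel y * (w (x - y) - w x).
apply: cvg_lim => //; apply/cvg_at_rightP => u [u0 ucvg].
have -> : (fun n => \int[mu]_(y in A (u n)) (K y * w (x - y))) =
   fine \o (fun n => \int[mu]_y ((EFin \o H) \_ (A (u n))) y)%E.
  apply/funext => n; rewrite (truncated_singular _ mw wB)//=.
  by rewrite /Rintegral integral_mkcond.
apply: fine_cvg; rewrite fineK; last exact: (integrable_fin_num _ iH).
have mH : measurable_fun setT (EFin \o H) by apply/measurable_EFinP; rewrite /H; mfun.
have h1 n : measurable_fun setT ((EFin \o H) \_ (A (u n))).
  apply/(measurable_restrictT _ _).1; [exact: mA|exact: measurable_funTS].
have h2 : {ae mu, forall y, [set: R] y -> ((EFin \o H) \_ (A (u n))) y @[n --> \oo] --> (EFin \o H) y}.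
  apply/aeW => y _; have [y0|] := ltP 0 `|y|; last first.
    rewrite normr_le0 => /eqP ->.
    have -> : (EFin \o H) 0 = 0%E by rewrite /H/= cut_kernel0 mul0r.
    apply: cvg_near_cst; apply: nearW => n; rewrite /patch; case: ifP => //= _.
    by rewrite /H cut_kernel0 mul0r.
  have [yP|Py] := ltP `|y| P; last first.
    apply: cvg_near_cst; apply: nearW => n; rewrite /patch; case: ifP => //= _.
    by rewrite /H cut_kernel_out// mul0r.
  apply: cvg_near_cst; move/cvgrPdist_lt : ucvg => /(_ _ y0) [N _ HN].
  exists N => // n /HN /=; rewrite sub0r normrN => un.
  rewrite /patch ifT// inE; apply/AE; rewrite yP andbT ltW//.
  exact: le_lt_trans (ler_norm _) un.
have h3 : mu.-integrable setT (fun y => `|(EFin \o H) y|)%E by exact: integrable_abse.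
have h4 : {ae mu, forall y n, [set: R] y ->
    (`| ((EFin \o H) \_ (A (u n))) y | <= `|(EFin \o H) y|)%E}.
  apply/aeW => y n _; rewrite /patch; case: ifP => //= _.
  by rewrite lee_fin normr0 normr_ge0.
by have [_ _] := @dominated_convergence _ _ _ mu setT measurableT _ (EFin \o H) _ h1 mH h2 h3 h4.
Qed.

End kernel.

(** * C1 bump functions *)

Section calculus.
Context {R : realType}.
Local Notation mu := (@lebesgue_measure R).

(** Carrying the derivative as a second argument keeps it explicit in the
    products and translates formed below. *)
Definition C1c (F F' : R -> R) : Prop :=
  [/\ forall x, is_derive x (1:R) F (F' x), continuous F' &
      exists M, forall x, M < `|x| -> F x = 0].

(** A quadratic remainder bound settles the piecewise quadratic functions
    below at their knots as well. *)
Lemma is_derive_quadratic (F : R -> R) (x l : R) :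
  (forall h, `|F (x + h) - F x - l * h| <= h ^+ 2) -> is_derive x (1:R) F l.
Proof.
move=> H.
have C : h^-1 *: (F (h *: (1:R) + x) - F x) @[h --> 0^'] --> l.
  apply/cvgrPdist_lt => e e0; near=> h.
  have h0 : h != 0 by near: h; exact: nbhs_dnbhs_neq.
  have he : `|h| < e by near: h; apply: dnbhs0_lt.
  have hp : 0 < `|h| by rewrite normr_gt0.
  rewrite distrC.
  have -> : h^-1 *: (F (h *: (1:R) + x) - F x) - l = h^-1 * (F (x + h) - F x - l * h).
    by rewrite /GRing.scale/= mulr1 (addrC h x); field.
  rewrite normrM normfV mulrC ltr_pdivrMr//.
  apply: le_lt_trans (H h) _.
  by rewrite -real_normK ?num_real// expr2 ltr_pM2r//.
split; first by apply/cvg_ex; exists l.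
by apply: cvg_lim.
Unshelve. all: by end_near. Qed.

(** The basic C1 spline, from which both the bumps and the steps are built. *)
Definition sqpos (x : R) : R := Num.max 0 x ^+ 2.

Lemma is_derive_sqpos (x : R) : is_derive x (1:R) sqpos (2 * Num.max 0 x).
Proof.
apply: is_derive_quadratic => h; rewrite /sqpos.
rewrite ler_norml !maxEle.
by case: (leP 0 x) => x0; case: (leP 0 (x + h)) => xh; apply/andP; split; nra.
Qed.

Lemma sqpos_ge0 x : 0 <= sqpos x. Proof. exact: sqr_ge0. Qed.

Lemma sqpos_eq0 x : x <= 0 -> sqpos x = 0.
Proof. by move=> x0; rewrite /sqpos max_l// expr0n. Qed.

Lemma sqpos_pos x : 0 <= x -> sqpos x = x ^+ 2.
Proof. by move=> x0; rewrite /sqpos max_r. Qed.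

Lemma is_derive_continuous (F : R -> R) (F' : R -> R) :
  (forall x, is_derive x (1:R) F (F' x)) -> continuous F.
Proof.
move=> dF x; apply: differentiable_continuous; apply/derivable1_diffP.
by have [] := dF x.
Qed.

Lemma continuous_max0 : continuous (fun x : R => Num.max 0 x).
Proof. by move=> x; apply: continuous_max; [exact: cvg_cst|exact: cvg_id]. Qed.

(** An even mollifier supported in [-a, a]. It is not normalised: its mass is
    a common factor of all terms of the doubled inequality. *)
Definition qbump (a t : R) : R := sqpos (a ^+ 2 - t ^+ 2).
Definition dqbump (a t : R) : R := - (2 * t) * (2 * Num.max 0 (a ^+ 2 - t ^+ 2)).

Lemma is_derive_qbump a t : is_derive t (1:R) (qbump a) (dqbump a t).
Proof.
have H : is_derive t (1:R) (fun t : R => a ^+ 2 - t ^+ 2) (- (2 * t)).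
  apply: is_derive_quadratic => h.
  by rewrite (_ : _ - _ = - h ^+ 2) ?normrN ?ger0_norm ?sqr_ge0//; ring.
rewrite /dqbump mulrC.
exact: (@is_derive1_comp _ sqpos _ _ _ _ (is_derive_sqpos _) H).
Qed.

End calculus.

(** * Doubled integrals of real densities *)

Section monotone.
Local Open Scope ereal_scope.
Context d (T : measurableType d) (R : realType) (mu : {measure set T -> \bar R}).

(** The integral of a nonnegative function is a supremum over the simple
    functions below it, hence monotone even without measurability. *)
Lemma ge0_le_integral_any (D : set T) (f g : T -> \bar R) :
  (forall x, D x -> 0 <= f x) -> (forall x, D x -> f x <= g x) ->
  \int[mu]_(x in D) f x <= \int[mu]_(x in D) g x.
Proof.
move=> f0 fg.
have g0 x : D x -> 0 <= g x by move=> Dx; exact: le_trans (f0 _ Dx) (fg _ Dx).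
rewrite !ge0_integralE//; apply: ereal_sup_le => _ [h hf <-]; exists h => //.
move=> x; apply: le_trans (hf x) _; rewrite /patch; case: ifPn => //.
by rewrite inE => Dx; exact: fg.
Qed.

End monotone.

Section doubled_density.
Local Open Scope ereal_scope.
Context {R : realType}.
Local Notation mu := (@lebesgue_measure R).
Local Notation mu2 := (mu \x mu).
Variable P : R.
Implicit Types F G : (R * R) * (R * R) -> R.

Definition doubledR F : \bar R := doubled P (EFin \o F).

Lemma doubledRE F : measurable_fun setT F -> (forall z, (0 <= F z)%R) ->
  doubledR F = \int[mu2]_(p in setT `*` cell P) \int[mu2]_q (F (p, q))%:E.
Proof.
by move=> mF F0; rewrite /doubledR -doubled_left//; exact/measurable_EFinP.
Qed.

Lemma doubledRD F G : measurable_fun setT F -> measurable_fun setT G ->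
  (forall z, (0 <= F z)%R) -> (forall z, (0 <= G z)%R) ->
  doubledR (fun z => F z + G z)%R = doubledR F + doubledR G.
Proof.
move=> mF mG F0 G0.
rewrite !doubledRE//; last 2 first.
- exact: measurable_funD.
- by move=> z; rewrite addr_ge0.
have mJ : measurable ([set: R] `*` cell P) by apply: measurableX.
have mi (H : (R * R) * (R * R) -> R) : measurable_fun setT H -> (forall z, (0 <= H z)%R) ->
   measurable_fun setT (fun p => \int[mu2]_q (H (p, q))%:E).
  move=> mH H0; apply: (@measurable_integral_product2 _ _ _ _ _ _ _ mu mu (EFin \o H)) => //.
  exact/measurable_EFinP.
rewrite -ge0_integralD//.
- apply: eq_integral => p _; rewrite -ge0_integralD//;
    first [by move=> q _; rewrite lee_fin
          | by apply/measurable_EFinP; apply: measurableT_comp].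
- by move=> p _; apply: integral_ge0 => q _; rewrite lee_fin.
- by apply: measurable_funTS; exact: mi.
- by move=> p _; apply: integral_ge0 => q _; rewrite lee_fin.
- by apply: measurable_funTS; exact: mi.
Qed.

Lemma le_doubledR F G : (forall z, (0 <= F z)%R) -> (forall z, (F z <= G z)%R) ->
  doubledR F <= doubledR G.
Proof.
move=> F0 FG; rewrite /doubledR /doubled.
apply: ge0_le_integral_any => [t _|t _].
  by do 3 apply: integral_ge0 => ? _; rewrite lee_fin.
apply: ge0_le_integral_any => [s _|s _].
  by do 2 apply: integral_ge0 => ? _; rewrite lee_fin.
apply: ge0_le_integral_any => [z _|z _].
  by apply: integral_ge0 => ? _; rewrite lee_fin.
by apply: ge0_le_integral_any => [x _|x _]; rewrite lee_fin.
Qed.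

Lemma doubledR_ge0 F : (forall z, (0 <= F z)%R) -> 0 <= doubledR F.
Proof. by move=> F0; do 4 apply: integral_ge0 => ? _; rewrite lee_fin. Qed.

(** The value of [doubled] when the integral over the cell has a product form. *)
Definition conv_bound (N w e : R -> R) : \bar R :=
  \int[mu]_t \int[mu]_s \int[mu]_z (N t * w (t - s) * e z)%:E.

Lemma doubledR_le F (N w e : R -> R) : (forall z, (0 <= F z)%R) ->
  (forall t s z, \int[mu]_(x in cell P) (F ((t, x), (s, x - z)))%:E <= (N t * w (t - s) * e z)%:E) ->
  doubledR F <= conv_bound N w e.
Proof.
move=> F0 FN; rewrite /doubledR /doubled.
apply: ge0_le_integral_any => [t _|t _].
  by do 3 apply: integral_ge0 => ? _; rewrite lee_fin.
apply: ge0_le_integral_any => [s _|s _].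
  by do 2 apply: integral_ge0 => ? _; rewrite lee_fin.
apply: ge0_le_integral_any => [z _|z _] //=.
by apply: integral_ge0 => ? _; rewrite lee_fin.
Qed.

Lemma doubledR_eq F (N w e : R -> R) :
  (forall t s z, \int[mu]_(x in cell P) (F ((t, x), (s, x - z)))%:E = (N t * w (t - s) * e z)%:E) ->
  doubledR F = conv_bound N w e.
Proof.
move=> FN; rewrite /doubledR /doubled.
by do 3 (apply: eq_integral => ? _); rewrite -FN.
Qed.

Lemma conv_boundE (N w e : R -> R) (cw ce : R) :
  measurable_fun setT N -> measurable_fun setT w -> measurable_fun setT e ->
  (forall t, (0 <= N t)%R) -> (forall t, (0 <= w t)%R) -> (forall t, (0 <= e t)%R) ->
  \int[mu]_t (w t)%:E = cw%:E -> \int[mu]_t (e t)%:E = ce%:E ->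
  conv_bound N w e = (cw * ce)%:E * \int[mu]_t (N t)%:E.
Proof.
move=> mN mw me N0 w0 e0 wE eE.
have cw0 : (0 <= cw)%R by rewrite -lee_fin -wE; apply: integral_ge0 => ? _; rewrite lee_fin.
have ce0 : (0 <= ce)%R by rewrite -lee_fin -eE; apply: integral_ge0 => ? _; rewrite lee_fin.
rewrite -ge0_integralZl_EFin//; last 3 first.
- by move=> t _; rewrite lee_fin.
- exact/measurable_EFinP.
- exact: mulr_ge0.
apply: eq_integral => t _.
transitivity (\int[mu]_s ((N t * ce)%:E * (w (t - s))%:E)).
  apply: eq_integral => s _.
  under eq_integral do rewrite EFinM.
  rewrite ge0_integralZl_EFin//.
  - by rewrite eE -!EFinM mulrAC.
  - by move=> z _; rewrite lee_fin.
  - exact/measurable_EFinP.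
  - exact: mulr_ge0.
rewrite ge0_integralZl_EFin//; last 3 first.
- by move=> s _; rewrite lee_fin.
- by apply/measurable_EFinP; mfun.
- exact: mulr_ge0.
have -> : \int[mu]_s (w (t - s))%:E = cw%:E.
  rewrite -wE -(@ge0_integral_reflection _ (fun s => (w (t - s))%:E)).
  - rewrite -[RHS](@ge0_integral_translation _ t (fun s => (w s)%:E)).
    + by apply: eq_integral => s _; rewrite opprK addrC.
    + exact/measurable_EFinP.
    + by move=> s; rewrite lee_fin.
  - by apply/measurable_EFinP; mfun.
  - by move=> s; rewrite lee_fin.
by rewrite -!EFinM; congr EFin; ring.
Qed.

(** Finiteness allows the cancellation of terms in extended arithmetic
    ([lee_cancel]). *)
Lemma doubledR_lty F (G T b : R) : (0 <= T)%R -> (0 <= b)%R -> (0 <= G)%R ->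
  (forall z, (0 <= F z)%R) ->
  (forall t x s y, F ((t, x), (s, y)) != 0%R -> [/\ (0 <= t <= T)%R, (0 <= s <= T)%R & (`|x - y| <= b)%R]) ->
  (forall t s z, \int[mu]_(x in cell P) (F ((t, x), (s, x - z)))%:E <= G%:E) ->
  doubledR F < +oo.
Proof.
move=> T0 b0 G0 F0 Fsupp FG.
pose i (a c : R) : R -> \bar R := (cst 1) \_ `[a, c].
have ig0 a c x : 0 <= i a c x by apply: erestrict_ge0.
have iI a c : (a <= c)%R -> \int[mu]_x i a c x = (c - a)%:E.
  move=> ac; rewrite -integral_mkcond integral_cst// mul1e/= lebesgue_measure_itv/= lte_fin.
  have [ac'|ca] := ltP a c; first by rewrite EFinB.
  by have -> : c = a by [apply/eqP; rewrite eq_le ca ac]; rewrite subrr.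
have mi a c : measurable_fun setT (i a c) by apply/(measurable_restrictT _ _).1.
have i0 (a c k : R) : (0 <= k)%R -> (a <= c)%R -> \int[mu]_x (k%:E * i a c x) = (k * (c - a))%:E.
  by move=> k0 ac; rewrite ge0_integralZl_EFin ?iI//; exact: mi.
apply: (@le_lt_trans _ _ (\int[mu]_t ((T * (2 * b * G))%:E * i 0%R T t))); last first.
  by rewrite i0// ?ltry// !mulr_ge0.
rewrite /doubledR /doubled; apply: ge0_le_integral_any => [t _|t _].
  by do 3 apply: integral_ge0 => ? _; rewrite lee_fin.
have [tT|tT] := boolP (0 <= t <= T)%R; last first.
  rewrite [leLHS](_ : _ = 0); first by rewrite mule_ge0// lee_fin !mulr_ge0.
  apply: integral0_eq => s _; apply: integral0_eq => z _; apply: integral0_eq => x _ /=.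
  by apply/eqP; rewrite eqe; apply: contraNT tT => /Fsupp[].
have -> : i 0%R T t = 1 by rewrite /i /patch ifT// inE/= in_itv.
rewrite mule1 (_ : (T * (2 * b * G))%:E = \int[mu]_s ((2 * b * G)%:E * i 0%R T s)); last first.
  by rewrite i0 ?subr0 1?mulrC// !mulr_ge0.
apply: ge0_le_integral_any => [s _|s _].
  by do 2 apply: integral_ge0 => ? _; rewrite lee_fin.
have [sT|sT] := boolP (0 <= s <= T)%R; last first.
  rewrite [leLHS](_ : _ = 0); first by rewrite mule_ge0// lee_fin !mulr_ge0.
  apply: integral0_eq => z _; apply: integral0_eq => x _ /=.
  by apply/eqP; rewrite eqe; apply: contraNT sT => /Fsupp[].
have -> : i 0%R T s = 1 by rewrite /i /patch ifT// inE/= in_itv.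
rewrite mule1 (_ : (2 * b * G)%:E = \int[mu]_z (G%:E * i (- b)%R b z)); last first.
  rewrite i0//; first by congr EFin; ring.
  by lra.
apply: ge0_le_integral_any => [z _|z _].
  by apply: integral_ge0 => ? _; rewrite lee_fin.
have [zb|zb] := boolP (`|z| <= b)%R; last first.
  rewrite [leLHS](_ : _ = 0); first by rewrite mule_ge0// lee_fin.
  apply: integral0_eq => x _ /=.
  apply/eqP; rewrite eqe; apply: contraNT zb => /Fsupp[_ _].
  by rewrite opprB addrC subrK.
have -> : i (- b)%R b z = 1 by rewrite /i /patch ifT// inE/= in_itv/= -ler_norml.
by rewrite mule1; exact: FG.
Qed.

End doubled_density.

(** * Estimates for bumps and signs *)

Section bump_estimates.
Context {R : realType}.
Local Notation mu := (@lebesgue_measure R).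

(** An inequality without subtraction can be integrated once more with no
    integrability to check. *)
Lemma integral_ge0_parts d (T : measurableType d) (m : {measure set T -> \bar R}) (phi : T -> R) :
  (0 <= \int[m]_z (phi z)%:E)%E ->
  (\int[m]_z (Num.max (- phi z) 0)%:E <= \int[m]_z (Num.max (phi z) 0)%:E)%E.
Proof.
rewrite integralE.
have -> : (\int[m]_x (fun x0 => (phi x0)%:E)^\+ x = \int[m]_z (Num.max (phi z) 0)%:E)%E.
  by apply: eq_integral => z _; rewrite funeposE EFin_max.
have -> : (\int[m]_x (fun x0 => (phi x0)%:E)^\- x = \int[m]_z (Num.max (- phi z) 0)%:E)%E.
  by apply: eq_integral => z _; rewrite funenegE EFin_max.
set X := (\int[m]_z (Num.max (phi z) 0)%:E)%E.
have : (0 <= \int[m]_z (Num.max (- phi z) 0)%:E)%E.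
  by apply: integral_ge0 => z _; rewrite lee_fin le_max lexx orbT.
case: (integral _ _ _) => [r| |] //= r0 H.
  by rewrite -sube_ge0//.
by move: H; rewrite addeNy.
Qed.

Lemma measurable_sg : measurable_fun [set: R] (@Num.sg R).
Proof.
apply: nondecreasing_measurable => // x y xy.
by case: (sgrP x) xy; case: (sgrP y) => //; lra.
Qed.

Lemma normM_le (x y X Y : R) : `|x| <= X -> `|y| <= Y -> `|x * y| <= X * Y.
Proof. by move=> xX yY; rewrite normrM ler_pM. Qed.

Lemma norm_sg_le (x : R) : `|Num.sg x| <= 1.
Proof. by rewrite normr_sg; case: (x != 0); rewrite ?ler01. Qed.

Lemma qbump_ge0 (a t : R) : 0 <= qbump a t. Proof. exact: sqpos_ge0. Qed.

Lemma qbump_supp (a t : R) : 0 < a -> a <= `|t| -> qbump a t = 0 /\ dqbump a t = 0.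
Proof.
move=> a0 at_; have h : a ^+ 2 - t ^+ 2 <= 0.
  by rewrite subr_le0 -(real_normK (num_real t)) ler_sqr ?nnegrE ?normr_ge0 ?(ltW a0).
by split; [exact: sqpos_eq0|rewrite /dqbump max_l// !mulr0].
Qed.

Lemma qbump_bound (a t : R) : 0 < a ->
  `|qbump a t| <= a ^+ 4 + 4 * a ^+ 3 /\ `|dqbump a t| <= a ^+ 4 + 4 * a ^+ 3.
Proof.
move=> a0.
have p4 : 0 <= a ^+ 4 by apply: exprn_ge0; exact: ltW.
have p3 : 0 <= 4 * a ^+ 3 by apply: mulr_ge0 => //; apply: exprn_ge0; exact: ltW.
have [ta|at_] := ltP `|t| a; last first.
  by have [-> ->] := qbump_supp a0 at_; rewrite normr0; split; exact: addr_ge0.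
have t2 : 0 <= t ^+ 2 by exact: sqr_ge0.
have h : t ^+ 2 < a ^+ 2.
  by rewrite -(real_normK (num_real t)) ltr_sqr ?nnegrE ?normr_ge0 ?(ltW a0).
split.
  rewrite ger0_norm ?qbump_ge0// /qbump sqpos_pos; last lra.
  apply: (@le_trans _ _ (a ^+ 4)); last by rewrite lerDl.
  rewrite (_ : a ^+ 4 = (a ^+ 2) ^+ 2); last by rewrite -exprM.
  by rewrite ler_sqr ?nnegrE; lra.
rewrite /dqbump max_r; last lra.
rewrite normrM normrN (normrM 2 t) (ger0_norm (_ : 0 <= 2))// (ger0_norm (_ : 0 <= 2 * _)); last lra.
apply: (@le_trans _ _ (4 * a ^+ 3)); last by rewrite lerDr.
rewrite (_ : 4 * a ^+ 3 = (2 * a) * (2 * a ^+ 2)); last ring.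
by apply: ler_pM; [exact: mulr_ge0|lra|have := ltW ta; lra|lra].
Qed.

Lemma measurable_qbump a : measurable_fun [set: R] (qbump a).
Proof.
apply: continuous_measurable_fun.
exact: (is_derive_continuous (is_derive_qbump a)).
Qed.

Lemma continuous_dqbump (a : R) : continuous (dqbump a).
Proof.
have C (t : R) : {for t, continuous ((fun x : R => Num.max 0 x) \o (fun t : R => a ^+ 2 - t ^+ 2))}.
  apply: continuous_comp; last exact: continuous_max0.
  by apply: cvgB; [exact: cvg_cst|exact: exprn_continuous].
move=> t; rewrite /dqbump; apply: cvgM.
  by apply: cvgN; apply: cvgM; [exact: cvg_cst|exact: cvg_id].
by apply: cvgM; [exact: cvg_cst|exact: C].
Qed.

Lemma measurable_dqbump (a : R) : measurable_fun [set: R] (dqbump a).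
Proof. by apply: continuous_measurable_fun; exact: continuous_dqbump. Qed.

Lemma qbump_integral (a : R) : 0 < a ->
  exists2 c : R, 0 < c & (\int[mu]_t (qbump a t)%:E = c%:E)%E.
Proof.
move=> a0.
have mb : measurable_fun [set: R] (EFin \o qbump a).
  by apply/measurable_EFinP; exact: measurable_qbump.
have I0 : (0 <= \int[mu]_t (qbump a t)%:E)%E.
  by apply: integral_ge0 => t _; rewrite lee_fin qbump_ge0.
have fin : (\int[mu]_t (qbump a t)%:E < +oo)%E.
  apply: (@le_lt_trans _ _ (\int[mu]_t ((cst (a ^+ 4 + 4 * a ^+ 3)%:E \_ `[(- a)%R, a]) t))%E).
    apply: ge0_le_integral_any => [t _|t _]; first by rewrite lee_fin qbump_ge0.
    rewrite /patch; case: ifPn => [_|]; first by rewrite lee_fin (le_trans (ler_norm _))//; have [] := qbump_bound t a0.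
    rewrite notin_setE/= in_itv/= -ler_norml => /negP; rewrite -ltNge => /ltW at_.
    by have [-> _] := qbump_supp a0 at_.
  rewrite -integral_mkcond integral_cst//= lebesgue_measure_itv/=.
  by case: ifP => _; rewrite -?EFinD -?EFinM ltry.
have pos : (0 < \int[mu]_t (qbump a t)%:E)%E.
  apply: (@lt_le_trans _ _ (\int[mu]_t ((cst (((3 / 4) * a ^+ 2) ^+ 2)%:E \_ `[0%R, (a / 2)%R]) t))%E).
    rewrite -integral_mkcond integral_cst//= lebesgue_measure_itv/= lte_fin ifT; last lra.
    rewrite -EFinB -EFinM lte_fin subr0 mulr_gt0//; last lra.
    by rewrite exprn_gt0// mulr_gt0// exprn_gt0.
  apply: ge0_le_integral_any => [t _|t _].
    by apply: erestrict_ge0 => ? _ /=; rewrite lee_fin sqr_ge0.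
  rewrite /patch; case: ifPn => [|_]; last by rewrite lee_fin qbump_ge0.
  rewrite inE/= in_itv/= => /andP[t0 ta]; rewrite lee_fin /qbump sqpos_pos; last by nra.
  by rewrite ler_sqr ?nnegrE; nra.
exists (fine (\int[mu]_t (qbump a t)%:E)%E); first by rewrite fine_gt0// pos fin.
by rewrite fineK// ge0_fin_numE.
Qed.

End bump_estimates.

(** * Doubling of variables *)

(** Adds two inequalities n <= p to a pointwise balance; the finite terms p
    dominate the terms n and cancel. *)
Lemma lee_cancel (R : realType) (p1 p2 n1 n2 e1 e2 : \bar R) :
  (p1 + p2 + e1 <= n1 + n2 + e2 -> n1 <= p1 -> n2 <= p2 -> p1 < +oo -> p2 < +oo ->
   0 <= p1 -> 0 <= p2 -> e1 <= e2)%E.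
Proof.
move=> H n1p n2p p1y p2y p10 p20.
have fin : (p1 + p2)%E \is a fin_num by rewrite fin_numD !ge0_fin_numE// p1y p2y.
by rewrite -(leeD2lE _ _ fin); apply: le_trans H _; rewrite leeD2r// leeD.
Qed.

(** The main term: both functions are taken at the same point w.1. [off_term]
    collects the error made in moving v from w.2 to w.1 and the difference of
    the sources. *)
Definition diag_term (R : realType) (u v : R * R -> R) (Y : R -> R) (a b : R)
    (w : (R * R) * (R * R)) : R :=
  `|u w.1 - v w.1| * Y w.1.1 * qbump a (w.1.1 - w.2.1) * qbump b (w.1.2 - w.2.2).

Definition off_term (R : realType) (u v gu gv : R * R -> R) (X X' : R -> R) (a b : R)
    (w : (R * R) * (R * R)) : R :=
  (`|v w.1 - v w.2| * `|X' w.1.1| + `|gu w.1 - gv w.2| * X w.1.1)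
   * qbump a (w.1.1 - w.2.1) * qbump b (w.1.2 - w.2.2).

Section doubling.
Context {R : realType}.
Local Notation mu := (@lebesgue_measure R).
Local Notation mu2 := (mu \x mu)%E.
Variables (P T : R) (f : R -> R).

(** Entropy inequalities for product test functions supported inside ]0, T[ in
    time. The source is a separate function, so that it may be replaced by one
    that is almost everywhere equal. *)
Definition entropic (u gu : R * R -> R) : Prop :=
  forall (k : R) (F F' H H' : R -> R), C1c F F' -> C1c H H' ->
    (forall t, 0 <= F t) -> (forall x, 0 <= H x) ->
    (exists2 c, 0 < c & forall t, F t != 0 -> c <= t <= T - c) ->
    (0 <= \int[mu2]_z (`|u z - k| * F' z.1 * H z.2
       + (f (u z) - f k) * Num.sg (u z - k) * F z.1 * H' z.2
       + gu z * Num.sg (u z - k) * F z.1 * H z.2)%:E)%E.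

Definition L1dist (g h : R * R -> R) (t : R) : R :=
  fine (\int[mu]_(x in cell P) `|g (t, x) - h (t, x)|%:E)%E.

Hypotheses (P0 : 0 < P) (T0 : 0 < T).
Variables (u v gu gv : R * R -> R) (B Bf G D : R).
Hypotheses (mf : measurable_fun [set: R] f)
  (m_u : measurable_fun [set: R * R] u) (m_v : measurable_fun [set: R * R] v)
  (m_gu : measurable_fun [set: R * R] gu) (m_gv : measurable_fun [set: R * R] gv).
Hypotheses (uB : forall z, `|u z| <= B) (vB : forall z, `|v z| <= B)
  (fB : forall y, `|y| <= B -> `|f y| <= Bf).
Hypotheses (uP : forall t x, u (t, x + 2 * P) = u (t, x))
  (vP : forall t x, v (t, x + 2 * P) = v (t, x))
  (guP : forall t x, gu (t, x + 2 * P) = gu (t, x))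
  (gvP : forall t x, gv (t, x + 2 * P) = gv (t, x)).
Hypotheses (guG : forall t, (\int[mu]_(x in cell P) `|gu (t, x)|%:E <= G%:E)%E)
  (gvG : forall t, (\int[mu]_(x in cell P) `|gv (t, x)|%:E <= G%:E)%E).
Hypotheses (ent_u : entropic u gu) (ent_v : entropic v gv).

Variables (X X' : R -> R) (c M a b : R).
Hypotheses (cX : C1c X X') (X0 : forall t, 0 <= X t) (c0 : 0 < c)
  (Xsupp : forall t, ~~ (2 * c <= t <= T - 2 * c) -> X t = 0 /\ X' t = 0)
  (a0 : 0 < a) (b0 : 0 < b) (ac : a <= c) (XM : forall t, `|X t| <= M /\ `|X' t| <= M)
  (aM : forall t, `|qbump a t| <= M /\ `|dqbump a t| <= M)
  (bM : forall t, `|qbump b t| <= M /\ `|dqbump b t| <= M).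

Local Notation om := (qbump a).
Local Notation om' := (dqbump a).
Local Notation et := (qbump b).
Local Notation et' := (dqbump b).

(** Entropy integrands of u with constant v w.2 and of v with constant u w.1,
    for the test function X(t) om(t - s) et(x - y). The derivatives of om in t
    and s are opposite, and so are those of et in x and y: they cancel in the
    sum. *)
Let Phi1 (w : (R * R) * (R * R)) : R :=
  `|u w.1 - v w.2| * (X' w.1.1 * om (w.1.1 - w.2.1) + X w.1.1 * om' (w.1.1 - w.2.1))
     * et (w.1.2 - w.2.2)
  + (f (u w.1) - f (v w.2)) * Num.sg (u w.1 - v w.2)
     * (X w.1.1 * om (w.1.1 - w.2.1)) * et' (w.1.2 - w.2.2)
  + gu w.1 * Num.sg (u w.1 - v w.2) * (X w.1.1 * om (w.1.1 - w.2.1)) * et (w.1.2 - w.2.2).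

Let Phi2 (w : (R * R) * (R * R)) : R :=
  `|v w.2 - u w.1| * (- (X w.1.1 * om' (w.1.1 - w.2.1))) * et (w.1.2 - w.2.2)
  + (f (v w.2) - f (u w.1)) * Num.sg (v w.2 - u w.1)
     * (X w.1.1 * om (w.1.1 - w.2.1)) * (- et' (w.1.2 - w.2.2))
  + gv w.2 * Num.sg (v w.2 - u w.1) * (X w.1.1 * om (w.1.1 - w.2.1)) * et (w.1.2 - w.2.2).

Let M0 : 0 <= M. Proof. by have [h _] := XM 0; exact: le_trans h. Qed.
Let B0 : 0 <= B. Proof. exact: le_trans (uB (0, 0)). Qed.
Let Bf0 : 0 <= Bf. Proof. exact: le_trans (fB (uB (0, 0))). Qed.
Let G0 : 0 <= G.
Proof. by rewrite -lee_fin (le_trans _ (guG 0))//; apply: integral_ge0 => x _; rewrite lee_fin. Qed.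

Let mX : measurable_fun [set: R] X.
Proof. by apply: continuous_measurable_fun; case: cX => /is_derive_continuous. Qed.
Let mX' : measurable_fun [set: R] X'.
Proof. by apply: continuous_measurable_fun; case: cX. Qed.
Let mom : measurable_fun [set: R] om. Proof. exact: measurable_qbump. Qed.
Let mom' : measurable_fun [set: R] om'. Proof. exact: measurable_dqbump. Qed.
Let met : measurable_fun [set: R] et. Proof. exact: measurable_qbump. Qed.
Let met' : measurable_fun [set: R] et'. Proof. exact: measurable_dqbump. Qed.
Let msg : measurable_fun [set: R] (@Num.sg R). Proof. exact: measurable_sg. Qed.

Let mPhi1 : measurable_fun setT Phi1. Proof. by rewrite /Phi1; mfun. Qed.
Let mPhi2 : measurable_fun setT Phi2. Proof. by rewrite /Phi2; mfun. Qed.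

Let pos (F : (R * R) * (R * R) -> R) w : R := Num.max (F w) 0.
Let neg (F : (R * R) * (R * R) -> R) w : R := Num.max (- F w) 0.
Let pos_ge0 F w : 0 <= pos F w. Proof. by rewrite le_max lexx orbT. Qed.
Let neg_ge0 F w : 0 <= neg F w. Proof. by rewrite le_max lexx orbT. Qed.
Let mpos F : measurable_fun setT F -> measurable_fun setT (pos F).
Proof. by move=> mF; apply: measurable_maxr. Qed.
Let mneg F : measurable_fun setT F -> measurable_fun setT (neg F).
Proof. by move=> mF; apply: measurable_maxr => //; apply: measurable_funN. Qed.

Lemma C1c_qbump_shift (d y : R) : 0 < d -> C1c (fun x => qbump d (x - y)) (fun x => dqbump d (x - y)).
Proof.
move=> d0; split.
- move=> x; rewrite -[dqbump _ _]mulr1.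
  apply: (@is_derive1_comp _ (qbump d) (fun x => x - y)); first exact: is_derive_qbump.
  apply: is_derive_quadratic => h.
  by rewrite (_ : _ - _ = 0) ?normr0 ?sqr_ge0//; ring.
- move=> x; apply: (@continuous_comp _ _ _ (fun x => x - y) (dqbump d)); last exact: continuous_dqbump.
  by apply: cvgB; [exact: cvg_id|exact: cvg_cst].
- exists (d + `|y|) => x xy; have [] // := @qbump_supp _ d (x - y) d0 _.
  by have := lerB_dist x y; lra.
Qed.

Lemma C1c_qbump_flip (d y : R) : 0 < d -> C1c (fun x => qbump d (y - x)) (fun x => - dqbump d (y - x)).
Proof.
move=> d0; split.
- move=> x; rewrite -mulrN1.
  apply: (@is_derive1_comp _ (qbump d) (fun x => y - x)); first exact: is_derive_qbump.
  apply: is_derive_quadratic => h.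
  by rewrite (_ : _ - _ = 0) ?normr0 ?sqr_ge0//; ring.
- move=> x; apply: cvgN; apply: (@continuous_comp _ _ _ (fun x => y - x) (dqbump d)); last exact: continuous_dqbump.
  by apply: cvgB; [exact: cvg_cst|exact: cvg_id].
- exists (d + `|y|) => x xy; have [] // := @qbump_supp _ d (y - x) d0 _.
  by rewrite distrC; have := lerB_dist x y; lra.
Qed.

Let Phi1_slice q : (\int[mu2]_p (neg Phi1 (p, q))%:E <= \int[mu2]_p (pos Phi1 (p, q))%:E)%E.
Proof.
apply: (@integral_ge0_parts _ _ _ mu2 (fun p => Phi1 (p, q))).
apply: (@ent_u (v q) (fun t => X t * om (t - q.1)) (fun t => X' t * om (t - q.1) + X t * om' (t - q.1))
  (fun x => et (x - q.2)) (fun x => et' (x - q.2))).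
- have [dX cX' [N XN]] := cX; have [dom com' _] := C1c_qbump_shift q.1 a0.
  split.
  + move=> t; rewrite addrC (mulrC (X' t)).
    exact: (is_deriveM (dX t) (dom t)).
  + move=> t; apply: cvgD; apply: cvgM.
    * exact: cX'.
    * exact: (is_derive_continuous dom).
    * exact: (is_derive_continuous dX).
    * exact: com'.
  + by exists N => t /XN ->; rewrite mul0r.
- exact: C1c_qbump_shift.
- by move=> t; rewrite mulr_ge0// qbump_ge0.
- by move=> x; exact: qbump_ge0.
- exists (2 * c) => [|t]; first by rewrite mulr_gt0.
  by apply: contraNT => /Xsupp[-> _]; rewrite mul0r.
Qed.

Let Phi2_slice p : (\int[mu2]_q (neg Phi2 (p, q))%:E <= \int[mu2]_q (pos Phi2 (p, q))%:E)%E.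
Proof.
apply: (@integral_ge0_parts _ _ _ mu2 (fun q => Phi2 (p, q))).
apply: (@ent_v (u p) (fun s => X p.1 * om (p.1 - s)) (fun s => - (X p.1 * om' (p.1 - s)))
  (fun y => et (p.2 - y)) (fun y => - et' (p.2 - y))).
- have [dom com' [N omN]] := C1c_qbump_flip p.1 a0.
  split.
  + move=> s; rewrite -mulrN.
    by apply: (@is_deriveZ _ _ _ _ (X p.1)); exact: dom.
  + move=> s; rewrite (_ : (fun s => - (X p.1 * om' (p.1 - s))) = (fun s => X p.1 * - om' (p.1 - s))).
      by apply: cvgM; [exact: cvg_cst|exact: com'].
    by apply/funext => s'; rewrite mulrN.
  + by exists N => s /omN ->; rewrite mulr0.
- exact: C1c_qbump_flip.
- by move=> t; rewrite mulr_ge0// qbump_ge0.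
- by move=> x; exact: qbump_ge0.
- exists c => // s; have [tT|tT] := boolP (2 * c <= p.1 <= T - 2 * c); last first.
    by have [-> _] := Xsupp tT; rewrite mul0r eqxx.
  apply: contraNT => sT.
  have [] // := @qbump_supp _ a (p.1 - s) a0 _; last by move=> ->; rewrite mulr0.
  have [//|h] := leP a `|p.1 - s|.
  exfalso; move/negP : sT; apply; move: h tT; rewrite ltr_norml => /andP[h1 h2] /andP[h3 h4].
  by have := ac; move=> ?; apply/andP; split; lra.
Qed.

(** For each q = w.2, the value v q is the constant of the entropy inequality
    of u; the result is integrated over one period in q. For Phi2 the roles of
    u and v, and of the two factors, are exchanged. *)
Let doubled_Phi1 : (doubledR P (neg Phi1) <= doubledR P (pos Phi1))%E.
Proof.
have E (F : (R * R) * (R * R) -> R) : measurable_fun setT F -> (forall z, 0 <= F z) ->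
    (forall t x s y, F ((t, x + 2 * P), (s, y + 2 * P)) = F ((t, x), (s, y))) ->
    doubledR P F = (\int[mu2]_(q in setT `*` cell P) \int[mu2]_p (F (p, q))%:E)%E.
  move=> mF F0 FP; apply/esym; apply: (@doubled_right _ P (EFin \o F)) => //.
    exact/measurable_EFinP.
  by move=> t x s y /=; rewrite FP.
have pPhi t x s y : Phi1 ((t, x + 2 * P), (s, y + 2 * P)) = Phi1 ((t, x), (s, y)).
  by rewrite /Phi1/= uP vP guP opprD addrACA subrr addr0.
rewrite !E; first last.
- by move=> t x s y; rewrite /neg pPhi.
- exact: neg_ge0.
- exact: mneg.
- by move=> t x s y; rewrite /pos pPhi.
- exact: pos_ge0.
- exact: mpos.
apply: ge0_le_integral_any => [q _|q _]; last exact: Phi1_slice.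
by apply: integral_ge0 => p _; rewrite lee_fin.
Qed.

Let doubled_Phi2 : (doubledR P (neg Phi2) <= doubledR P (pos Phi2))%E.
Proof.
rewrite !doubledRE//; [|exact: mpos|exact: mneg].
apply: ge0_le_integral_any => [q _|q _]; last exact: Phi2_slice.
by apply: integral_ge0 => p _; rewrite lee_fin.
Qed.

Let cell_affine (g : R -> R) (C0 C1 : R) : measurable_fun [set: R] g -> 0 <= C0 -> 0 <= C1 ->
  (\int[mu]_(x in cell P) `|g x|%:E <= G%:E)%E ->
  (\int[mu]_(x in cell P) (C0 + C1 * `|g x|)%:E <= (C0 * (2 * P) + C1 * G)%:E)%E.
Proof.
move=> mg C00 C10 gG.
under eq_integral do rewrite EFinD EFinM.
have mgn : measurable_fun (cell P) (fun x => `|g x|%:E).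
  by apply: measurable_funTS; mfun.
rewrite ge0_integralD; [|exact: measurable_cell|by move=> x _; rewrite lee_fin
  |exact: measurable_cst|by move=> x _; rewrite -EFinM lee_fin mulr_ge0
  |by apply: emeasurable_funM => //; exact: measurable_cst].
rewrite ge0_integralZl_EFin; [|exact: measurable_cell|by move=> x _; rewrite lee_fin
  |exact: mgn|by []].
rewrite [X in (X + _)%E](_ : _ = (C0 * (2 * P))%:E).
  by rewrite EFinD leeD2l// EFinM lee_wpmul2l.
rewrite integral_cst; last exact: measurable_cell.
rewrite cell_itv/= lebesgue_measure_itv/= lte_fin ifT; last by have := P0; lra.
by rewrite -EFinD -EFinM opprK mulr2n mulrDl !mul1r.
Qed.

Let K0 : R := 2 * B * (M * M + M * M) * M + 2 * Bf * 1 * (M * M) * M.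
Let K1 : R := M * M * M.
Let K00 : 0 <= K0. Proof. by rewrite /K0 addr_ge0// !mulr_ge0// addr_ge0// mulr_ge0. Qed.
Let K10 : 0 <= K1. Proof. by rewrite /K1 !mulr_ge0. Qed.

Let Phi1_bound w : `|Phi1 w| <= K0 + K1 * `|gu w.1|.
Proof.
have [hX hX'] := XM w.1.1; have [ho ho'] := aM (w.1.1 - w.2.1); have [he he'] := bM (w.1.2 - w.2.2).
have h1 : `| (`|u w.1 - v w.2|) | <= 2 * B.
  rewrite normr_id (le_trans (ler_normB _ _))//; have := uB w.1; have := vB w.2; lra.
have h2 : `|f (u w.1) - f (v w.2)| <= 2 * Bf.
  rewrite (le_trans (ler_normB _ _))//; have := fB (uB w.1); have := fB (vB w.2); lra.
rewrite /Phi1 /K0; apply: le_trans (ler_normD _ _) _; apply: lerD.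
  apply: le_trans (ler_normD _ _) _; apply: lerD.
    apply: normM_le => //; apply: normM_le => //.
    by apply: le_trans (ler_normD _ _) _; apply: lerD; exact: normM_le.
  by apply: normM_le => //; apply: normM_le; [apply: normM_le => //; exact: norm_sg_le|exact: normM_le].
rewrite (_ : K1 * _ = `|gu w.1| * 1 * (M * M) * M); last by rewrite /K1; ring.
by apply: normM_le => //; apply: normM_le; [apply: normM_le => //; exact: norm_sg_le|exact: normM_le].
Qed.

Let Phi2_bound w : `|Phi2 w| <= K0 + K1 * `|gv w.2|.
Proof.
have [hX hX'] := XM w.1.1; have [ho ho'] := aM (w.1.1 - w.2.1); have [he he'] := bM (w.1.2 - w.2.2).
have h1 : `| (`|v w.2 - u w.1|) | <= 2 * B.
  rewrite normr_id (le_trans (ler_normB _ _))//; have := uB w.1; have := vB w.2; lra.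
have h2 : `|f (v w.2) - f (u w.1)| <= 2 * Bf.
  rewrite (le_trans (ler_normB _ _))//; have := fB (uB w.1); have := fB (vB w.2); lra.
rewrite /Phi2 /K0; apply: le_trans (ler_normD _ _) _; apply: lerD.
  apply: le_trans (ler_normD _ _) _; apply: lerD.
    apply: normM_le => //; apply: normM_le => //; rewrite normrN.
    by apply: (@le_trans _ _ (M * M)); [exact: normM_le|rewrite lerDl mulr_ge0].
  by apply: normM_le; [apply: normM_le; [apply: normM_le => //; exact: norm_sg_le|exact: normM_le]|rewrite normrN].
rewrite (_ : K1 * _ = `|gv w.2| * 1 * (M * M) * M); last by rewrite /K1; ring.
by apply: normM_le => //; apply: normM_le; [apply: normM_le => //; exact: norm_sg_le|exact: normM_le].
Qed.

Let Phi_supp t x s y : Phi1 ((t, x), (s, y)) != 0 \/ Phi2 ((t, x), (s, y)) != 0 ->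
  [/\ 2 * c <= t <= T - 2 * c, `|t - s| < a & `|x - y| < b].
Proof.
move=> H; have [tT|/Xsupp[hX hX']] := boolP (2 * c <= t <= T - 2 * c); last first.
  by case: H; rewrite /Phi1 /Phi2/= ?hX ?hX' !(mul0r, mulr0, addr0, oppr0) eqxx.
have [ts|/(qbump_supp a0)[h h']] := ltP `|t - s| a; last first.
  by case: H; rewrite /Phi1 /Phi2/= ?h ?h' !(mul0r, mulr0, addr0, oppr0) eqxx.
have [xy|/(qbump_supp b0)[h1 h1']] := ltP `|x - y| b; first by split.
by case: H; rewrite /Phi1 /Phi2/= ?h1 ?h1' !(mul0r, mulr0, addr0, oppr0) eqxx.
Qed.

Let Phi_supp' t x s y : Phi1 ((t, x), (s, y)) != 0 \/ Phi2 ((t, x), (s, y)) != 0 ->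
  [/\ 0 <= t <= T, 0 <= s <= T & `|x - y| <= b].
Proof.
move=> /Phi_supp[/andP[t1 t2] ts xy]; split; last exact: ltW.
  by have := c0 => ?; apply/andP; split; lra.
move: ts; rewrite ltr_norml => /andP[? ?].
by have := c0; have := ac => ? ?; apply/andP; split; lra.
Qed.

Let pos_neq0 F w : pos F w != 0 -> F w != 0.
Proof. by apply: contraNneq => h; rewrite /pos h maxxx. Qed.

Let pos_le F w : pos F w <= `|F w|.
Proof. by rewrite /pos ge_max ler_norm normr_ge0. Qed.

Let doubled_Phi1_fin : (doubledR P (pos Phi1) < +oo)%E.
Proof.
apply: (@doubledR_lty _ _ _ (K0 * (2 * P) + K1 * G) T b) => //.
- exact: ltW.
- exact: ltW.
- by rewrite addr_ge0// !mulr_ge0// ltW.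
- by move=> t x s y /pos_neq0 h; apply: Phi_supp'; left.
- move=> t s z; apply: le_trans (cell_affine _ K00 K10 (guG t)); last by mfun.
  apply: ge0_le_integral_any => [x _|x _]; rewrite lee_fin//.
  exact: le_trans (pos_le _ _) (Phi1_bound _).
Qed.

Let doubled_Phi2_fin : (doubledR P (pos Phi2) < +oo)%E.
Proof.
apply: (@doubledR_lty _ _ _ (K0 * (2 * P) + K1 * G) T b) => //.
- exact: ltW.
- exact: ltW.
- by rewrite addr_ge0// !mulr_ge0// ltW.
- by move=> t x s y /pos_neq0 h; apply: Phi_supp'; right.
- move=> t s z; apply: le_trans (@cell_affine (fun x => gv (s, x - z)) _ _ _ K00 K10 _).
  + apply: ge0_le_integral_any => [x _|x _]; rewrite lee_fin//.
    exact: le_trans (pos_le _ _) (Phi2_bound _).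
  + by mfun.
  + rewrite (@integral_period_shift _ P (fun x => `|gv (s, x)|%:E) (- z))//.
    * by mfun.
    * by move=> x; rewrite gvP.
Qed.

Let Ep := diag_term u v (fun t => Num.max (X' t) 0) a b.
Let En := diag_term u v (fun t => Num.max (- X' t) 0) a b.
Let Rem := off_term u v gu gv X X' a b.

(** In Phi1 + Phi2 the fluxes and the derivatives of the bumps cancel. There
    remain X' |u w.1 - v w.2|, in which v w.2 is replaced by v w.1, and the
    difference of the sources. *)
Let pointwise w : pos Phi1 w + pos Phi2 w + En w <= neg Phi1 w + neg Phi2 w + (Ep w + Rem w).
Proof.
have pn (r : R) : Num.max r 0 = r + Num.max (- r) 0.
  by rewrite !maxEle oppr_le0; case: (lerP 0 r) => r0; case: (lerP r 0) => r1; lra.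
(* Adding the negative parts to both sides removes the truncations at 0. *)
suff H : Phi1 w + Phi2 w + En w <= Ep w + Rem w.
  rewrite /pos (pn (Phi1 w)) (pn (Phi2 w)) -/(neg Phi1 w) -/(neg Phi2 w).
  by move: H; lra.
rewrite /Ep /En /Rem /diag_term /off_term (pn (X' w.1.1)) /Phi1 /Phi2.
have e0 : 0 <= om (w.1.1 - w.2.1) * et (w.1.2 - w.2.2) by rewrite mulr_ge0// qbump_ge0.
rewrite (distrC (v w.2)) (_ : Num.sg (v w.2 - u w.1) = - Num.sg (u w.1 - v w.2)); last first.
  by rewrite -sgrN opprB.
move: e0; set o := om _; set e := et _; set o' := om' _; set e' := et' _.
set S := Num.sg _; set A := `|u w.1 - v w.2|; set A0 := `|u w.1 - v w.1|.
set Dv := `|v w.1 - v w.2|; set xp := X' _; set xx := X _; set mm := Num.max _ _ => e0.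
set ga := gu _; set gb := gv _; set fa := f (u _); set fb := f (v _).
have h1 : (A - A0) * xp <= Dv * `|xp|.
  apply: le_trans (ler_norm _) _; rewrite normrM ler_wpM2r//.
  rewrite /A /A0 /Dv; apply: le_trans (ler_dist_dist _ _) _.
  by rewrite [X in `|X| <= _](_ : _ = v w.1 - v w.2)//; ring.
have h2 : (ga - gb) * S * xx <= `|ga - gb| * xx.
  rewrite ler_wpM2r ?X0//; apply: le_trans (ler_norm _) _; rewrite normrM.
  by rewrite ler_piMr// norm_sg_le.
have := ler_wpM2r e0 (lerD h1 h2).
rewrite -subr_ge0 => H; rewrite -subr_ge0; apply: le_trans H _; rewrite le_eqVlt; apply/orP; left; apply/eqP.
by ring.
Qed.

Let mEp : measurable_fun setT Ep.
Proof.
have mm : measurable_fun [set: R] (fun t => Num.max (X' t) 0) by exact: measurable_maxr.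
have mm' : measurable_fun setT (fun w : (R * R) * (R * R) => Num.max (X' w.1.1) 0).
  by apply: (measurableT_comp mm); mfun.
by rewrite /Ep /diag_term; mfun.
Qed.

Let mEn : measurable_fun setT En.
Proof.
have mm : measurable_fun [set: R] (fun t => Num.max (- X' t) 0).
  by apply: measurable_maxr => //; exact: measurable_funN.
have mm' : measurable_fun setT (fun w : (R * R) * (R * R) => Num.max (- X' w.1.1) 0).
  by apply: (measurableT_comp mm); mfun.
by rewrite /En /diag_term; mfun.
Qed.

Let mRem : measurable_fun setT Rem. Proof. by rewrite /Rem /off_term; mfun. Qed.

Let Ep_ge0 w : 0 <= Ep w.
Proof.
rewrite /Ep /diag_term; apply: mulr_ge0; last exact: qbump_ge0.
apply: mulr_ge0; last exact: qbump_ge0.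
by apply: mulr_ge0 => //; rewrite le_max lexx orbT.
Qed.
Let En_ge0 w : 0 <= En w.
Proof.
rewrite /En /diag_term; apply: mulr_ge0; last exact: qbump_ge0.
apply: mulr_ge0; last exact: qbump_ge0.
by apply: mulr_ge0 => //; rewrite le_max lexx orbT.
Qed.
Let Rem_ge0 w : 0 <= Rem w.
Proof.
rewrite /Rem /off_term; apply: mulr_ge0; last exact: qbump_ge0.
apply: mulr_ge0; last exact: qbump_ge0.
by apply: addr_ge0; exact: mulr_ge0.
Qed.

(** Integrating [pointwise] and cancelling the two entropy inequalities. The
    positive and negative parts of X' are on opposite sides, so that all terms
    are nonnegative. *)
Lemma doubled_entropy_inequality : (doubledR P (diag_term u v (fun t => Num.max (- X' t) 0)%R a b) <=
  doubledR P (diag_term u v (fun t => Num.max (X' t) 0)%R a b) +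
  doubledR P (off_term u v gu gv X X' a b))%E.
Proof.
have := @le_doubledR _ P (fun w => pos Phi1 w + pos Phi2 w + En w)
   (fun w => neg Phi1 w + neg Phi2 w + (Ep w + Rem w)) _ pointwise.
have mp1 := mpos mPhi1; have mp2 := mpos mPhi2.
have mn1 := mneg mPhi1; have mn2 := mneg mPhi2.
rewrite (@doubledRD _ P (fun w => pos Phi1 w + pos Phi2 w) En)//; [|exact: measurable_funD|by move=> z; rewrite addr_ge0].
rewrite (@doubledRD _ P (pos Phi1) (pos Phi2))//.
rewrite (@doubledRD _ P (fun w => neg Phi1 w + neg Phi2 w) (fun w => Ep w + Rem w))//;
  [|exact: measurable_funD|exact: measurable_funD|by move=> z; rewrite addr_ge0|by move=> z; rewrite addr_ge0].
rewrite (@doubledRD _ P (neg Phi1) (neg Phi2))// (@doubledRD _ P Ep Rem)//.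
move=> /(_ _)H.
have {}H := H (fun w => addr_ge0 (addr_ge0 (pos_ge0 _ _) (pos_ge0 _ _)) (En_ge0 w)).
apply: (lee_cancel H doubled_Phi1 doubled_Phi2 doubled_Phi1_fin doubled_Phi2_fin); exact: doubledR_ge0.
Qed.

End doubling.

(** * Doubled integrals of the main and error terms *)

Section slices.
Context {R : realType}.
Local Notation mu := (@lebesgue_measure R).
Variable P : R.

Lemma integral_cell_fin (g : R -> R) (C : R) : 0 < P -> measurable_fun [set: R] g ->
  (forall x, `|g x| <= C) ->
  (\int[mu]_(x in cell P) `|g x|%:E <= (C * (2 * P))%:E)%E.
Proof.
move=> P0 mg gC.
apply: (@le_trans _ _ (\int[mu]_(x in cell P) (cst C%:E x))%E).
  by apply: ge0_le_integral_any => x _; rewrite lee_fin.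
rewrite integral_cst; last exact: measurable_cell.
rewrite cell_itv/= lebesgue_measure_itv/= lte_fin ifT; last by lra.
by rewrite -EFinD -EFinM lee_fin opprK mulr2n mulrDl !mul1r.
Qed.

Lemma slice_product (g : R -> R) (r k k1 k2 : R) : measurable_fun [set: R] g ->
  0 <= k -> 0 <= k1 -> 0 <= k2 -> (forall x, 0 <= g x) ->
  (\int[mu]_(x in cell P) (g x)%:E = r%:E)%E ->
  (\int[mu]_(x in cell P) (g x * k * k1 * k2)%:E = (k * r * k1 * k2)%:E)%E.
Proof.
move=> mg k0 k10 k20 g0 gr.
transitivity (\int[mu]_(x in cell P) ((k * k1 * k2)%:E * (g x)%:E))%E.
  by apply: eq_integral => x _; rewrite -EFinM; congr EFin; ring.
rewrite ge0_integralZl_EFin; [|exact: measurable_cell|by move=> x _; rewrite lee_fin| |by rewrite !mulr_ge0].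
  by rewrite gr -EFinM; congr EFin; ring.
by apply: measurable_funTS; apply/measurable_EFinP.
Qed.

Lemma slice_combination (g h : R -> R) (r q k1 k2 l : R) :
  measurable_fun [set: R] g -> measurable_fun [set: R] h ->
  0 <= k1 -> 0 <= k2 -> 0 <= l -> (forall x, 0 <= g x) -> (forall x, 0 <= h x) ->
  (\int[mu]_(x in cell P) (g x)%:E <= r%:E)%E ->
  (\int[mu]_(x in cell P) (h x)%:E <= q%:E)%E ->
  (\int[mu]_(x in cell P) ((g x * k1 + h x * k2) * l)%:E <= ((r * k1 + q * k2) * l)%:E)%E.
Proof.
move=> mg mh k10 k20 l0 g0 h0 gr hq.
have mge : measurable_fun (cell P) (EFin \o g) by apply: measurable_funTS; apply/measurable_EFinP.
have mhe : measurable_fun (cell P) (EFin \o h) by apply: measurable_funTS; apply/measurable_EFinP.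
have -> : (\int[mu]_(x in cell P) ((g x * k1 + h x * k2) * l)%:E =
    \int[mu]_(x in cell P) ((k1 * l)%:E * (g x)%:E + (k2 * l)%:E * (h x)%:E))%E.
  by apply: eq_integral => x _; rewrite -!EFinM -EFinD; congr EFin; ring.
rewrite ge0_integralD; [|exact: measurable_cell
  |by move=> x _; rewrite -EFinM lee_fin !mulr_ge0
  |by apply: emeasurable_funM => //; exact: measurable_cst
  |by move=> x _; rewrite -EFinM lee_fin !mulr_ge0
  |by apply: emeasurable_funM => //; exact: measurable_cst].
rewrite ge0_integralZl_EFin; [|exact: measurable_cell|by move=> x _; rewrite lee_fin|exact: mge|by rewrite mulr_ge0].
rewrite ge0_integralZl_EFin; [|exact: measurable_cell|by move=> x _; rewrite lee_fin|exact: mhe|by rewrite mulr_ge0].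
rewrite (_ : ((r * k1 + q * k2) * l)%:E = ((k1 * l)%:E * r%:E + (k2 * l)%:E * q%:E)%E); last first.
  by rewrite -!EFinM -EFinD; congr EFin; ring.
by apply: leeD; apply: lee_wpmul2l => //; rewrite lee_fin mulr_ge0.
Qed.

Variables (u v : R * R -> R) (B : R).
Hypotheses (P0 : 0 < P) (m_u : measurable_fun [set: R * R] u) (m_v : measurable_fun [set: R * R] v)
  (uB : forall z, `|u z| <= B) (vB : forall z, `|v z| <= B).

Lemma L1distE t : (\int[mu]_(x in cell P) `|u (t, x) - v (t, x)|%:E = (L1dist P u v t)%:E)%E.
Proof.
rewrite /L1dist fineK// ge0_fin_numE; last by apply: integral_ge0 => x _; rewrite lee_fin.
apply: le_lt_trans (integral_cell_fin (C := 2 * B) P0 _ _) (ltry _); first by mfun.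
by move=> x; rewrite (le_trans (ler_normB _ _))//; have := uB (t, x); have := vB (t, x); lra.
Qed.

Lemma L1dist_ge0 t : 0 <= L1dist P u v t.
Proof. by apply: fine_ge0; apply: integral_ge0 => x _; rewrite lee_fin. Qed.

Lemma measurable_L1dist : measurable_fun [set: R] (L1dist P u v).
Proof.
have mfi : measurable_fun [set: \bar R] (@fine R) by exact: fine_measurable.
apply: (measurableT_comp mfi).
apply: (@measurable_partial_integral _ _ _ _ _ mu (fun z => `|u z - v z|%:E) (cell P)).
- exact: measurable_cell.
- by mfun.
- by move=> z; rewrite lee_fin.
Qed.

Lemma doubledR_diag_term (Y : R -> R) (a b ca cb : R) : measurable_fun [set: R] Y ->
  (forall t, 0 <= Y t) ->
  (\int[mu]_t (qbump a t)%:E = ca%:E)%E -> (\int[mu]_t (qbump b t)%:E = cb%:E)%E ->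
  doubledR P (diag_term u v Y a b) = ((ca * cb)%:E * \int[mu]_t (Y t * L1dist P u v t)%:E)%E.
Proof.
move=> mY Y0 caE cbE.
have mW := measurable_L1dist.
rewrite -(@conv_boundE _ _ (qbump a) (qbump b) ca cb _ _ _ _ _ _ caE cbE).
- apply: doubledR_eq => t s z.
  under eq_integral do rewrite /diag_term/= opprB (addrC _ (z - _)) subrK.
  apply: slice_product; [by mfun|exact: Y0|exact: qbump_ge0|exact: qbump_ge0| |exact: L1distE].
  by move=> x; exact: normr_ge0.
- by mfun.
- exact: measurable_qbump.
- exact: measurable_qbump.
- by move=> t; rewrite mulr_ge0//; exact: L1dist_ge0.
- by move=> t; exact: qbump_ge0.
- by move=> t; exact: qbump_ge0.
Qed.

(** On the support of the bumps |t - s| < a and |z| < b, where v moves by at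
    most eps in L1; the L1 distance of u t to the moved v is then at most the
    distance at time t plus eps, which enters the estimate of the sources. *)
Lemma doubledR_off_term (gu gv : R * R -> R) (X X' : R -> R) (S : set R) (a b ca cb eps alpha beta : R) :
  measurable_fun [set: R * R] gu -> measurable_fun [set: R * R] gv ->
  measurable_fun [set: R] X -> measurable_fun [set: R] X' -> (forall t, 0 <= X t) ->
  (forall t, ~ S t -> X t = 0 /\ X' t = 0) ->
  0 < a -> 0 < b -> 0 <= eps -> 0 <= alpha -> 0 <= beta ->
  (\int[mu]_t (qbump a t)%:E = ca%:E)%E -> (\int[mu]_t (qbump b t)%:E = cb%:E)%E ->
  (forall t s z, S t -> `|t - s| < a -> `|z| < b ->
    (\int[mu]_(x in cell P) `|v (t, x) - v (s, x - z)|%:E <= eps%:E)%E) ->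
  (forall t s z L, `|z| < b ->
    (\int[mu]_(x in cell P) `|u (t, x) - v (s, x - z)|%:E <= L%:E)%E ->
    (\int[mu]_(x in cell P) `|gu (t, x) - gv (s, x - z)|%:E <= (alpha + beta * L)%:E)%E) ->
  (doubledR P (off_term u v gu gv X X' a b) <= (ca * cb)%:E *
   \int[mu]_t (eps * `|X' t| + (alpha + beta * (L1dist P u v t + eps)) * X t)%:E)%E.
Proof.
move=> m_gu m_gv mX mX' X0 XS a0 b0 eps0 al0 be0 caE cbE hv hG.
have mW := measurable_L1dist.
have W0 := L1dist_ge0.
rewrite -(@conv_boundE _ _ (qbump a) (qbump b) ca cb _ _ _ _ _ _ caE cbE); first last.
- by move=> t; exact: qbump_ge0.
- by move=> t; exact: qbump_ge0.
- by move=> t; rewrite addr_ge0 ?mulr_ge0// addr_ge0 ?mulr_ge0// addr_ge0.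
- exact: measurable_qbump.
- exact: measurable_qbump.
- by mfun.
apply: doubledR_le.
  move=> w; rewrite /off_term; apply: mulr_ge0; last exact: qbump_ge0.
  apply: mulr_ge0; last exact: qbump_ge0.
  by apply: addr_ge0; exact: mulr_ge0.
move=> t s z.
have zero : qbump a (t - s) * qbump b z = 0 \/ (X t = 0 /\ X' t = 0) ->
   (\int[mu]_(x in cell P) (off_term u v gu gv X X' a b (t, x, (s, x - z)))%:E <=
   ((eps * `|X' t| + (alpha + beta * (L1dist P u v t + eps)) * X t) *
    qbump a (t - s) * qbump b z)%:E)%E.
  move=> H; rewrite integral0_eq.
    rewrite lee_fin; apply: mulr_ge0; last exact: qbump_ge0.
    apply: mulr_ge0; last exact: qbump_ge0.
    by rewrite addr_ge0 ?mulr_ge0// addr_ge0 ?mulr_ge0// addr_ge0.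
  move=> x _; congr EFin; rewrite /off_term/= opprB (addrC x (z - x)) subrK.
  case: H => [h|[-> ->]]; first by rewrite -mulrA h mulr0.
  by rewrite normr0 !mulr0 addr0 !mul0r.
have [St|/XS] := pselect (S t); last by move=> h; apply: zero; right.
have [ts|/(qbump_supp a0)[h _]] := ltP `|t - s| a; last by apply: zero; left; rewrite h mul0r.
have [zb|/(qbump_supp b0)[h _]] := ltP `|z| b; last by apply: zero; left; rewrite h mulr0.
clear zero.
have hvz := hv t s z St ts zb.
have huv : (\int[mu]_(x in cell P) `|u (t, x) - v (s, x - z)|%:E <= (L1dist P u v t + eps)%:E)%E.
  rewrite EFinD -L1distE; apply: le_trans (leeD2l _ hvz).
  rewrite -ge0_integralD; [|exact: measurable_cell|by move=> x _; rewrite lee_fin| |by move=> x _; rewrite lee_fin|].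
  - apply: ge0_le_integral_any => x _; first by rewrite lee_fin.
    rewrite -EFinD lee_fin; apply: le_trans (ler_normD _ _).
    by rewrite addrA subrK.
  - by apply: measurable_funTS; mfun.
  - by apply: measurable_funTS; mfun.
have hguv := hG t s z _ zb huv.
rewrite -mulrA.
have -> : (\int[mu]_(x in cell P) (off_term u v gu gv X X' a b (t, x, (s, x - z)))%:E =
  \int[mu]_(x in cell P) ((`|v (t, x) - v (s, x - z)| * `|X' t| + `|gu (t, x) - gv (s, x - z)| * X t)
     * (qbump a (t - s) * qbump b z))%:E)%E.
  by apply: eq_integral => x _; rewrite /off_term/= opprB (addrC x (z - x)) subrK -mulrA.
apply: slice_combination => //; [by mfun|by mfun|].
by rewrite mulr_ge0// qbump_ge0.
Qed.

End slices.

(** * Smooth steps in time *)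

Section step.
Context {R : realType}.
Local Notation mu := (@lebesgue_measure R).
Implicit Types r h t : R.

(** Second difference of [sqpos]: a C1 step from 0 at r to 1 at r + 2h, with a
    tent of unit mass as derivative. *)
Definition step r h t : R :=
  (sqpos (t - r) - 2 * sqpos (t - r - h) + sqpos (t - r - 2 * h)) / (2 * h ^+ 2).
Definition dstep r h t : R :=
  (Num.max 0 (t - r) - 2 * Num.max 0 (t - r - h) + Num.max 0 (t - r - 2 * h)) / h ^+ 2.

Lemma is_derive_shift (F : R -> R) (l k t : R) :
  is_derive (t - k) (1:R) F l -> is_derive t (1:R) (fun t => F (t - k)) l.
Proof.
move=> dF; rewrite -[l]mulr1.
apply: (@is_derive1_comp _ F (fun t => t - k)) => //.
apply: is_derive_quadratic => h.
by rewrite (_ : _ - _ = 0) ?normr0 ?sqr_ge0//; ring.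
Qed.

Lemma is_derive_step r h t : 0 < h -> is_derive t (1:R) (step r h) (dstep r h t).
Proof.
move=> h0.
have dk k : is_derive t (1:R) (fun t => sqpos (t - r - k)) (2 * Num.max 0 (t - r - k)).
  rewrite (_ : (fun t => sqpos (t - r - k)) = (fun t => sqpos (t - (r + k)))); last first.
    by apply/funext => s; congr sqpos; ring.
  rewrite (_ : t - r - k = t - (r + k)); last ring.
  exact: is_derive_shift (is_derive_sqpos _).
have d1 := is_derive_shift (is_derive_sqpos (t - r)).
have := is_deriveZ (2 * h ^+ 2)^-1 (is_deriveD (is_deriveB d1 (is_deriveZ 2 (dk h))) (dk (2 * h))).
rewrite (_ : (2 * h ^+ 2)^-1 *: _ = dstep r h t); last first.
  by rewrite /dstep /GRing.scale/=; field; rewrite gt_eqF.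
rewrite (_ : (2 * h ^+ 2)^-1 \*: _ = step r h)//.
by apply/funext => s; rewrite /step [RHS]mulrC.
Qed.

Lemma continuous_dstep r h : continuous (dstep r h).
Proof.
have cm (k : R) : continuous (fun t : R => Num.max 0 (t - k)).
  move=> t; apply: (@continuous_comp _ _ _ (fun t : R => t - k) (fun x : R => Num.max 0 x)).
    by apply: cvgB; [exact: cvg_id|exact: cvg_cst].
  exact: continuous_max0.
have -> : dstep r h = fun t => (Num.max 0 (t - r) - 2 * Num.max 0 (t - (r + h)) +
   Num.max 0 (t - (r + 2 * h))) / h ^+ 2.
  by apply/funext => t; rewrite /dstep !opprD !addrA.
move=> t; apply: cvgM; last exact: cvg_cst.
apply: cvgD; last exact: cm.
by apply: cvgB; [exact: cm|apply: cvgM; [exact: cvg_cst|exact: cm]].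
Qed.

Lemma stepP r h t : 0 < h -> [/\ 0 <= step r h t <= 1, 0 <= dstep r h t,
  t <= r -> step r h t = 0 /\ dstep r h t = 0 &
  r + 2 * h <= t -> step r h t = 1 /\ dstep r h t = 0].
Proof.
move=> h0; have hh : 0 < h ^+ 2 by exact: exprn_gt0.
have E (a b : R) : step r h t = a / (2 * h ^+ 2) -> dstep r h t = b / h ^+ 2 ->
   0 <= a <= 2 * h ^+ 2 -> 0 <= b -> 0 <= step r h t <= 1 /\ 0 <= dstep r h t.
  have h2 : 0 < 2 * h ^+ 2 by rewrite mulr_gt0.
  move=> -> -> /andP[a0' a1] b0; split; last by apply: divr_ge0 => //; exact: ltW.
  by rewrite ler_pdivrMr// mul1r a1 andbT; apply: divr_ge0 => //; exact: ltW.
have [x0|x0] := leP t r.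
  have s0 : step r h t = 0.
    by rewrite /step !sqpos_eq0 ?mulr0 ?subr0 ?addr0 ?mul0r//; lra.
  have d0 : dstep r h t = 0.
    by rewrite /dstep !max_l ?mulr0 ?subr0 ?addr0 ?mul0r//; lra.
  by split; rewrite ?s0 ?d0 ?lexx ?ler01// => ?; exfalso; lra.
have [x2|x2] := leP (r + 2 * h) t.
  have s1 : step r h t = 1.
    rewrite /step !sqpos_pos; [|lra|lra|lra].
    by field; rewrite gt_eqF.
  have d0 : dstep r h t = 0.
    by rewrite /dstep !max_r; [ring|lra|lra|lra].
  by split; rewrite ?s1 ?d0 ?lexx ?ler01// => ?; exfalso; lra.
have [x1|x1] := leP t (r + h).
  have [] := E ((t - r) ^+ 2) (t - r).
  - by rewrite /step (sqpos_pos (_ : 0 <= t - r)) ?sqpos_eq0 ?mulr0 ?subr0 ?addr0//; lra.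
  - by rewrite /dstep (max_r (_ : 0 <= t - r)) ?max_l ?mulr0 ?subr0 ?addr0//; lra.
  - by rewrite sqr_ge0/=; nra.
  - by lra.
  by move=> ? ?; split => // ?; exfalso; lra.
have [] := E ((t - r) ^+ 2 - 2 * (t - r - h) ^+ 2) (2 * h - (t - r)).
- by rewrite /step (sqpos_pos (_ : 0 <= t - r)) ?(sqpos_pos (_ : 0 <= t - r - h)) ?sqpos_eq0 ?addr0//; lra.
- rewrite /dstep (max_r (_ : 0 <= t - r)) ?(max_r (_ : 0 <= t - r - h)) ?max_l; [|lra|lra|lra].
  by congr (_ / _); ring.
- by apply/andP; split; nra.
- by lra.
by move=> ? ?; split => // ?; exfalso; lra.
Qed.

Lemma integral_dstep r h : 0 < h -> (\int[mu]_t (dstep r h t)%:E = 1)%E.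
Proof.
move=> h0.
transitivity (\int[mu]_(t in `[r, (r + 2 * h)%R]) (dstep r h t)%:E)%E.
  rewrite [RHS]integral_mkcond; apply: eq_integral => t _.
  rewrite /patch; case: ifPn => //; rewrite notin_setE/= in_itv/= => /negP.
  have [_ _ H1 H2] := stepP r t h0.
  rewrite negb_and -!ltNge => /orP[/ltW /H1[_ ->]//|/ltW /H2[_ ->]//].
rewrite (@continuous_FTC2 _ (dstep r h) (step r h)).
- have [_ _ _ /(_ (lexx _))[-> _]] := stepP r (r + 2 * h) h0.
  have [_ _ /(_ (lexx _))[-> _] _] := stepP r r h0.
  by rewrite sube0.
- by lra.
- by apply: continuous_subspaceT => t; exact: continuous_dstep.
- have cs := is_derive_continuous (fun t => is_derive_step r t h0).
  split.
  + by move=> t _; have [] := is_derive_step r t h0.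
  + by apply: cvg_at_right_filter; exact: cs.
  + by apply: cvg_at_left_filter; exact: cs.
- by move=> t _; rewrite derive1E; have [_ ->] := is_derive_step r t h0.
Qed.

End step.

(** * The differential inequality for the L1 distance *)

(** Weak form on ]0, T[ of W' <= A e^{-m} + K m W for every m > 0. The
    derivative falls on the test function, and X' is split by sign so that
    only nonnegative functions are integrated. *)
Definition osgood_inequality (R : realType) (T A K : R) (W : R -> R) : Prop :=
  forall (X X' : R -> R) (c M m : R), C1c X X' -> (forall t, 0 <= X t) ->
  0 < c -> (forall t, ~~ (2 * c <= t <= T - 2 * c) -> X t = 0 /\ X' t = 0) ->
  (forall t, `|X t| <= M /\ `|X' t| <= M) -> 0 < m ->
  (\int[@lebesgue_measure R]_t (Num.max (- X' t) 0 * W t)%:E <=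
   \int[@lebesgue_measure R]_t (Num.max (X' t) 0 * W t)%:E +
   \int[@lebesgue_measure R]_t ((A * expR (- m) + K * m * W t) * X t)%:E)%E.

Section stability.
Context {R : realType}.
Local Notation mu := (@lebesgue_measure R).
Variables (P T : R) (f : R -> R) (u v gu gv : R * R -> R) (B Bf G D A K : R).
Hypotheses (P0 : 0 < P) (T0 : 0 < T).
Hypotheses (mf : measurable_fun [set: R] f)
  (m_u : measurable_fun [set: R * R] u) (m_v : measurable_fun [set: R * R] v)
  (m_gu : measurable_fun [set: R * R] gu) (m_gv : measurable_fun [set: R * R] gv).
Hypotheses (uB : forall z, `|u z| <= B) (vB : forall z, `|v z| <= B)
  (fB : forall y, `|y| <= B -> `|f y| <= Bf).
Hypotheses (uP : forall t x, u (t, x + 2 * P) = u (t, x))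
  (vP : forall t x, v (t, x + 2 * P) = v (t, x))
  (guP : forall t x, gu (t, x + 2 * P) = gu (t, x))
  (gvP : forall t x, gv (t, x + 2 * P) = gv (t, x)).
Hypotheses (guG : forall t, (\int[mu]_(x in cell P) `|gu (t, x)|%:E <= G%:E)%E)
  (gvG : forall t, (\int[mu]_(x in cell P) `|gv (t, x)|%:E <= G%:E)%E).
Hypotheses (ent_u : entropic T f u gu) (ent_v : entropic T f v gv).
Hypotheses (D0 : 0 <= D) (A0 : 0 <= A) (K0 : 0 <= K).
Hypothesis v_mod : forall t h, `|h| <= P ->
  (\int[mu]_(x in cell P) `|v (t, x + h) - v (t, x)|%:E <= (D * `|h|)%:E)%E.
Hypothesis v_unif : forall e, 0 < e -> exists2 a, 0 < a &
  forall t s, 0 <= t <= T -> 0 <= s <= T -> `|t - s| < a ->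
  (\int[mu]_(x in cell P) `|v (t, x) - v (s, x)|%:E <= e%:E)%E.
Hypothesis g_log : forall m t s z L, 0 < m -> `|z| <= P ->
  (\int[mu]_(x in cell P) `|u (t, x) - v (s, x - z)|%:E <= L%:E)%E ->
  (\int[mu]_(x in cell P) `|gu (t, x) - gv (s, x - z)|%:E <= (A * expR (- m) + K * m * L)%:E)%E.

Local Notation W := (L1dist P u v).

(** The bumps are taken so narrow that v moves by at most eps in L1 within
    their supports; the product of their masses divides out, and eps is
    arbitrary. *)
Lemma weak_inequality : osgood_inequality T A K W.
Proof.
move=> X X' c M m cX X0 c0 Xsupp XM m0.
have mW : measurable_fun [set: R] W by exact: measurable_L1dist.
have W0 t : 0 <= W t by exact: L1dist_ge0.
have mX : measurable_fun [set: R] X.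
  by apply: continuous_measurable_fun; case: cX => /is_derive_continuous.
have mX' : measurable_fun [set: R] X' by apply: continuous_measurable_fun; case: cX.
have M0 : 0 <= M by have [h _] := XM 0; exact: le_trans h.
set al := A * expR (- m); set be := K * m.
have al0 : 0 <= al by rewrite mulr_ge0// ltW// expR_gt0.
have be0 : 0 <= be by rewrite mulr_ge0// ltW.
pose q := (M + be * M) * T.
have q0 : 0 <= q by apply: mulr_ge0; [apply: addr_ge0 => //; exact: mulr_ge0|exact: ltW].
have qE : (\int[mu]_t (`|X' t| + be * X t)%:E <= q%:E)%E.
  apply: (@le_trans _ _ (\int[mu]_t ((cst (M + be * M)%:E \_ `[0%R, T]) t))%E).
    apply: ge0_le_integral_any => [t _|t _].
      by rewrite lee_fin addr_ge0// mulr_ge0.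
    rewrite /patch; case: ifPn => [_|].
      rewrite lee_fin lerD//; first by have [] := XM t.
      by rewrite ler_wpM2l// (le_trans (ler_norm _))//; have [] := XM t.
    rewrite notin_setE/= in_itv/= => /negP tT; have [|-> ->] := Xsupp t.
      by apply: contra tT => /andP[? ?]; apply/andP; split; lra.
    by rewrite normr0 mulr0 addr0.
  rewrite -integral_mkcond integral_cst//= lebesgue_measure_itv/= lte_fin T0.
  by rewrite -EFinD -EFinM subr0.
apply/lee_addgt0Pr => e e0.
pose eps := e / (q + 1).
have eps0 : 0 < eps by rewrite divr_gt0//; lra.
have [a1 a10 a1P] := v_unif (divr_gt0 eps0 (ltr0n _ 2)).
pose a := Num.min a1 c.
have a0 : 0 < a by rewrite lt_min a10.
have ac : a <= c by rewrite ge_min lexx orbT.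
have aa1 : a <= a1 by rewrite ge_min lexx.
(* A shift by |z| < b moves v by at most D b <= eps / 2; the other half of eps
   is for the shift in time. *)
pose b := Num.min P (eps / (2 * (D + 1))).
have D1 : 0 < 2 * (D + 1) by have := D0 => ?; lra.
have b0 : 0 < b by rewrite lt_min P0 divr_gt0.
have bP : b <= P by rewrite ge_min lexx.
have bD : D * b <= eps / 2.
  apply: (@le_trans _ _ ((D + 1) * (eps / (2 * (D + 1))))).
    apply: ler_pM => //; [exact: ltW|by have := D0 => ?; lra|by rewrite ge_min lexx orbT].
  rewrite le_eqVlt; apply/orP; left; apply/eqP; field.
  by rewrite gt_eqF//; have := D0 => ?; lra.
pose M' := M + (a ^+ 4 + 4 * a ^+ 3) + (b ^+ 4 + 4 * b ^+ 3).
have p4 d : 0 < d -> 0 <= d ^+ 4 + 4 * d ^+ 3 :> R.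
  by move=> d0; apply: addr_ge0; [|apply: mulr_ge0 => //]; apply: exprn_ge0; exact: ltW.
have pa := p4 _ a0; have pb := p4 _ b0.
have XM' t : `|X t| <= M' /\ `|X' t| <= M'.
  by have [? ?] := XM t; rewrite /M'; split; lra.
have aM' t : `|qbump a t| <= M' /\ `|dqbump a t| <= M'.
  by have [? ?] := qbump_bound t a0; rewrite /M'; split; lra.
have bM' t : `|qbump b t| <= M' /\ `|dqbump b t| <= M'.
  by have [? ?] := qbump_bound t b0; rewrite /M'; split; lra.
have [ca ca0 caE] := qbump_integral a0.
have [cb cb0 cbE] := qbump_integral b0.
have mp : measurable_fun [set: R] (fun t => Num.max (X' t) 0) by exact: measurable_maxr.
have mn : measurable_fun [set: R] (fun t => Num.max (- X' t) 0).
  by apply: measurable_maxr => //; exact: measurable_funN.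
have max0 (r : R) : 0 <= Num.max r 0 by rewrite le_max lexx orbT.
have Hv t s z : 2 * c <= t <= T - 2 * c -> `|t - s| < a -> `|z| < b ->
    (\int[mu]_(x in cell P) `|v (t, x) - v (s, x - z)|%:E <= eps%:E)%E.
  move=> /andP[t1 t2] ts zb.
  have tT : 0 <= t <= T by apply/andP; split; lra.
  have sT : 0 <= s <= T.
    by move: ts; rewrite ltr_norml => /andP[? ?]; apply/andP; split; lra.
  have h1 := a1P t s tT sT (lt_le_trans ts aa1).
  have h2 : (\int[mu]_(x in cell P) `|v (s, x) - v (s, x - z)|%:E <= (eps / 2)%:E)%E.
    have := @v_mod s (- z); rewrite normrN => /(_ (ltW (lt_le_trans zb bP))) h.
    apply: (@le_trans _ _ (D * `|z|)%:E); last first.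
      by rewrite lee_fin; apply: le_trans bD; rewrite ler_wpM2l// ltW.
    by apply: le_trans h; apply: ge0_le_integral_any => x _; rewrite lee_fin// distrC.
  rewrite [eps]splitr EFinD; apply: le_trans (leeD h1 h2).
  rewrite -ge0_integralD; [|exact: measurable_cell|by move=> x _; rewrite lee_fin| |by move=> x _; rewrite lee_fin|].
  - apply: ge0_le_integral_any => x _; first by rewrite lee_fin.
    rewrite -EFinD lee_fin; apply: le_trans (ler_normD _ _).
    by rewrite addrA subrK.
  - by apply: measurable_funTS; mfun.
  - by apply: measurable_funTS; mfun.
have H := doubled_entropy_inequality P0 T0 mf m_u m_v m_gu m_gv uB vB fB uP vP guP gvP guG gvG
  ent_u ent_v cX X0 c0 Xsupp a0 b0 ac XM' aM' bM'.
have Hg t s z L : `|z| < b ->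
    (\int[mu]_(x in cell P) `|u (t, x) - v (s, x - z)|%:E <= L%:E)%E ->
    (\int[mu]_(x in cell P) `|gu (t, x) - gv (s, x - z)|%:E <= (al + be * L)%:E)%E.
  by move=> zb; apply: g_log => //; exact: ltW (lt_le_trans zb bP).
have XS t : ~ [set t | 2 * c <= t <= T - 2 * c] t -> X t = 0 /\ X' t = 0.
  by move=> /= /negP; exact: Xsupp.
have H1 := doubledR_diag_term P0 m_u m_v uB vB mp (fun t => max0 _) caE cbE.
have H2 := doubledR_diag_term P0 m_u m_v uB vB mn (fun t => max0 _) caE cbE.
have H3 := doubledR_off_term P0 m_u m_v uB vB m_gu m_gv mX mX' X0 XS a0 b0 (ltW eps0) al0 be0 caE cbE Hv Hg.
rewrite H1 H2 in H.
have {H1 H2 H3}H := le_trans H (leeD2l _ H3).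
have cc : 0 < ca * cb by rewrite mulr_gt0.
rewrite -ge0_muleDr in H; last 2 first.
- by apply: integral_ge0 => t _; rewrite lee_fin mulr_ge0.
- apply: integral_ge0 => t _; rewrite lee_fin; apply: addr_ge0; apply: mulr_ge0 => //; first exact: ltW.
  by apply: addr_ge0 => //; apply: mulr_ge0 => //; apply: addr_ge0 => //; exact: ltW.
move: H; rewrite lee_pmul2l ?lte_fin// => H.
apply: (le_trans H); rewrite -[leRHS]addeA; apply: leeD2l.
have -> : (\int[mu]_t (eps * `|X' t| + (al + be * (W t + eps)) * X t)%:E =
   \int[mu]_t (((al + be * W t) * X t)%:E + eps%:E * (`|X' t| + be * X t)%:E))%E.
  by apply: eq_integral => t _; rewrite -EFinM -EFinD; congr EFin; ring.
rewrite ge0_integralD//.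
- apply: leeD2l; rewrite ge0_integralZl_EFin//.
  + apply: (@le_trans _ _ (eps%:E * q%:E)%E); first by rewrite lee_wpmul2l// lee_fin ltW.
    rewrite -EFinM lee_fin /eps mulrAC ler_pdivrMr; last lra.
    by apply: ler_wpM2l; [exact: ltW|lra].
  + by move=> t _; rewrite lee_fin addr_ge0// mulr_ge0.
  + by mfun.
  + exact: ltW.
- by move=> t _; rewrite lee_fin mulr_ge0// addr_ge0// mulr_ge0.
- by mfun.
- by move=> t _; rewrite -EFinM lee_fin mulr_ge0 ?(ltW eps0)// addr_ge0// mulr_ge0.
- by apply: emeasurable_funM; [exact: measurable_cst|mfun].
Qed.

End stability.

(** * Osgood uniqueness in weak form *)

Section osgood.
Context {R : realType}.
Local Notation mu := (@lebesgue_measure R).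
Variables (T A K Wm : R) (W : R -> R).
Hypotheses (T0 : 0 < T) (A0 : 0 <= A) (K0 : 0 <= K) (mW : measurable_fun [set: R] W)
  (W0 : forall t, 0 <= W t) (WM : forall t, W t <= Wm).
Hypothesis Wcont : forall t e, 0 <= t <= T -> 0 < e -> exists2 d, 0 < d &
  forall s, 0 <= s <= T -> `|s - t| < d -> `|W s - W t| <= e.
Hypothesis Wweak : osgood_inequality T A K W.

Lemma dstep_le (r h t : R) : 0 < h -> dstep r h t <= h / h ^+ 2.
Proof.
move=> h0; rewrite /dstep ler_wpM2r ?invr_ge0 ?sqr_ge0//.
by rewrite !maxEle; case: (leP 0 (t - r)) => ?; case: (leP 0 (t - r - h)) => ?; case: (leP 0 (t - r - 2 * h)) => ?; lra.
Qed.

Lemma measurable_dstep (r h : R) : measurable_fun [set: R] (dstep r h).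
Proof. by apply: continuous_measurable_fun; exact: continuous_dstep. Qed.

Lemma integral_bounded_support (g : R -> R) (C : R) : 0 <= C -> (forall t, 0 <= g t <= C) ->
  (forall t, ~~ (0 <= t <= T) -> g t = 0) -> (\int[mu]_t (g t)%:E <= (C * T)%:E)%E.
Proof.
move=> C0 gC g0.
apply: (@le_trans _ _ (\int[mu]_t ((cst C%:E \_ `[0%R, T]) t))%E).
  apply: ge0_le_integral_any => [t _|t _]; first by rewrite lee_fin; have /andP[] := gC t.
  rewrite /patch; case: ifPn => [_|]; first by rewrite lee_fin; have /andP[] := gC t.
  by rewrite notin_setE/= in_itv/= => /negP tT; rewrite g0.
rewrite -integral_mkcond integral_cst//= lebesgue_measure_itv/= lte_fin T0.
by rewrite -EFinD -EFinM subr0.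
Qed.

Definition damping (k r t : R) : R := expR (- (k * (t - r))).

Lemma is_derive_damping (k r t : R) : is_derive t (1:R) (damping k r) (- k * damping k r t).
Proof.
rewrite mulrC; apply: (@is_derive1_comp _ expR (fun t => - (k * (t - r)))).
apply: is_derive_quadratic => h.
by rewrite (_ : _ - _ = 0) ?normr0 ?sqr_ge0//; ring.
Qed.

(** Gronwall with the test function e^{-K m (t - r1)} (step at r1 - step at
    r2): the exponential absorbs K m W, and the two tents average W near r1
    and near r2. *)
Lemma damped_propagation (m r1 r2 h : R) : 0 < m -> 0 < h -> 0 < r1 -> r1 + 2 * h <= r2 ->
  r2 + 2 * h < T ->
  (\int[mu]_t (damping (K * m) r1 t * W t * dstep r2 h t)%:E <=
   \int[mu]_t (damping (K * m) r1 t * W t * dstep r1 h t)%:E + (A * expR (- m) * T)%:E)%E.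
Proof.
move=> m0 h0 r10 r12 r2T.
set k := K * m; set al := A * expR (- m).
have k0 : 0 <= k by rewrite mulr_ge0// ltW.
have al0 : 0 <= al by rewrite mulr_ge0// ltW// expR_gt0.
have Wm0 : 0 <= Wm by exact: le_trans (W0 0) (WM 0).
pose p t := step r1 h t - step r2 h t.
pose p' t := dstep r1 h t - dstep r2 h t.
pose X t := damping k r1 t * p t.
pose X' t := damping k r1 t * (p' t - k * p t).
have E0 t : 0 < damping k r1 t by exact: expR_gt0.
have E1 t : r1 <= t -> damping k r1 t <= 1.
  by move=> rt; rewrite -expR0 ler_expR oppr_le0 mulr_ge0// subr_ge0.
have pP t : [/\ 0 <= p t <= 1, t <= r1 -> p t = 0 /\ p' t = 0 & r2 + 2 * h <= t -> p t = 0 /\ p' t = 0].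
  have [/andP[s0 s1] _ sl sr] := stepP r1 t h0; have [/andP[q0 q1] _ ql qr] := stepP r2 t h0.
  split.
  - have [tr|tr] := leP t r2.
      by have [q _] := ql tr; rewrite /p q; apply/andP; split; lra.
    have [s _] := sr (le_trans r12 (ltW tr)).
    by rewrite /p s; apply/andP; split; lra.
  - move=> tr; have [s s'] := sl tr; have [|q q'] := ql; first lra.
    by rewrite /p /p' s s' q q' subrr.
  - move=> tr; have [q q'] := qr tr; have [|s s'] := sr; first lra.
    by rewrite /p /p' s s' q q' !subrr.
pose c := Num.min r1 (T - (r2 + 2 * h)) / 2.
have c0 : 0 < c by rewrite divr_gt0// lt_min r10 subr_gt0.
have c2 : 2 * c = Num.min r1 (T - (r2 + 2 * h)) by rewrite /c mulrC divfK.
have Xs t : ~~ (2 * c <= t <= T - 2 * c) -> p t = 0 /\ p' t = 0.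
  have [_ Hl Hr] := pP t.
  rewrite c2 negb_and -!ltNge => /orP[|] H.
    by apply: Hl; rewrite ltW// (lt_le_trans H)// ge_min lexx.
  apply: Hr; have : Num.min r1 (T - (r2 + 2 * h)) <= T - (r2 + 2 * h) by rewrite ge_min lexx orbT.
  by move: H; lra.
have Xsupp t : ~~ (2 * c <= t <= T - 2 * c) -> X t = 0 /\ X' t = 0.
  by move=> /Xs[q q']; rewrite /X /X' q q' !mulr0 subrr mulr0.
have in01 t : ~~ (0 <= t <= T) -> ~~ (2 * c <= t <= T - 2 * c).
  by apply: contra => /andP[? ?]; apply/andP; split; lra.
pose M := 2 * (h / h ^+ 2) + k + 1.
have hh : 0 <= h / h ^+ 2 by apply: divr_ge0; [exact: ltW|exact: sqr_ge0].
have XM t : `|X t| <= M /\ `|X' t| <= M.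
  have [tr|/ltW tr] := leP t r1.
    have [_ /(_ tr)[q q'] _] := pP t.
    by rewrite /X /X' q q' !mulr0 subrr mulr0 normr0 /M; split; lra.
  have [/andP[q0 q1] _ _] := pP t.
  have e1 : `|damping k r1 t| <= 1 by rewrite gtr0_norm// E1.
  have d1 := dstep_le r1 t h0; have d2 := dstep_le r2 t h0.
  have [_ d10 _ _] := stepP r1 t h0; have [_ d20 _ _] := stepP r2 t h0.
  have kp : 0 <= k * p t <= k.
    by rewrite mulr_ge0//= ler_piMr.
  split.
    apply: le_trans (normM_le e1 (_ : `|p t| <= 1)) _; first by rewrite ger0_norm.
    by rewrite /M; lra.
  apply: le_trans (normM_le e1 (_ : `|p' t - k * p t| <= M)) _; last by rewrite mul1r.
  by rewrite ler_norml /M /p'; apply/andP; split; lra.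
have X0 t : 0 <= X t by apply: mulr_ge0; [exact: ltW|have [/andP[]] := pP t].
have X1 t : X t <= 1.
  have [tr|/ltW tr] := leP t r1; first by have [_ /(_ tr)[q _] _] := pP t; rewrite /X q mulr0.
  have [/andP[q0 q1] _ _] := pP t.
  rewrite -[leRHS]mulr1; apply: ler_pM => //; [exact: ltW|exact: E1].
have dp t : is_derive t (1:R) p (p' t).
  exact: (is_deriveB (is_derive_step r1 t h0) (is_derive_step r2 t h0)).
have cX : C1c X X'.
  split.
  - move=> t; rewrite /X' mulrBr (_ : _ - _ = damping k r1 t * p' t + p t * (- k * damping k r1 t)); last ring.
    exact: (is_deriveM (is_derive_damping k r1 t) (dp t)).
  - have cE := is_derive_continuous (is_derive_damping k r1).
    have cp := is_derive_continuous dp.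
    move=> t; apply: cvgM; first exact: cE.
    apply: cvgB; first by apply: cvgB; exact: continuous_dstep.
    by apply: cvgM; [exact: cvg_cst|exact: cp].
  - exists T => t tT; have [] // := Xsupp t; apply: in01; apply: contraTN tT => /andP[t0' tT'].
    by rewrite -leNgt ger0_norm.
have H := @Wweak _ _ _ _ _ cX X0 c0 Xsupp XM m0.
have mE : measurable_fun [set: R] (damping k r1).
  apply: continuous_measurable_fun; exact: (is_derive_continuous (is_derive_damping k r1)).
have mp : measurable_fun [set: R] p.
  apply: continuous_measurable_fun; exact: (is_derive_continuous dp).
have md1 := measurable_dstep r1 h; have md2 := measurable_dstep r2 h.
have mX : measurable_fun [set: R] X by rewrite /X; mfun.
have mX' : measurable_fun [set: R] X' by rewrite /X' /p'; mfun.
have mXp : measurable_fun [set: R] (fun t => Num.max (X' t) 0) by exact: measurable_maxr.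
have mXn : measurable_fun [set: R] (fun t => Num.max (- X' t) 0).
  by apply: measurable_maxr => //; exact: measurable_funN.
have max0 (r : R) : 0 <= Num.max r 0 by rewrite le_max lexx orbT.
have d0 r t : 0 <= dstep r h t by have [] := stepP r t h0.
have EW0 t : 0 <= damping k r1 t * W t by apply: mulr_ge0 => //; exact: ltW.
have I2 (g1 g2 : R -> R) : measurable_fun setT g1 -> measurable_fun setT g2 ->
   (forall t, 0 <= g1 t) -> (forall t, 0 <= g2 t) ->
   (\int[mu]_t (g1 t + g2 t)%:E = \int[mu]_t (g1 t)%:E + \int[mu]_t (g2 t)%:E)%E.
  move=> mg1 mg2 g10 g20.
  apply: (@ge0_integralD _ _ _ mu setT measurableT (EFin \o g1) (EFin \o g2)).
  - by move=> t _; rewrite lee_fin.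
  - exact/measurable_EFinP.
  - by move=> t _; rewrite lee_fin.
  - exact/measurable_EFinP.
pose gn t := Num.max (- X' t) 0 * W t.
pose gp t := Num.max (X' t) 0 * W t.
pose gl t := (al + k * W t) * X t.
pose g1 t := damping k r1 t * W t * dstep r1 h t.
pose g2 t := damping k r1 t * W t * dstep r2 h t.
pose ga t := al * X t.
have gn0 t : 0 <= gn t by rewrite mulr_ge0.
have gp0 t : 0 <= gp t by rewrite mulr_ge0.
have gl0 t : 0 <= gl t by apply: mulr_ge0 => //; apply: addr_ge0 => //; exact: mulr_ge0.
have g10 t : 0 <= g1 t by rewrite mulr_ge0.
have g20 t : 0 <= g2 t by rewrite mulr_ge0.
have ga0 t : 0 <= ga t by rewrite mulr_ge0.
have mgn : measurable_fun [set: R] gn by rewrite /gn; mfun.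
have mgp : measurable_fun [set: R] gp by rewrite /gp; mfun.
have mgl : measurable_fun [set: R] gl by rewrite /gl; mfun.
have mg1 : measurable_fun [set: R] g1 by rewrite /g1; mfun.
have mg2 : measurable_fun [set: R] g2 by rewrite /g2; mfun.
have mga : measurable_fun [set: R] ga by rewrite /ga; mfun.
(* Leibniz rule: the derivative of the exponential gives - K m X, and p' is
   the difference of the two tents. *)
have Eq : (\int[mu]_t (gp t)%:E + \int[mu]_t (gl t)%:E + \int[mu]_t (g2 t)%:E =
           \int[mu]_t (gn t)%:E + (\int[mu]_t (g1 t)%:E + \int[mu]_t (ga t)%:E))%E.
  rewrite -(I2 gp gl)// -(I2 g1 ga)// -(I2 _ g2)//; [|by mfun|by move=> t; rewrite addr_ge0].
  rewrite -(I2 gn _)//; [|by mfun|by move=> t; rewrite addr_ge0].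
  apply: eq_integral => t _; congr EFin; rewrite /gp /gl /g2 /gn /g1 /ga.
  have -> : Num.max (X' t) 0 = X' t + Num.max (- X' t) 0.
    by rewrite !maxEle oppr_le0; case: (lerP 0 (X' t)) => q0; case: (lerP (X' t) 0) => q1; lra.
  by rewrite /X' /X /p'; ring.
have fin : (\int[mu]_t (gn t)%:E)%E \is a fin_num.
  rewrite ge0_fin_numE; last by apply: integral_ge0 => t _; rewrite lee_fin.
  apply: le_lt_trans (integral_bounded_support (C := M * Wm) _ _ _) (ltry _).
  - by apply: mulr_ge0 => //; have [h' _] := XM 0; exact: le_trans h'.
  - move=> t; rewrite gn0/=; apply: ler_pM => //.
    have [_ XMt] := XM t; rewrite ge_max (le_trans (ler_norm _)) ?normrN//=.
    exact: le_trans XMt.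
  - by move=> t /in01/Xsupp[_ Xt]; rewrite /gn Xt oppr0 maxxx mul0r.
have Ha : (\int[mu]_t (ga t)%:E <= (al * T)%:E)%E.
  apply: integral_bounded_support => //.
    by move=> t; rewrite ga0/= ler_piMr.
  by move=> t /in01/Xsupp[Xt _]; rewrite /ga Xt mulr0.
apply: le_trans (leeD2l _ Ha).
rewrite -(leeD2lE _ _ fin) -Eq; exact: leeD2r.
Qed.

(** For narrow tents [damped_propagation] says that W t2 is at most e^{K m (t2
    - t1)} A T e^{-m} up to a small error. Since K (t2 - t1) <= 1 / 4, this
    tends to 0 as m grows. *)
Lemma osgood_step (t1 t2 : R) : 0 <= t1 -> t1 < t2 -> t2 < T -> K * (t2 - t1) <= 1 / 4 ->
  W t1 = 0 -> W t2 = 0.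
Proof.
move=> t10 t12 t2T Kt Wt1.
apply/eqP; rewrite eq_le W0 andbT leNgt; apply/negP => w0.
pose w := W t2.
(* Since e^{m/2} >= 1 + m/2, this m gives A T e^{-m/2} <= w / 4. *)
pose m := 8 * (A * T) / w + 1.
have AT : 0 <= A * T by rewrite mulr_ge0// ltW.
have m0 : 0 < m.
  have q : 0 <= 8 * (A * T) / w by apply: divr_ge0; [exact: mulr_ge0|exact: ltW].
  by rewrite /m; lra.
pose em := expR (m / 2).
have em0 : 0 < em by exact: expR_gt0.
(* On the tents W is within e of W t1 = 0 and of W t2; the first error gets
   multiplied by em, and both then amount to w / 4. *)
pose e := w / (4 * (1 + em)).
have e0 : 0 < e by rewrite divr_gt0// mulr_gt0//; lra.
have eE : e + e * em = w / 4.
  by rewrite /e; field; rewrite gt_eqF//; lra.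
have t1T : 0 <= t1 <= T by apply/andP; split; lra.
have t2T' : 0 <= t2 <= T by apply/andP; split; lra.
have [d1 d10 H1] := Wcont t1T e0.
have [d2 d20 H2] := Wcont t2T' e0.
pose h := Num.min (Num.min (d1 / 8) (d2 / 8)) (Num.min (Num.min ((t2 - t1) / 8) ((T - t2) / 8)) (1 / (8 * (K + 1)))).
have K1 : 0 < 8 * (K + 1) by have := K0 => ?; lra.
have h0 : 0 < h.
  by rewrite !lt_min; apply/andP; split; [apply/andP; split|apply/andP; split; [apply/andP; split|]];
    rewrite divr_gt0//; lra.
have hP : [/\ h <= d1 / 8, h <= d2 / 8, h <= (t2 - t1) / 8, h <= (T - t2) / 8 & h <= 1 / (8 * (K + 1))].
  by split; rewrite /h !ge_min lexx ?orbT.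
have [h1 h2 h3 h4 h5] := hP.
have hK : K * h <= 1 / 8.
  apply: (@le_trans _ _ ((K + 1) * (1 / (8 * (K + 1))))).
    by apply: ler_pM => //; [exact: ltW|lra].
  by rewrite le_eqVlt; apply/orP; left; apply/eqP; field; rewrite gt_eqF//; have := K0 => ?; lra.
have H := @damped_propagation m (t1 + h) t2 h m0 h0.
have {}H := H _ _ _.
have Hr1 : 0 < t1 + h by lra.
have Hr2 : t1 + h + 2 * h <= t2 by lra.
have Hr3 : t2 + 2 * h < T by lra.
have {Hr1 Hr2 Hr3}H := H Hr1 Hr2 Hr3.
have d0 r t : 0 <= dstep r h t by have [] := stepP r t h0.
have int_d r q : 0 <= q -> (\int[mu]_t (q * dstep r h t)%:E = q%:E)%E.
  move=> q0; under eq_integral do rewrite EFinM.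
  rewrite ge0_integralZl_EFin//; [by rewrite integral_dstep// mule1|by move=> t _; rewrite lee_fin|].
  by apply/measurable_EFinP; exact: measurable_dstep.
have E0 t : 0 < damping (K * m) (t1 + h) t by exact: expR_gt0.
have U : (\int[mu]_t (damping (K * m) (t1 + h) t * W t * dstep (t1 + h) h t)%:E <= e%:E)%E.
  rewrite -(int_d (t1 + h) e (ltW e0)); apply: ge0_le_integral_any => t _.
    by rewrite lee_fin; apply: mulr_ge0 => //; apply: mulr_ge0 => //; exact: ltW.
  rewrite lee_fin; have [_ _ Hl Hr] := stepP (t1 + h) t h0.
  have [tl|tl] := leP t (t1 + h); first by have [_ ->] := Hl tl; rewrite !mulr0.
  have [tr|tr] := leP (t1 + h + 2 * h) t; first by have [_ ->] := Hr tr; rewrite !mulr0.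
  apply: ler_wpM2r => //; rewrite -[leRHS]mul1r; apply: ler_pM => //; first exact: ltW.
    rewrite -expR0 ler_expR oppr_le0; apply: mulr_ge0; last by rewrite subr_ge0 ltW.
    by apply: mulr_ge0 => //; exact: ltW.
  have tT : 0 <= t <= T by apply/andP; split; lra.
  have td : `|t - t1| < d1 by rewrite ger0_norm; lra.
  by have := H1 t tT td; rewrite Wt1 subr0 ger0_norm.
have we : 0 <= w - e.
  have ee : 0 <= e * em by rewrite mulr_ge0// ltW.
  have := eE; have : 0 < w by []; lra.
have L : (((w - e) / em)%:E <= \int[mu]_t (damping (K * m) (t1 + h) t * W t * dstep t2 h t)%:E)%E.
  rewrite -(int_d t2 ((w - e) / em)); last by rewrite divr_ge0// ltW.
  apply: ge0_le_integral_any => t _.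
    by rewrite lee_fin; apply: mulr_ge0 => //; rewrite divr_ge0// ltW.
  rewrite lee_fin; have [_ _ Hl Hr] := stepP t2 t h0.
  have [tl|tl] := leP t t2; first by have [_ ->] := Hl tl; rewrite !mulr0.
  have [tr|tr] := leP (t2 + 2 * h) t; first by have [_ ->] := Hr tr; rewrite !mulr0.
  apply: ler_wpM2r => //; rewrite mulrC; apply: ler_pM => //.
  - by rewrite invr_ge0 ltW.
  - rewrite /em -expRN /damping ler_expR lerN2.
    have Q : K * (t - (t1 + h)) <= 2^-1.
      have : K * (t - (t1 + h)) <= K * ((t2 - t1) + h) by apply: ler_wpM2l => //; lra.
      by rewrite (mulrDr K); lra.
    rewrite (_ : K * m * (t - (t1 + h)) = m * (K * (t - (t1 + h)))); last ring.
    by apply: ler_wpM2l => //; exact: ltW.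
  - have tT : 0 <= t <= T by apply/andP; split; lra.
    have td : `|t - t2| < d2 by rewrite ger0_norm; lra.
    by have := H2 t tT td; rewrite ler_norml -/w => /andP[? _]; lra.
have := le_trans L (le_trans H (leeD2r _ U)).
rewrite -EFinD lee_fin ler_pdivrMr// mulrDl.
have -> : A * expR (- m) * T * em = A * T * expR (- (m / 2)).
  have -> : expR (- m) = expR (- (m / 2)) * expR (- (m / 2)).
    by rewrite -expRD; congr expR; field.
  have EE : expR (- (m / 2)) * em = 1 by rewrite /em -expRD addNr expR0.
  rewrite (_ : A * _ * T * em = A * T * expR (- (m / 2)) * (expR (- (m / 2)) * em)); last ring.
  by rewrite EE mulr1.
move=> Hf.
have bd : A * T * expR (- (m / 2)) <= w / 4.
  rewrite expRN ler_pdivrMr ?expR_gt0//.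
  apply: (@le_trans _ _ (w / 4 * (1 + m / 2))).
    rewrite /m.
    have -> : w / 4 * (1 + (8 * (A * T) / w + 1) / 2) = A * T + w * (3 / 8).
      by field; rewrite gt_eqF.
    by have : 0 < w by []; lra.
  by rewrite ler_wpM2l ?expR_ge1Dx// divr_ge0// ltW.
have : 0 < w by [].
have := eE; lra.
Qed.

(** Steps of the fixed length allowed by [osgood_step] exhaust [0, T[, and the
    endpoint follows by continuity. *)
Lemma osgood_vanish : W 0 = 0 -> forall t, 0 <= t <= T -> W t = 0.
Proof.
move=> W00.
have inner (t : R) : 0 <= t -> t < T -> W t = 0.
  rewrite le_eqVlt => /orP[/eqP <-//|t0] tT.
  pose n := (Num.truncn (4 * K * t)).+1.
  have n0 : (0 : R) < n%:R by rewrite ltr0n.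
  have nK : K * (t / n%:R) <= 1 / 4.
    rewrite mulrA ler_pdivrMr//.
    by have := truncnS_gt (4 * K * t); rewrite -/n; lra.
  have tn0 : 0 < t / n%:R by rewrite divr_gt0.
  have step_i (i : nat) : (i <= n)%N -> W (i%:R * (t / n%:R)) = 0.
    elim: i => [|i IH] ilen; first by rewrite mul0r.
    have i_le : i.+1%:R * (t / n%:R) <= t.
      rewrite mulrA ler_pdivrMr// mulrC; apply: ler_wpM2l; first exact: ltW.
      by rewrite ler_nat.
    have iE : i.+1%:R = i%:R + 1 :> R by rewrite natr1.
    apply: (@osgood_step (i%:R * (t / n%:R))).
    - by apply: mulr_ge0; [exact: ler0n|exact: ltW].
    - by rewrite iE mulrDl mul1r ltrDl.
    - exact: le_lt_trans tT.
    - rewrite (_ : i.+1%:R * (t / n%:R) - i%:R * (t / n%:R) = t / n%:R)//.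
      by rewrite iE; ring.
    - by apply: IH; exact: ltnW.
  have := step_i n (leqnn n).
  by rewrite mulrC divfK// gt_eqF.
move=> t /andP[t0]; rewrite le_eqVlt => /orP[/eqP ->|]; last exact: inner.
apply/eqP; rewrite eq_le W0 andbT; apply/ler_addgt0Pr => e e0; rewrite add0r.
have TT : 0 <= T <= T by rewrite lexx andbT ltW.
have [d d0 H] := Wcont TT e0.
pose s := Num.max (T / 2) (T - d / 2).
have sT : s < T by rewrite gt_max; apply/andP; split; have := T0 => ?; lra.
have s1 : T / 2 <= s by rewrite le_max lexx.
have s2 : T - d / 2 <= s by rewrite le_max lexx orbT.
have s0 : 0 <= s by have := T0 => ?; lra.
have := H s; rewrite (inner s s0 sT) sub0r normrN s0 (ltW sT) => /(_ isT).
have -> : `|W T| = W T by rewrite ger0_norm.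
by apply; rewrite ltr0_norm; lra.
Qed.

End osgood.

(** * Translates of functions of bounded variation *)

Section variation.
Context {R : realType}.
Local Notation mu := (@lebesgue_measure R).

Lemma ae_lebesgue_filter : Filter (almost_everywhere mu).
Proof. exact: ae_filter_ringOfSetsType. Qed.

Lemma ae_translation (Q : R -> Prop) (c : R) : {ae mu, forall x, Q x} -> {ae mu, forall x, Q (x + c)}.
Proof.
move=> [N [mN N0 QN]]; exists ((fun x => x + c) @^-1` N); split.
- by rewrite -[X in measurable X]setTI; apply: measurable_addr.
- by have := lebesgue_measure_translation c mN; rewrite /pushforward => ->.
- by move=> x /= nQ; apply: QN.
Qed.

Lemma total_variation_le_sub (h : R -> R) (a b x y : R) (v : R) :
  a <= x -> x <= y -> y <= b -> (total_variation a b h <= v%:E)%E ->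
  `|h y - h x| <= fine (total_variation a y h) - fine (total_variation a x h).
Proof.
move=> ax xy yb hv.
have fin z : a <= z -> z <= b -> total_variation a z h \is a fin_num.
  move=> az zb; rewrite ge0_fin_numE ?total_variation_ge0//.
  apply: le_lt_trans (ltry v); apply: le_trans hv.
  by rewrite (total_variationD h az zb) leeDl// total_variation_ge0.
have ay := le_trans ax xy; have xb := le_trans xy yb.
rewrite -lee_fin EFinB !fineK ?fin//.
rewrite (total_variationD h ax xy) addeAC subee ?fin// add0e.
exact: total_variation_ge.
Qed.

Variables (P : R) (P0 : 0 < P).

Let clamp (x : R) := Num.max (- P) (Num.min x P).

(** Let V x be the variation of h on [-P, x]. An increment inside the cell is
    at most V (x + z) - V x, whose integral telescopes to an integral of V
    over a length z. On the last stretch, also of length z, the translate has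
    left the cell, and there the oscillation of h over the period bounds the
    increment. *)
Lemma integral_increment_le (g h : R -> R) (v z : R) : measurable_fun [set: R] g ->
  (forall x, g (x + 2 * P) = g x) -> (total_variation (- P) P h <= v%:E)%E ->
  {ae mu, forall x, - P <= x <= P -> g x = h x} -> 0 <= z <= 2 * P ->
  (\int[mu]_(x in cell P) `|g (x + z) - g x|%:E <= (2 * v * z)%:E)%E.
Proof.
move=> mg gP hv gh /andP[z0 z2].
have PP : - P <= P by rewrite ge0_cp// ltW.
have v0 : 0 <= v by rewrite -lee_fin (le_trans _ hv)// total_variation_ge0.
pose V x := fine (total_variation (- P) (clamp x) h).
have clampP x : - P <= clamp x <= P.
  by rewrite /clamp le_max lexx/= ge_max PP ge_min lexx orbT.
have clamp_le x y : x <= y -> clamp x <= clamp y.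
  by move=> xy; rewrite /clamp !maxEle !minEle; case: (leP x P) => ?; case: (leP y P) => ?;
    case: (leP (- P) x) => ?; case: (leP (- P) y) => ?; case: (leP (- P) P) => ?; lra.
have clampE x : - P <= x <= P -> clamp x = x.
  by move=> /andP[? ?]; rewrite /clamp min_l// max_r.
have hV x y : x <= y -> `|h (clamp y) - h (clamp x)| <= V y - V x.
  move=> xy; have /andP[c1 c2] := clampP x; have /andP[c3 c4] := clampP y.
  by apply: total_variation_le_sub hv => //; exact: clamp_le.
have Vnd x y : x <= y -> V x <= V y.
  by move=> xy; rewrite -subr_ge0; apply: le_trans (hV _ _ xy).
have V0 x : 0 <= V x by apply: fine_ge0; apply: total_variation_ge0; have /andP[] := clampP x.
have Vv x : V x <= v.
  have /andP[c1 c2] := clampP x.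
  rewrite -lee_fin fineK.
    by apply: le_trans hv; rewrite (total_variationD h c1 c2) leeDl// total_variation_ge0.
  rewrite ge0_fin_numE ?total_variation_ge0//; apply: le_lt_trans (ltry v); apply: le_trans hv.
  by rewrite (total_variationD h c1 c2) leeDl// total_variation_ge0.
have mV : measurable_fun [set: R] V by apply: nondecreasing_measurable => // x y; exact: Vnd.
have hosc x y : - P <= x <= P -> - P <= y <= P -> `|h x - h y| <= v.
  move=> xP yP; wlog xy : x y xP yP / x <= y => [H|].
    by have [xy|/ltW yx] := leP x y; [exact: H|rewrite distrC; exact: H].
  rewrite distrC; have := hV _ _ xy; rewrite !clampE// => H; apply: le_trans H _.
  by have := V0 x; have := Vv y; lra.
(* The points of the cell which the translation by z carries out of it. *)
pose J : R -> R := \1_(`[P - z, P[%classic).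
have mJ : measurable_fun [set: R] J by exact: measurable_indic.
have J0 x : 0 <= J x by [].
have IJ : (\int[mu]_(x in cell P) (v * J x)%:E <= (v * z)%:E)%E.
  under eq_integral do rewrite EFinM.
  rewrite ge0_integralZl_EFin; [|exact: measurable_cell|by move=> x _; rewrite lee_fin| |by []].
    rewrite EFinM lee_wpmul2l// /J integral_indic; try exact: measurable_cell; try by [].
    apply: (@le_trans _ _ (mu `[(P - z)%R, P[)).
      apply: le_measure; rewrite ?inE; [|by []|exact: subIsetl].
      by apply: measurableI => //; exact: measurable_cell.
    rewrite /= lebesgue_measure_itv/=; case: ifP => _; last by rewrite lee_fin.
    by rewrite -EFinB lee_fin; lra.
  by apply: measurable_funTS; apply/measurable_EFinP.
have aeb : {ae mu, forall x, cell P x -> (`|g (x + z) - g x|%:E + (V x)%:E <= (V (x + z) + v * J x)%:E)%E}.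
  have gh1 := ae_translation z gh; have gh2 := ae_translation (z - 2 * P) gh.
  apply: (@filterS3 _ _ ae_lebesgue_filter _ _ _ _ _ gh gh1 gh2) => x e0 e1 e2 /andP[x1 x2].
  rewrite -EFinD lee_fin.
  have xP : - P <= x <= P by rewrite x1 ltW.
  have [xz|xz] := leP (x + z) P.
    have xzP : - P <= x + z <= P by apply/andP; split; lra.
    have := @hV x (x + z); rewrite !clampE// lerDl => /(_ z0).
    by rewrite e0// e1//; have := mulr_ge0 v0 (J0 x); lra.
  have xzP : - P <= x + (z - 2 * P) <= P by apply/andP; split; lra.
  have -> : g (x + z) = h (x + (z - 2 * P)).
    by rewrite -e2// -[RHS]gP; congr g; ring.
  have := hosc _ _ xzP xP; rewrite e0// => H.
  have Vxz : V x <= V (x + z) by apply: Vnd; lra.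
  have -> : J x = 1.
    by rewrite /J indicE mem_set//= in_itv/=; apply/andP; split; lra.
  by lra.
have IV : (\int[mu]_(x in cell P) (V x)%:E)%E \is a fin_num.
  rewrite ge0_fin_numE; last by apply: integral_ge0 => x _; rewrite lee_fin.
  apply: le_lt_trans (ltry (v * (2 * P))).
  under eq_integral do rewrite -[V _]ger0_norm//.
  by apply: integral_cell_fin => // x; rewrite ger0_norm.
have IVz : (\int[mu]_(x in cell P) (V (x + z))%:E <= \int[mu]_(x in cell P) (V x)%:E + (v * z)%:E)%E.
  have mVe : measurable_fun [set: R] (EFin \o V) by apply/measurable_EFinP.
  have E : cell P = [set x | (`[- P + z, P + z[%classic : set R) (x + z)].
    by apply/seteqP; split => x; rewrite /cell /= in_itv/=; lra.
  have -> : (\int[mu]_(x in cell P) (V (x + z))%:E =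
      \int[mu]_(x in `[(- P + z)%R, (P + z)%R[) (V x)%:E)%E.
    by rewrite E; apply: (@ge0_integral_translation_on _ z `[- P + z, P + z[%classic (EFin \o V)).
  apply: (@le_trans _ _ (\int[mu]_(x in cell P `|` `[P, (P + z)%R[) (V x)%:E)%E).
    apply: ge0_subset_integral => //.
    - by apply: measurableU => //; exact: measurable_cell.
    - by apply: measurable_funTS; mfun.
    - by move=> x _; rewrite lee_fin.
    - by move=> x; rewrite /cell /= !in_itv/=; lra.
  rewrite ge0_integral_setU; [|exact: measurable_cell|by []|by apply: measurable_funTS; mfun
    |by move=> x _; rewrite lee_fin
    |by rewrite disj_set2E; apply/eqP/seteqP; split => x //=; rewrite /cell /= in_itv/=; lra].
  apply: leeD2l; apply: (@le_trans _ _ (\int[mu]_(x in `[P, (P + z)%R[) (cst v%:E x))%E).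
    by apply: ge0_le_integral_any => x _; rewrite lee_fin.
  rewrite integral_cst//= lebesgue_measure_itv/=; case: ifP => _; last by rewrite mule0 lee_fin mulr_ge0.
  by rewrite -EFinB -EFinM lee_fin addrAC subrr add0r.
rewrite -(leeD2rE _ _ IV) -ge0_integralD; [|exact: measurable_cell|by move=> x _; rewrite lee_fin
  |by apply: measurable_funTS; mfun|by move=> x _; rewrite lee_fin|by apply: measurable_funTS; mfun].
apply: (@le_trans _ _ (\int[mu]_(x in cell P) ((V (x + z))%:E + (v * J x)%:E))%E).
  apply: ae_ge0_le_integral; [exact: measurable_cell
    |by move=> x _; rewrite -EFinD lee_fin addr_ge0
    |by apply: emeasurable_funD; apply: measurable_funTS; mfun
    |by move=> x _; rewrite -EFinD lee_fin addr_ge0// mulr_ge0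
    |by apply: emeasurable_funD; apply: measurable_funTS; mfun
    |exact: aeb].
rewrite ge0_integralD; [|exact: measurable_cell|by move=> x _; rewrite lee_fin
  |by apply: measurable_funTS; mfun|by move=> x _; rewrite lee_fin mulr_ge0|by apply: measurable_funTS; mfun].
apply: le_trans (leeD IVz IJ) _.
by rewrite -addeA addeC -EFinD (_ : 2 * v * z = v * z + v * z)//; ring.
Qed.

End variation.

Section bounded_variation.
Context {R : realType}.
Local Notation mu := (@lebesgue_measure R).
Variables (P : R) (P0 : 0 < P).

Lemma total_variation_osc (h : R -> R) (a b v x y : R) : (total_variation a b h <= v%:E)%E ->
  a <= x <= b -> a <= y <= b -> `|h x - h y| <= v.
Proof.
move=> hv xP yP; wlog xy : x y xP yP / x <= y => [H|].
  by have [xy|/ltW yx] := leP x y; [exact: H|rewrite distrC; exact: H].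
move: xP yP => /andP[ax xb] /andP[ay yb].
rewrite distrC -lee_fin; apply: le_trans (total_variation_ge h xy) _; apply: le_trans hv.
rewrite (total_variationD h ax xb) (total_variationD h xy yb) addeA.
apply: (@le_trans _ _ (total_variation a x h + total_variation x y h)%E).
  by rewrite leeDr// total_variation_ge0.
by rewrite leeDl// total_variation_ge0.
Qed.

(** The slack 1 makes a representative attaining the infimum unnecessary. *)
Lemma ess_total_variation_rep (g : R -> R) (M : R) : (ess_total_variation (- P) P g <= M%:E)%E ->
  exists2 h : R -> R, {ae mu, forall x, - P <= x <= P -> g x = h x} &
    (total_variation (- P) P h <= (M + 1)%:E)%E.
Proof.
move=> gM; have : (ess_total_variation (- P) P g < (M + 1)%:E)%E.
  by apply: le_lt_trans gM _; rewrite lte_fin; lra.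
by move=> /ereal_inf_lt[_ [h gh <-] /ltW hM]; exists h.
Qed.

(** A negative translation is undone by shifting the periodic integral. *)
Lemma bv_modulus (g : R -> R) (M z : R) : measurable_fun [set: R] g ->
  (forall x, g (x + 2 * P) = g x) -> (ess_total_variation (- P) P g <= M%:E)%E ->
  `|z| <= P -> (\int[mu]_(x in cell P) `|g (x + z) - g x|%:E <= (2 * (M + 1) * `|z|)%:E)%E.
Proof.
move=> mg gP /ess_total_variation_rep[h gh hM] zP.
have [z0|z0] := leP 0 z.
  rewrite ger0_norm//; rewrite ger0_norm// in zP; apply: integral_increment_le hM gh _ => //.
  by apply/andP; split=> //; lra.
rewrite ltr0_norm//; rewrite ltr0_norm// in zP.
have zz : 0 <= - z <= 2 * P by apply/andP; split; lra.
have := integral_increment_le P0 mg gP hM gh zz.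
rewrite -(@integral_period_shift _ P (fun x => `|g (x + - z) - g x|%:E) z)//; last 2 first.
- by mfun.
- by move=> x; rewrite gP addrAC gP.
by under eq_integral do rewrite addrK distrC.
Qed.

(** If |h x| exceeds the variation M + 1 by some amount, then |h| exceeds that
    amount on the whole cell, and so does its mean. *)
Lemma bv_sup (g : R -> R) (M L : R) : measurable_fun [set: R] g ->
  (ess_total_variation (- P) P g <= M%:E)%E ->
  (\int[mu]_(x in cell P) `|g x|%:E <= L%:E)%E ->
  {ae mu, forall x, cell P x -> `|g x| <= L / (2 * P) + (M + 1)}.
Proof.
move=> mg /ess_total_variation_rep[h gh hM] gL.
apply: (@filterS _ _ ae_lebesgue_filter _ _ _ gh) => x e /andP[x1 x2].
have xP : - P <= x <= P by rewrite x1 ltW.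
have PP : 0 < 2 * P by lra.
rewrite e// -lerBlDr ler_pdivlMr// -lee_fin; apply: le_trans gL.
have [hx|hx] := leP (`|h x| - (M + 1)) 0.
  apply: (@le_trans _ _ 0%E); first by rewrite lee_fin; apply: mulr_le0_ge0 => //; exact: ltW.
  by apply: integral_ge0 => y _; rewrite lee_fin.
have -> : ((`|h x| - (M + 1)) * (2 * P))%:E = (\int[mu]_(y in cell P) (cst (`|h x| - (M + 1))%:E y))%E.
  rewrite integral_cst; last exact: measurable_cell.
  rewrite cell_itv/= lebesgue_measure_itv/= lte_fin ifT; last lra.
  by rewrite -EFinD -EFinM; congr EFin; ring.
apply: ae_ge0_le_integral; [exact: measurable_cell
  |by move=> y _; rewrite lee_fin ltW
  |exact: measurable_cst
  |by move=> y _; rewrite lee_fin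
  |by apply: measurable_funTS; mfun|].
apply: (@filterS _ _ ae_lebesgue_filter _ _ _ gh) => y ey /andP[y1 y2].
have yP : - P <= y <= P by rewrite y1 ltW.
rewrite ey//= lee_fin lerBlDl -lerBlDr; apply: le_trans (lerB_dist _ _) _.
exact: total_variation_osc hM xP yP.
Qed.

(** Countably many translates of the cell cover the line. *)
Lemma ae_periodic (Q : R -> Prop) : (forall x, Q (x + 2 * P) <-> Q x) ->
  {ae mu, forall x, cell P x -> Q x} -> {ae mu, forall x, Q x}.
Proof.
move=> QP Qc.
have Qn (n : nat) x : (Q (x + n%:R * (2 * P)) <-> Q x).
  elim: n => [|n IH]; first by rewrite mul0r addr0.
  have -> : n.+1%:R = n%:R + 1 :> R by rewrite natr1.
  by rewrite mulrDl mul1r addrA QP.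
have H (n : nat) : {ae mu, forall x, (cell P (x + n%:R * (2 * P)) -> Q x) /\
    (cell P (x + - (n%:R * (2 * P))) -> Q x)}.
  have h1 := ae_translation (n%:R * (2 * P)) Qc.
  have h2 := ae_translation (- (n%:R * (2 * P))) Qc.
  apply: (@filterS2 _ _ ae_lebesgue_filter _ _ _ _ h1 h2) => x H1 H2; split.
    by move=> /H1; rewrite Qn.
  by move=> /H2 H; rewrite -(subrK (n%:R * (2 * P)) x) Qn.
have := ae_foralln H.
apply: (@filterS _ _ ae_lebesgue_filter) => x Hx.
have PP : 0 < 2 * P by rewrite mulr_gt0.
have [x0|x0] := leP (- P) x.
  pose n := Num.truncn ((x + P) / (2 * P)).
  have [_] := Hx n; apply.
  have q0 : 0 <= (x + P) / (2 * P) by rewrite divr_ge0 ?(ltW PP)//; lra.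
  have /andP[] := truncn_itv q0; rewrite -/n ler_pdivlMr// ltr_pdivrMr//.
  have -> : n.+1%:R = n%:R + 1 :> R by rewrite natr1.
  by rewrite mulrDl mul1r => a b; apply/andP; split; lra.
pose n := Num.truncn ((- P - x) / (2 * P)).
have q0 : 0 <= (- P - x) / (2 * P) by rewrite divr_ge0 ?(ltW PP)//; lra.
have nE : n.+1%:R = n%:R + 1 :> R by rewrite natr1.
have /andP[] := truncn_itv q0; rewrite -/n ler_pdivlMr// ltr_pdivrMr// nE mulrDl mul1r.
rewrite le_eqVlt => /orP[/eqP|] a b.
  by have [+ _] := Hx n; apply; apply/andP; split; lra.
by have [+ _] := Hx n.+1; apply; rewrite nE mulrDl mul1r; apply/andP; split; lra.
Qed.

(** Integrate |g| <= e / 2 + g^2 / (2 e) over the cell. *)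
Lemma L1_le_L2 (g : R -> R) (e : R) : measurable_fun [set: R] g -> 0 < e ->
  (L2per_norm P g <= e%:E)%E ->
  (\int[mu]_(x in cell P) `|g x|%:E <= ((P + 1) * e)%:E)%E.
Proof.
move=> mg e0 ge.
have I2 : (\int[mu]_(x in cell P) (g x ^+ 2)%:E <= (e ^+ 2)%:E)%E.
  have H := @poweR_Lnorm _ _ _ mu (EFin \o (g \_ `[- P, P])) 2 (ltac:(by rewrite pnatr_eq0)).
  apply: (@le_trans _ _ (L2per_norm P g `^ 2)%E); last first.
    apply: (@le_trans _ _ (e%:E `^ 2)%E).
      by apply: gt0_ler_poweR => //; rewrite ?in_itv/= ?leey ?andbT ?Lnorm_ge0 ?lee_fin ?(ltW e0).
    by rewrite poweR_EFin powR_mulrn// ltW.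
  rewrite /L2per_norm H [leLHS]integral_mkcond.
  apply: ge0_le_integral_any => x _.
    by apply: erestrict_ge0 => y _; rewrite lee_fin sqr_ge0.
  rewrite /patch; case: ifPn => [|_]; last by rewrite poweR_ge0.
  rewrite inE => /andP[x1 x2]; rewrite /= /patch ifT; last by rewrite inE/= in_itv/= x1 ltW.
  by rewrite /= ?poweR_EFin powR_mulrn// real_normK// num_real.
have mg2 : measurable_fun (cell P) (fun x => (g x ^+ 2)%:E).
  by apply: measurable_funTS; apply/measurable_EFinP; apply: measurable_funX.
apply: (@le_trans _ _ (\int[mu]_(x in cell P) (cst (e / 2)%:E x + ((2 * e)^-1)%:E * (g x ^+ 2)%:E))%E).
  apply: ge0_le_integral_any => x _; first by rewrite lee_fin.
  rewrite /= -EFinM -EFinD lee_fin -(real_normK (num_real (g x))).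
  have : 0 <= (`|g x| - e) ^+ 2 / (2 * e) by rewrite divr_ge0 ?sqr_ge0// mulr_ge0// ltW.
  have -> : (`|g x| - e) ^+ 2 / (2 * e) = e / 2 + (2 * e)^-1 * `|g x| ^+ 2 - `|g x|.
    by field; rewrite gt_eqF.
  by rewrite subr_ge0.
rewrite ge0_integralD; [|exact: measurable_cell|by move=> x _; rewrite lee_fin divr_ge0// ltW
  |exact: measurable_cst|by move=> x _; rewrite -EFinM lee_fin mulr_ge0 ?sqr_ge0// invr_ge0 mulr_ge0// ltW
  |by apply: emeasurable_funM => //; exact: measurable_cst].
rewrite ge0_integralZl_EFin; [|exact: measurable_cell|by move=> x _; rewrite lee_fin sqr_ge0
  |exact: mg2|by rewrite invr_ge0 mulr_ge0// ltW].
rewrite integral_cst; last exact: measurable_cell.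
rewrite cell_itv/= lebesgue_measure_itv/= lte_fin ifT; last by have := P0; lra.
apply: (@le_trans _ _ ((e / 2)%:E * (2 * P)%:E + ((2 * e)^-1)%:E * (e ^+ 2)%:E)%E).
  apply: leeD; first by rewrite -EFinD -!EFinM lee_fin le_eqVlt; apply/orP; left; apply/eqP; ring.
  by apply: lee_wpmul2l => //; rewrite lee_fin invr_ge0 mulr_ge0// ltW.
rewrite -!EFinM -EFinD lee_fin.
have -> : e / 2 * (2 * P) + (2 * e)^-1 * e ^+ 2 = P * e + e / 2 by field; rewrite gt_eqF.
by rewrite mulrDl; lra.
Qed.

End bounded_variation.

(** * Continuity in time *)

Section continuity.
Context {R : realType}.
Local Notation mu := (@lebesgue_measure R).
Variables (P : R) (P0 : 0 < P) (u : R -> R -> R).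
Hypothesis uL2 : forall t : R, 0 <= t -> L2per P (u t).
Hypothesis uC : forall t : R, 0 <= t ->
  L2per_norm P (u s \- u t) @[s --> within `[0, +oo[ (nbhs t)] --> 0%E.

Let mu_ (t : R) : 0 <= t -> measurable_fun [set: R] (u t). Proof. by move=> /uL2[]. Qed.

Lemma L1_finite (t : R) : 0 <= t -> exists2 L : R, 0 <= L & (\int[mu]_(x in cell P) `|u t x|%:E <= L%:E)%E.
Proof.
move=> t0; have [mut _ hfin] := uL2 t0.
pose e := fine (L2per_norm P (u t)) + 1.
have N0 : (0 <= L2per_norm P (u t))%E by exact: Lnorm_ge0.
have e0 : 0 < e by rewrite ltr_wpDl// fine_ge0.
exists ((P + 1) * e); first by rewrite mulr_ge0 ?(ltW e0)// addr_ge0// ltW.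
apply: L1_le_L2 => //.
rewrite EFinD fineK; first by rewrite leeDl.
by rewrite ge0_fin_numE.
Qed.

Lemma L1_continuous (t e : R) : 0 <= t -> 0 < e -> exists2 d, 0 < d &
  forall s, 0 <= s -> `|s - t| < d -> (\int[mu]_(x in cell P) `|u s x - u t x|%:E <= e%:E)%E.
Proof.
move=> t0 e0.
have P1 : 0 < P + 1 by rewrite addr_gt0.
pose e' := e / (P + 1).
have e'0 : 0 < e' by rewrite divr_gt0.
have H : \forall s \near within `[0, +oo[%classic (nbhs t), (L2per_norm P (u s \- u t)%R < e'%:E)%E.
  have N0 : nbhs (0%E : \bar R) [set x | (x < e'%:E)%E].
    by apply: open_ereal_lt'; rewrite lte_fin.
  exact: (uC t0 N0).
move: H; rewrite near_withinE => /nbhs_ballP[d /= d0 Hd].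
exists d => // s s0 st.
have {}Hd : (L2per_norm P (u s \- u t)%R < e'%:E)%E.
  apply: Hd; last by rewrite /= in_itv/= s0.
  by rewrite /ball/= distrC.
have := @L1_le_L2 R P P0 (u s \- u t) e' _ e'0 (ltW Hd).
rewrite /e' mulrC divfK ?gt_eqF//; apply.
by apply: measurable_funB; exact: mu_.
Qed.

Lemma L1_triangle (t s r a b : R) : 0 <= t -> 0 <= s -> 0 <= r ->
  (\int[mu]_(x in cell P) `|u t x - u r x|%:E <= a%:E)%E ->
  (\int[mu]_(x in cell P) `|u r x - u s x|%:E <= b%:E)%E ->
  (\int[mu]_(x in cell P) `|u t x - u s x|%:E <= (a + b)%:E)%E.
Proof.
move=> t0 s0 r0 ha hb; have mt := mu_ t0; have ms := mu_ s0; have mr := mu_ r0.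
rewrite EFinD; apply: le_trans (leeD ha hb).
rewrite -ge0_integralD; [|exact: measurable_cell|by move=> x _; rewrite lee_fin
  |by apply: measurable_funTS; mfun|by move=> x _; rewrite lee_fin|by apply: measurable_funTS; mfun].
apply: ge0_le_integral_any => x _; first by rewrite lee_fin.
by rewrite -EFinD lee_fin; exact: ler_distD.
Qed.

Lemma L1_sym t s : (\int[mu]_(x in cell P) `|u t x - u s x|%:E = \int[mu]_(x in cell P) `|u s x - u t x|%:E)%E.
Proof. by apply: eq_integral => x _; rewrite distrC. Qed.

Variable T : R.

(** Compactness of [0, T] in its covering form; the second variable of the
    filter is the modulus. *)
Lemma L1_unif_continuous (e : R) : 0 < e -> exists2 a, 0 < a &
  forall t s, 0 <= t <= T -> 0 <= s <= T -> `|t - s| < a ->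
  (\int[mu]_(x in cell P) `|u t x - u s x|%:E <= e%:E)%E.
Proof.
move=> e0.
have cpt : compact (`[0, T] : set R) by exact: segment_compact.
have cov := (near_covering_withinP _).2 ((compact_near_coveringP _).1 cpt).
pose Q (a t : R) := forall s, 0 <= s <= T -> `|t - s| < a ->
  (\int[mu]_(x in cell P) `|u t x - u s x|%:E <= e%:E)%E.
have ptw (x : R) : `[0, T]%classic x ->
    \forall x' \near x & a \near (0:R)^'+, `[0, T]%classic x' -> Q a x'.
  rewrite /= in_itv/= => /andP[x0 xT].
  have [d d0 Hd] := L1_continuous x0 (divr_gt0 e0 (ltr0n _ 2)).
  have d20 : 0 < d / 2 by rewrite divr_gt0.
  exists (ball x (d / 2), [set a : R | a < d / 2]).
    split; first exact: nbhsx_ballx.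
    exact: nbhs_right_lt.
  move=> [y a] /= [yx ad]; rewrite in_itv/= => /andP[y0 yT] s /andP[s0 sT] ysa.
  have yx' : `|x - y| < d / 2 by exact: yx.
  rewrite [e]splitr; apply: (@L1_triangle _ _ x) => //.
    by apply: Hd => //; rewrite distrC; lra.
  rewrite L1_sym; apply: Hd => //.
  apply: le_lt_trans (ler_distD y _ _) _.
  by rewrite (distrC s) (distrC y x); lra.
have H := cov R (0:R)^'+ Q (at_right_proper_filter (0:R)) ptw.
have [a [a0 Ha]] := filter_ex (filterI (nbhs_right_gt (0:R)) H).
exists a => // t s tT sT ts; apply: Ha => //.
Qed.

Lemma L1_bounded : exists2 L : R, 0 <= L &
  forall t, 0 <= t <= T -> (\int[mu]_(x in cell P) `|u t x|%:E <= L%:E)%E.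
Proof.
have cpt : compact (`[0, T] : set R) by exact: segment_compact.
have cov := (near_covering_withinP _).2 ((compact_near_coveringP _).1 cpt).
pose Q (L t : R) := (\int[mu]_(x in cell P) `|u t x|%:E <= L%:E)%E.
have ptw (x : R) : `[0, T]%classic x ->
    \forall x' \near x & L \near (+oo_R), `[0, T]%classic x' -> Q L x'.
  rewrite /= in_itv/= => /andP[x0 xT].
  have [d d0 Hd] := L1_continuous x0 (@ltr01 R).
  have [L L0 HL] := L1_finite x0.
  exists (ball x d, [set M : R | L + 1 < M]).
    split; first exact: nbhsx_ballx.
    by exists (L + 1); split; first exact: num_real.
  move=> [y M] /= [yx /ltW LM]; rewrite in_itv/= => /andP[y0 yT].
  have yx' : `|y - x| < d by rewrite distrC; exact: yx.
  apply: (@le_trans _ _ (L + 1)%:E); last by rewrite lee_fin.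
  rewrite EFinD; apply: le_trans (leeD HL (Hd _ y0 yx')).
  have mx := mu_ x0; have my := mu_ y0.
  rewrite -ge0_integralD; [|exact: measurable_cell|by move=> z _; rewrite lee_fin
    |by apply: measurable_funTS; mfun|by move=> z _; rewrite lee_fin|by apply: measurable_funTS; mfun].
  apply: ge0_le_integral_any => z _; first by rewrite lee_fin.
  rewrite -EFinD lee_fin; apply: le_trans (ler_normD _ _).
  by rewrite addrC subrK.
have H := cov R (+oo_R) Q proper_pinfty_nbhs ptw.
have [L [L0 HL]] := filter_ex (filterI (nbhs_pinfty_ge (num_real (0:R))) H).
by exists L => // t tT; apply: HL; rewrite /= in_itv.
Qed.

End continuity.

(** * Tensor products as test functions *)

Section tensor.
Context {R : realType}.
Variables (F F' H H' : R -> R).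
Hypotheses (cF : C1c F F') (cH : C1c H H').

Let phi (z : R * R) : R := F z.1 * H z.2.

Lemma is_derive_tensor_t (z : R * R) : is_derive z (1, 0) phi (F' z.1 * H z.2).
Proof.
have [dF _ _] := cF.
have d1 : is_derive z.1 (1:R) (fun t => H z.2 * F t) (H z.2 * F' z.1).
  exact: (is_deriveZ (H z.2) (dF z.1)).
have E : (fun h : R => h^-1 *: (phi (h *: (1, 0) + z) - phi z)) =
         (fun h : R => h^-1 *: (H z.2 * F (h *: (1:R) + z.1) - H z.2 * F z.1)).
  apply/funext => h; rewrite /phi/=.
  by rewrite scaler0 add0r !(mulrC (H z.2)).
have [h1 h2] := d1.
split.
  by rewrite /derivable E.
by rewrite /derive E [RHS]mulrC; exact: h2.
Qed.

Lemma is_derive_tensor_x (z : R * R) : is_derive z (0, 1) phi (F z.1 * H' z.2).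
Proof.
have [dH _ _] := cH.
have d1 : is_derive z.2 (1:R) (fun x => F z.1 * H x) (F z.1 * H' z.2).
  exact: (is_deriveZ (F z.1) (dH z.2)).
have E : (fun h : R => h^-1 *: (phi (h *: (0, 1) + z) - phi z)) =
         (fun h : R => h^-1 *: (F z.1 * H (h *: (1:R) + z.2) - F z.1 * H z.2)).
  by apply/funext => h; rewrite /phi/= scaler0 add0r.
have [h1 h2] := d1.
split.
  by rewrite /derivable E.
by rewrite /derive E.
Qed.

Lemma dt_tensor : dt phi = (fun z => F' z.1 * H z.2).
Proof. by apply/funext => z; have [_ <-] := is_derive_tensor_t z. Qed.

Lemma dx_tensor : dx phi = (fun z => F z.1 * H' z.2).
Proof. by apply/funext => z; have [_ <-] := is_derive_tensor_x z. Qed.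

Lemma continuous_tensor (A B : R -> R) : continuous A -> continuous B ->
  continuous (fun z : R * R => A z.1 * B z.2).
Proof.
move=> cA cB z; apply: cvgM.
  by apply: (@continuous_comp _ _ _ fst A); [exact: cvg_fst|exact: cA].
by apply: (@continuous_comp _ _ _ snd B); [exact: cvg_snd|exact: cB].
Qed.

Lemma test_function_tensor (a b : R) : 0 < a -> (forall t, F t != 0 -> a <= t <= b) ->
  test_function phi.
Proof.
move=> a0 Fsupp.
have [dF cF' _] := cF; have [dH cH' [N HN]] := cH.
have cFF := is_derive_continuous dF; have cHH := is_derive_continuous dH.
split.
- by move=> z; split; [have [] := is_derive_tensor_t z|have [] := is_derive_tensor_x z].
- exact: continuous_tensor.
- by rewrite dt_tensor; exact: continuous_tensor.
- by rewrite dx_tensor; exact: continuous_tensor.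
have cpt : compact (`[a, b] `*` `[- N, N] : set (R * R)).
  by apply: compact_setX; exact: segment_compact.
have clo : closed (`[a, b] `*` `[- N, N] : set (R * R)).
  by apply: compact_closed cpt; exact: norm_hausdorff.
have sub : closure [set z | phi z != 0] `<=` `[a, b] `*` `[- N, N].
  rewrite [X in _ `<=` X](closure_id _).1//; apply: closureS => -[t x] /=.
  rewrite /phi/= mulf_eq0 negb_or => /andP[/Fsupp tab hx]; split => /=; rewrite in_itv//=.
  rewrite -ler_norml leNgt; apply: contra hx => /HN ->; exact: eqxx.
split.
  by apply: subclosed_compact cpt sub; exact: closed_closure.
move=> z /sub[/=]; rewrite !in_itv/= => /andP[az _] _; split => //=.
by rewrite ?in_itv/= ?andbT; exact: lt_le_trans az.
Qed.

End tensor.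

(** * Integrals and almost everywhere equality *)

Section nonmeasurable.
Import HBNNSimple.
Local Open Scope ereal_scope.
Context d (T : measurableType d) (R : realType) (m : {measure set T -> \bar R}).

Let ge0_le_ae (p q : T -> \bar R) (N : set T) : measurable N -> m N = 0 ->
  (forall z, 0 <= p z) -> (forall z, 0 <= q z) -> (forall z, ~ N z -> p z = q z) ->
  \int[m]_z p z <= \int[m]_z q z.
Proof.
move=> mN N0 p0 q0 pq.
rewrite ge0_integralTE// ge0_integralTE//.
apply: ge_ereal_sup => _ [h /= hp <-].
have mC : measurable (~` N) by exact: measurableC.
pose h' := proj_nnsfun h mC.
have -> : sintegral m h = sintegral m h'.
  rewrite -!integralT_nnsfun; apply: ge0_ae_eq_integral => //.
  - exact/measurable_EFinP.
  - exact/measurable_EFinP.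
  - by move=> x _; rewrite lee_fin.
  - by move=> x _; rewrite lee_fin.
  - exists N; split => // x /= nx; apply: contrapT => Nx; apply: nx => _.
    by congr EFin; rewrite /h' /proj_nnsfun/= mindicE mem_set// mulr1.
apply: ereal_sup_ubound; exists h' => //= z.
have [zN|zN] := pselect (N z).
  by rewrite /h' /proj_nnsfun/= mindicE memNset ?mulr0//=; exact.
by rewrite /h' /proj_nnsfun/= mindicE mem_set// mulr1 -pq.
Qed.

(** Integrals are suprema over simple functions, and these can be cut off on a
    null set, so the functions need not be measurable. This matters for (t, x)
    -> Gper P K (u t) x, whose measurability, as a limit over e -> 0+, is not
    immediate. *)
Lemma integral_ae_eq_any (D : set T) (f g : T -> \bar R) :
  {ae m, forall z, D z -> f z = g z} ->
  \int[m]_(z in D) f z = \int[m]_(z in D) g z.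
Proof.
move=> [N [mN N0 fg]].
have e z : ~ N z -> (f \_ D) z = (g \_ D) z.
  move=> Nz; rewrite /patch; case: ifPn => // zD.
  by apply: contrapT => h; apply: Nz; apply: fg => /= H; apply: h; apply: H; rewrite inE in zD.
rewrite integral_mkcond [RHS]integral_mkcond integralE [RHS]integralE.
congr (_ - _); apply/eqP; rewrite eq_le; apply/andP; split; apply: ge0_le_ae mN N0 _ _ _ => //;
  by move=> z /e; rewrite ?funeposE ?funenegE => ->.
Qed.

End nonmeasurable.

Section almost_everywhere.
Context {R : realType}.
Local Notation mu := (@lebesgue_measure R).

Lemma C1c_derive_supp (F F' : R -> R) (a b : R) : C1c F F' ->
  (forall t, F t != 0 -> a <= t <= b) -> forall t, F' t != 0 -> a <= t <= b.
Proof.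
move=> [dF _ _] Fs t; apply: contraNT => tab.
have [_ <-] := dF t.
suff -> : 'D_1 F t = 'D_1 (cst 0 : R -> R) t by rewrite derive_cst.
apply: near_eq_derive.
have z s : ~~ (a <= s <= b) -> F s = cst 0 s.
  by move=> H; apply/eqP; apply: contraNT H => /Fs.
move: tab; rewrite negb_and -!ltNge => /orP[ta|bt].
  near=> s; apply: z; rewrite negb_and -!ltNge; apply/orP; left.
  by near: s; exact: lt_nbhsl.
near=> s; apply: z; rewrite negb_and -!ltNge; apply/orP; right.
by near: s; exact: lt_nbhsr.
Unshelve. all: by end_near. Qed.

Lemma ae_reflection (Q : R -> Prop) : {ae mu, forall x, Q x} -> {ae mu, forall x, Q (- x)}.
Proof.
move=> [N [mN N0 QN]]; exists (-%R @^-1` N); split.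
- by rewrite -[X in measurable X]setTI; apply: oppr_measurable.
- by have := lebesgue_measureN mN; rewrite /pushforward => ->.
- by move=> x /= nQ; apply: QN.
Qed.

Lemma Gper_ae_eq (P : R) (K g h : R -> R) (x : R) : {ae mu, forall y, g y = h y} ->
  Gper P K g x = Gper P K h x.
Proof.
move=> gh; rewrite /Gper.
suff E (e : R) : \int[mu]_(y in `]- P, P[ `\` `]- e, e[) (K y * g (x - y)) = \int[mu]_(y in `]- P, P[ `\` `]- e, e[) (K y * h (x - y)).
  by under eq_fun do rewrite E.
rewrite /Rintegral; congr fine.
apply: (@integral_ae_eq_any _ _ R (@lebesgue_measure R)).
have := ae_reflection (ae_translation x gh).
apply: (@filterS _ _ ae_lebesgue_filter) => y H _.
by rewrite addrC H.
Qed.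

End almost_everywhere.

(** * A bounded representative of a solution *)

Section bounded_representative.
Context {R : realType}.
Local Notation mu := (@lebesgue_measure R).
Local Notation mu2 := (mu \x mu)%E.

Definition clip (B y : R) : R := Num.max (- B) (Num.min y B).

Lemma clip_id (B y : R) : `|y| <= B -> clip B y = y.
Proof. by rewrite ler_norml /clip => /andP[h1 h2]; rewrite min_l// max_r. Qed.

Lemma clip_bound (B y : R) : 0 <= B -> `|clip B y| <= B.
Proof.
by move=> B0; rewrite /clip ler_norml le_max lexx/= ge_max ge_min lexx orbT andbT; lra.
Qed.

Lemma measurable_clip (B : R) : measurable_fun [set: R] (clip B).
Proof.
apply: measurable_maxr; first exact: measurable_cst.
by apply: measurable_minr; [exact: measurable_id|exact: measurable_cst].
Qed.

Variables (P T B M : R) (u : R -> R -> R).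
Hypotheses (P0 : 0 < P) (B0 : 0 <= B).
Hypothesis u_loc : locally_integrable_halfplane (fun z => u z.1 z.2).
Hypothesis uL2 : forall t : R, 0 <= t -> L2per P (u t).
Hypothesis uC : forall t : R, 0 <= t ->
  L2per_norm P (u s \- u t) @[s --> within `[0, +oo[ (nbhs t)] --> 0%E.
Hypothesis uTV : forall t, 0 <= t <= T -> (ess_total_variation (- P) P (u t) <= M%:E)%E.
Hypothesis uB : forall t, 0 <= t <= T -> {ae mu, forall x, `|u t x| <= B}.

(** On [0, T] clipping at an essential bound of the slices alters each of them
    on a null set only; the value 0 at other times makes the function
    measurable on the whole plane. *)
Definition clipped (z : R * R) : R := if 0 <= z.1 <= T then clip B (u z.1 z.2) else 0.

(** Local integrability provides measurability on the compact rectangles [0,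
    T] x [-n, n]. *)
Lemma measurable_solution : measurable_fun (`[0, T] `*` [set: R]) (fun z : R * R => u z.1 z.2).
Proof.
have -> : `[0, T] `*` [set: R] = \bigcup_n (`[0, T] `*` `[- n%:R, n%:R]).
  apply/seteqP; split => [[t x] [/= tT _]|[t x] [n _ [/= tT _]]]; last by split.
  exists (Num.bound `|x|) => //; split => //=.
  by rewrite in_itv/= -ler_norml ltW// archi_boundP.
apply/measurable_fun_bigcup => n.
  by apply: measurableX; exact: measurable_itv.
apply/measurable_EFinP; apply: (@measurable_int _ _ _ mu2); apply: u_loc.
  by apply: compact_setX; exact: segment_compact.
by move=> [t x] [/= + _]; rewrite !in_itv/= => /andP[-> _].
Qed.

Lemma measurable_clipped : measurable_fun [set: R * R] clipped.
Proof.
pose D := `[0, T] `*` [set: R].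
have mD : measurable D by apply: measurableX; [exact: measurable_itv|exact: measurableT].
have -> : clipped = (fun z => clip B (u z.1 z.2)) \_ D.
  apply/funext => z; rewrite /clipped /patch.
  have -> // : (z \in D) = (0 <= z.1 <= T).
  by apply/idP/idP; rewrite inE /D /= in_itv/=; [case|split].
apply/(measurable_restrictT _ mD).
apply: (@measurableT_comp _ _ _ _ _ _ (clip B)); first exact: measurable_clip.
exact: measurable_solution.
Qed.

Lemma clipped_bound z : `|clipped z| <= B.
Proof. by rewrite /clipped; case: ifP => _; [exact: clip_bound|rewrite normr0]. Qed.

Lemma clipped_periodic t x : clipped (t, x + 2 * P) = clipped (t, x).
Proof.
by rewrite /clipped/=; case: ifP => // /andP[t0 _]; have [_ -> _] := uL2 t0.
Qed.

Lemma clipped_ae t : 0 <= t <= T -> {ae mu, forall x, clipped (t, x) = u t x}.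
Proof.
move=> tT; have := uB tT; apply: (@filterS _ _ ae_lebesgue_filter) => x.
by rewrite /clipped/= tT; exact: clip_id.
Qed.

Lemma clipped_modulus t h : 0 <= M -> `|h| <= P ->
  (\int[mu]_(x in cell P) `|clipped (t, x + h) - clipped (t, x)|%:E <= (2 * (M + 1) * `|h|)%:E)%E.
Proof.
move=> M0 hP; have [tT|tT] := boolP (0 <= t <= T); last first.
  under eq_integral do rewrite /clipped/= (negbTE tT) subrr normr0.
  by rewrite integral0 lee_fin mulr_ge0//; lra.
have t0 : 0 <= t by case/andP: tT.
have [mut put _] := uL2 t0.
rewrite (@integral_ae_eq_any _ _ R mu (cell P) _ (fun x => `|u t (x + h) - u t x|%:E)).
  by apply: bv_modulus => //; exact: uTV.
apply: (@filterS2 _ _ ae_lebesgue_filter _ _ _ _ (ae_translation h (clipped_ae tT)) (clipped_ae tT)).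
by move=> x -> -> _.
Qed.

Lemma clipped_dist_le t s e : 0 <= t <= T -> 0 <= s <= T ->
  (\int[mu]_(x in cell P) `|u t x - u s x|%:E <= e)%E ->
  (\int[mu]_(x in cell P) `|clipped (t, x) - clipped (s, x)|%:E <= e)%E.
Proof.
move=> tT sT H; rewrite (@integral_ae_eq_any _ _ R mu (cell P) _ (fun x => `|u t x - u s x|%:E)).
  by [].
apply: (@filterS2 _ _ ae_lebesgue_filter _ _ _ _ (clipped_ae tT) (clipped_ae sT)).
by move=> x -> -> _.
Qed.

Lemma clipped_unif_continuous e : 0 < e -> exists2 a, 0 < a &
  forall t s, 0 <= t <= T -> 0 <= s <= T -> `|t - s| < a ->
  (\int[mu]_(x in cell P) `|clipped (t, x) - clipped (s, x)|%:E <= e%:E)%E.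
Proof.
move=> e0; have [a a0 aP] := L1_unif_continuous P0 uL2 uC T e0.
exists a => // t s tT sT ts; apply: clipped_dist_le => //; exact: aP.
Qed.

End bounded_representative.

(** * Finiteness and stability of the singular operator *)

Section null_sets.
Context {R : realType}.
Local Notation mu := (@lebesgue_measure R).
Local Notation mu2 := (mu \x mu)%E.

Lemma null_of_null_slices (N : set (R * R)) : measurable N ->
  (forall t, {ae mu, forall x, ~ N (t, x)}) -> mu2 N = 0%E.
Proof.
move=> mN N0; rewrite /product_measure1 /=.
under eq_integral => t _.
  rewrite /=.
  have -> : mu (xsection N t) = 0%E.
    have [N' [mN' N'0 NN']] := N0 t.
    apply/eqP; rewrite eq_le measure_ge0 andbT -N'0.
    apply: le_measure; rewrite ?inE//; first exact: measurable_xsection.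
    move=> x; rewrite /xsection/= inE => Ntx; apply: NN' => /=; exact.
  over.
by rewrite integral0.
Qed.

End null_sets.

Section singular_operator.
Context {R : realType}.
Local Notation mu := (@lebesgue_measure R).
Variables (P : R) (K : R -> R) (CK : R).
Hypothesis P0 : 0 < P.
Hypothesis K1 : forall x, kernel_domain P x -> derivable K x 1 /\ {for x, continuous (derive1 K)}.
Hypothesis Kodd : forall x, kernel_domain P x -> K (- x) = - K x.
Hypothesis CK0 : 0 < CK.
Hypothesis Kbd : forall (i : nat) (x : R), (i <= 1)%N -> - P <= x <= P -> x != 0 ->
          `|derive1n i K x| <= CK / `|x| ^+ i.+1.

Lemma measurable_abs_singular (uu : R * R -> R) : measurable_fun [set: R * R] uu ->
  measurable_fun [set: R * R] (fun z => abs_singular P K (fun y => uu (z.1, y)) z.2).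
Proof.
move=> mu_.
have mK := measurable_cut_kernel P0 K1.
pose h (w : (R * R) * R) : \bar R :=
  (`|cut_kernel P K w.2| * `|uu (w.1.1, w.1.2 - w.2) - uu (w.1.1, w.1.2)|)%:E.
have mh : measurable_fun setT h by rewrite /h; mfun.
apply: (measurable_partial_integral mu measurableT mh) => z.
by rewrite lee_fin mulr_ge0.
Qed.

Lemma singular_periodic (w : R -> R) x : (forall x, w (x + 2 * P) = w x) ->
  singular P K w (x + 2 * P) = singular P K w x.
Proof.
move=> wP; rewrite /singular; congr fine; apply: eq_integral => y _.
by rewrite -(wP x) -(wP (x - y)); congr (_ * (w _ - _))%:E; ring.
Qed.

Lemma abs_singular_periodic (w : R -> R) x : (forall x, w (x + 2 * P) = w x) ->
  abs_singular P K w (x + 2 * P) = abs_singular P K w x.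
Proof.
move=> wP; rewrite /abs_singular; apply: eq_integral => y _.
by rewrite -(wP x) -(wP (x - y)); congr (_ * `|w _ - _|)%:E; ring.
Qed.

(** The integral over one period is finite by [integral_abs_singular_le]. *)
Lemma abs_singular_finite (w : R -> R) (D B : R) :
  measurable_fun [set: R] w -> (forall x, w (x + 2 * P) = w x) -> (forall x, `|w x| <= B) ->
  (forall h, `|h| <= P -> (\int[mu]_(x in cell P) `|w (x + h) - w x|%:E <= (D * `|h|)%:E)%E) ->
  0 <= D -> {ae mu, forall x, (abs_singular P K w x < +oo)%E}.
Proof.
move=> mw wP wB wD D0.
apply: (ae_periodic P0) => [x|]; first by rewrite abs_singular_periodic.
have mA : measurable_fun [set: R] (abs_singular P K w).
  have mw2 : measurable_fun [set: R * R] (fun z => w z.2) by mfun.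
  have /= h := @measurableT_comp _ _ _ _ _ _ _ _ _ (measurable_abs_singular mw2) (pair1_measurable (0:R)).
  exact: h.
have wL : (\int[mu]_(x in cell P) `|w x|%:E <= (2 * P * B)%:E)%E.
  apply: (@le_trans _ _ (\int[mu]_(x in cell P) (cst B%:E) x)%E).
    by apply: ge0_le_integral_any => x _; rewrite lee_fin.
  rewrite cell_itv integral_cst//= lebesgue_measure_itv/= lte_fin ifT; last by have := P0; lra.
  by rewrite -EFinD -EFinM lee_fin; lra.
have H := integral_abs_singular_le P0 K1 CK0 Kbd mw wP wD D0 ltr01 wL.
have A0 x : (0 <= abs_singular P K w x)%E.
  by apply: integral_ge0 => y _; rewrite lee_fin mulr_ge0.
have : mu.-integrable (cell P) (abs_singular P K w).
  apply/integrableP; split; first by apply: measurable_funTS; exact: mA.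
  under eq_integral do rewrite gee0_abs//.
  by apply: le_lt_trans H _; rewrite ltry.
move=> /(@integrable_ae _ _ R mu (cell P) (measurable_cell P)).
apply: (@filterS _ _ ae_lebesgue_filter) => x H1 /H1.
by rewrite ge0_fin_numE.
Qed.

(** The difference w1 - w2 has modulus of continuity D1 + D2, and
    [abs_singular] of it bounds the difference of the two operators wherever
    both converge. *)
Lemma singular_dist_le (w1 w2 : R -> R) (D1 D2 B m L : R) :
  measurable_fun [set: R] w1 -> measurable_fun [set: R] w2 ->
  (forall x, w1 (x + 2 * P) = w1 x) -> (forall x, w2 (x + 2 * P) = w2 x) ->
  (forall x, `|w1 x| <= B) -> (forall x, `|w2 x| <= B) ->
  (forall h, `|h| <= P -> (\int[mu]_(x in cell P) `|w1 (x + h) - w1 x|%:E <= (D1 * `|h|)%:E)%E) ->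
  (forall h, `|h| <= P -> (\int[mu]_(x in cell P) `|w2 (x + h) - w2 x|%:E <= (D2 * `|h|)%:E)%E) ->
  0 <= D1 -> 0 <= D2 -> 0 < m ->
  (\int[mu]_(x in cell P) `|w1 x - w2 x|%:E <= L%:E)%E ->
  (\int[mu]_(x in cell P) `|singular P K w1 x - singular P K w2 x|%:E <=
     (2 * CK * (D1 + D2) * P * expR (- m) + 4 * CK * L * m)%:E)%E.
Proof.
move=> mw1 mw2 w1P w2P w1B w2B w1D w2D D10 D20 m0 wL.
pose w y := w1 y - w2 y.
have mw : measurable_fun [set: R] w by rewrite /w; mfun.
have mA : measurable_fun [set: R] (abs_singular P K w).
  have mw2' : measurable_fun [set: R * R] (fun z => w z.2) by mfun.
  have /= h := @measurableT_comp _ _ _ _ _ _ _ _ _ (measurable_abs_singular mw2') (pair1_measurable (0:R)).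
  exact: h.
have A0 x : (0 <= abs_singular P K w x)%E.
  by apply: integral_ge0 => y _; rewrite lee_fin mulr_ge0.
apply: (@le_trans _ _ (\int[mu]_(x in cell P) abs_singular P K w x)%E).
  have f1 := abs_singular_finite mw1 w1P w1B w1D D10.
  have f2 := abs_singular_finite mw2 w2P w2B w2D D20.
  (* The minimum agrees with the integrand almost everywhere and obeys the
     bound everywhere. *)
  pose q x : \bar R := mine `|singular P K w1 x - singular P K w2 x|%:E (abs_singular P K w x).
  rewrite (@integral_ae_eq_any _ _ R mu (cell P) _ q).
    apply: ge0_le_integral_any => x _; first by rewrite le_min lee_fin normr_ge0/=.
    by rewrite ge_min lexx orbT.
  apply: (@filterS2 _ _ ae_lebesgue_filter _ _ _ _ f1 f2) => x h1 h2 _.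
  by rewrite /q min_l//; exact: singular_sub_le.
apply: (integral_abs_singular_le P0 K1 CK0 Kbd) => //.
- by move=> x; rewrite /w w1P w2P.
- move=> h hP; apply: (@le_trans _ _ (\int[mu]_(x in cell P)
     (`|w1 (x + h) - w1 x|%:E + `|w2 (x + h) - w2 x|%:E))%E).
    apply: ge0_le_integral_any => x _; first by rewrite lee_fin.
    rewrite -EFinD lee_fin /w (_ : _ - _ - _ = (w1 (x + h) - w1 x) - (w2 (x + h) - w2 x)).
      exact: ler_normB.
    by ring.
  rewrite ge0_integralD.
  - by rewrite mulrDl EFinD; apply: leeD; [exact: w1D|exact: w2D].
  - exact: measurable_cell.
  - by move=> x _; rewrite lee_fin.
  - by apply: measurable_funTS; mfun.
  - by move=> x _; rewrite lee_fin.
  - by apply: measurable_funTS; mfun.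
- exact: addr_ge0.
Qed.

Lemma singular_cst0 x : singular P K (fun=> 0) x = 0.
Proof.
rewrite /singular /Rintegral (eq_integral (fun=> 0%E)) ?integral0// => y _.
by rewrite subrr mulr0.
Qed.

End singular_operator.

(** * The entropy inequality of the bounded representative *)

Section regularized_solution.
Context {R : realType}.
Local Notation mu := (@lebesgue_measure R).
Local Notation mu2 := (mu \x mu)%E.
Variables (P T B M CK : R) (f K ubar : R -> R) (u : R -> R -> R).
Hypotheses (P0 : 0 < P) (B0 : 0 <= B) (M0 : 0 <= M).
Hypothesis K1 : forall x, kernel_domain P x -> derivable K x 1 /\ {for x, continuous (derive1 K)}.
Hypothesis Kodd : forall x, kernel_domain P x -> K (- x) = - K x.
Hypothesis CK0 : 0 < CK.
Hypothesis Kbd : forall (i : nat) (x : R), (i <= 1)%N -> - P <= x <= P -> x != 0 ->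
          `|derive1n i K x| <= CK / `|x| ^+ i.+1.
Hypothesis u_sol : entropy_weak_solution P f K ubar u.
Hypothesis uTV : forall t, 0 <= t <= T -> (ess_total_variation (- P) P (u t) <= M%:E)%E.
Hypothesis uB : forall t, 0 <= t <= T -> {ae mu, forall x, `|u t x| <= B}.

Local Notation r := (clipped T B u).

Definition clipped_source (z : R * R) : R := singular P K (fun y => r (z.1, y)) z.2.

Let u_loc : locally_integrable_halfplane (fun z => u z.1 z.2). Proof. by case: u_sol. Qed.
Let uL2 : forall t : R, 0 <= t -> L2per P (u t). Proof. by case: u_sol. Qed.
Let mr : measurable_fun [set: R * R] r := measurable_clipped T B u_loc.

Let mrt (t : R) : measurable_fun [set: R] (fun y => r (t, y)).
Proof. by mfun. Qed.

Lemma measurable_clipped_source : measurable_fun [set: R * R] clipped_source.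
Proof. exact: measurable_singular. Qed.

Lemma clipped_source_periodic t x : clipped_source (t, x + 2 * P) = clipped_source (t, x).
Proof. by apply: singular_periodic => y; apply: clipped_periodic. Qed.

Lemma clipped_abs_singular_finite t :
  {ae mu, forall x, (abs_singular P K (fun y => r (t, y)) x < +oo)%E}.
Proof.
apply: (abs_singular_finite P0 K1 CK0 Kbd (B := B) (D := 2 * (M + 1))) => //.
- by move=> x; apply: clipped_periodic.
- by move=> x; apply: clipped_bound.
- by move=> h hP; apply: clipped_modulus.
- by have := M0; lra.
Qed.

(** The integrands of the two entropy inequalities agree off two null sets:
    the points where u differs from its clipping, and those where
    [abs_singular] is infinite, so that Gper and [singular] may differ. *)
Lemma clipped_entropic : entropic T f r clipped_source.
Proof.
move=> k F F' H H' cF cH F0 H0 [c c0 Fc].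
have Fc' := C1c_derive_supp cF Fc.
pose phi (z : R * R) : R := F z.1 * H z.2.
have tphi : test_function phi := test_function_tensor cF cH c0 Fc.
have [_ _ _ _ /(_ k phi tphi)] := u_sol.
have phi0 z : 0 <= phi z by rewrite /phi mulr_ge0.
move=> /(_ phi0) ent; apply: (le_trans ent).
rewrite le_eqVlt; apply/orP; left; apply/eqP.
rewrite integral_mkcond (dt_tensor H cF) (dx_tensor F cH).
apply: (@integral_ae_eq_any _ _ R mu2 setT).
pose D := `[0, T] `*` [set: R].
have mD : measurable D by apply: measurableX; [exact: measurable_itv|exact: measurableT].
have mA := measurable_abs_singular P0 K1 mr.
pose N1 := D `&` [set z | u z.1 z.2 != r z].
pose N2 := [set z | abs_singular P K (fun y => r (z.1, y)) z.2 = +oo%E].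
have mN1 : measurable N1.
  have mu_ : measurable_fun D (fun z => u z.1 z.2 - r z).
    apply: measurable_funB; first exact: measurable_solution.
    exact: measurable_funTS.
  rewrite (_ : N1 = D `&` (fun z => u z.1 z.2 - r z) @^-1` (~` [set 0])).
    by apply: mu_ => //; apply: measurableC; exact: measurable_set1.
  apply/seteqP; split => z [Dz] /= h; split => //=.
    by move=> /eqP; rewrite subr_eq0; apply/negP.
  by apply/eqP => e; apply: h; rewrite e subrr.
have mN2 : measurable N2.
  rewrite -[N2]setTI.
  by apply: (mA measurableT [set +oo%E]); exact: emeasurable_set1.
have N10 : mu2 N1 = 0%E.
  apply: null_of_null_slices => // t.
  have [tT|tT] := boolP (0 <= t <= T).
    apply: (@filterS _ _ ae_lebesgue_filter _ _ _ (clipped_ae uB tT)) => x rx [_ /=].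
    by rewrite rx eqxx.
  apply: aeW => x [[/= + _] _]; rewrite in_itv/=; exact/negP.
have N20 : mu2 N2 = 0%E.
  apply: null_of_null_slices => // t.
  apply: (@filterS _ _ ae_lebesgue_filter _ _ _ (clipped_abs_singular_finite t)) => x h.
  by rewrite /N2/= => e; rewrite e in h.
exists (N1 `|` N2); split.
- exact: measurableU.
- apply/eqP; rewrite eq_le measure_ge0 andbT.
  by apply: (le_trans (measureU2 mu2 mN1 mN2)); rewrite [X in (X + _)%E]N10 [X in (_ + X)%E]N20 adde0.
move=> [t x] /= nz; apply: contrapT => nN; apply: nz => _.
rewrite /patch /phi/=.
have [tc|tc] := boolP (c <= t <= T - c); last first.
  have -> : F t = 0 by apply/eqP; apply: contraNT tc => /Fc.
  have -> : F' t = 0 by apply/eqP; apply: contraNT tc => /Fc'.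
  by rewrite !(mulr0, mul0r, addr0); case: ifP.
have t0 : 0 < t by case/andP: tc => + _; exact: lt_le_trans.
have tT : 0 <= t <= T.
  by rewrite ltW//=; case/andP: tc => _ /le_trans; apply; rewrite gerBl ltW.
rewrite ifT; last first.
  by rewrite inE; split => //=; rewrite in_itv/= andbT.
have ur : u t x = r (t, x).
  apply: contrapT => h; apply: nN; left; split; first by split => //=; rewrite in_itv.
  by apply/eqP.
have gE : Gper P K (u t) x = clipped_source (t, x).
  rewrite -(Gper_ae_eq P K x (clipped_ae uB tT)).
  apply: (Gper_singular P0 K1 Kodd CK0 Kbd (mrt t) (B := B)).
    by move=> y; apply: clipped_bound.
  by rewrite ltey; apply/eqP => h; apply: nN; right.
by rewrite ur gE /phi/=; congr (_ + _ + _)%:E; ring.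
Qed.

End regularized_solution.

(** * Uniqueness *)

Section distance.
Context {R : realType}.
Local Notation mu := (@lebesgue_measure R).

Lemma L1dist_increment (P B a b : R) (g h : R * R -> R) (s t : R) : 0 < P ->
  measurable_fun [set: R * R] g -> measurable_fun [set: R * R] h ->
  (forall z, `|g z| <= B) -> (forall z, `|h z| <= B) ->
  (\int[mu]_(x in cell P) `|g (s, x) - g (t, x)|%:E <= a%:E)%E ->
  (\int[mu]_(x in cell P) `|h (s, x) - h (t, x)|%:E <= b%:E)%E ->
  L1dist P g h s <= L1dist P g h t + a + b.
Proof.
move=> P0 mg mh gB hB ga hb; rewrite -lee_fin !EFinD -!(L1distE P0 mg mh gB hB).
have ms (p : R * R -> R) (r : R) : measurable_fun [set: R * R] p ->
    measurable_fun [set: R] (fun x => p (r, x)) by move=> mp; mfun.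
have [mgs mgt mhs mht] := And4 (ms _ s mg) (ms _ t mg) (ms _ s mh) (ms _ t mh).
apply: (@le_trans _ _ (\int[mu]_(x in cell P)
   (`|g (t, x) - h (t, x)|%:E + `|g (s, x) - g (t, x)|%:E + `|h (s, x) - h (t, x)|%:E))%E).
  apply: ge0_le_integral_any => x _; first by rewrite lee_fin.
  rewrite -!EFinD lee_fin.
  rewrite (_ : _ - _ = (g (t, x) - h (t, x)) + (g (s, x) - g (t, x)) - (h (s, x) - h (t, x))).
    by apply: (le_trans (ler_normB _ _)); rewrite lerD2r; exact: ler_normD.
  by ring.
have sm (p q : R -> R) : measurable_fun [set: R] p -> measurable_fun [set: R] q ->
    measurable_fun (cell P) (fun x => `|p x - q x|%:E).
  by move=> mp mq; apply: measurable_funTS; mfun.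
rewrite ge0_integralD; [|exact: measurable_cell|by move=> x _; rewrite adde_ge0// lee_fin| |
  by move=> x _; rewrite lee_fin|exact: sm]; last by apply: emeasurable_funD; exact: sm.
rewrite ge0_integralD; [|exact: measurable_cell|by move=> x _; rewrite lee_fin|exact: sm|
  by move=> x _; rewrite lee_fin|exact: sm].
by apply: leeD => //; exact: leeD.
Qed.

Lemma continuous_bounded_on (f : R -> R) (B : R) : 0 <= B -> continuous f ->
  exists C, forall y, `|y| <= B -> `|f y| <= C.
Proof.
move=> B0 cf; have BB : - B <= B by lra.
have cnf : {within `[- B, B], continuous (fun y => `|f y|)}.
  apply: continuous_subspaceT => y.
  by apply: (@continuous_comp _ _ _ f Num.norm); [exact: cf|exact: norm_continuous].
have [c _ cP] := EVT_max BB cnf.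
by exists `|f c| => y yB; apply: cP; rewrite in_itv/= -ler_norml.
Qed.

End distance.

Section comparison.
Context {R : realType}.
Local Notation mu := (@lebesgue_measure R).
Variables (P T B M CK : R) (f K ubar : R -> R).
Hypotheses (P0 : 0 < P) (T0 : 0 < T) (B0 : 0 <= B) (M0 : 0 <= M).
Hypothesis cf : continuous f.
Hypothesis K1 : forall x, kernel_domain P x -> derivable K x 1 /\ {for x, continuous (derive1 K)}.
Hypothesis Kodd : forall x, kernel_domain P x -> K (- x) = - K x.
Hypothesis CK0 : 0 < CK.
Hypothesis Kbd : forall (i : nat) (x : R), (i <= 1)%N -> - P <= x <= P -> x != 0 ->
          `|derive1n i K x| <= CK / `|x| ^+ i.+1.

Definition bounded_solution (u : R -> R -> R) : Prop :=
  [/\ entropy_weak_solution P f K ubar u,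
      forall t, 0 <= t <= T -> (ess_total_variation (- P) P (u t) <= M%:E)%E &
      forall t, 0 <= t <= T -> {ae mu, forall x, `|u t x| <= B}].

Local Notation r := (clipped T B).
Local Notation g := (clipped_source P T B K).
Local Notation D := (2 * (M + 1)).

Lemma clipped_slice_measurable u t : bounded_solution u ->
  measurable_fun [set: R] (fun x => r u (t, x)).
Proof. by move=> [[u_loc _ _ _ _] _ _]; have mr := measurable_clipped T B u_loc; mfun. Qed.

Lemma clipped_source_bound u t : bounded_solution u ->
  (\int[mu]_(x in cell P) `|g u (t, x)|%:E <=
    (2 * CK * D * P * expR (- 1) + 4 * CK * (B * (2 * P)))%:E)%E.
Proof.
move=> Hu; have [[u_loc uL2 uC _ _] uTV uB] := Hu.
have mut := clipped_slice_measurable t Hu.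
under eq_integral => x _.
  rewrite -[g u (t, x)]subr0 -(singular_cst0 P K x).
  over.
have := @singular_dist_le _ _ _ _ P0 K1 CK0 Kbd (fun x => r u (t, x)) (fun=> 0) D 0 B 1 (B * (2 * P)).
rewrite addr0 mulr1; apply => //.
- by move=> x; apply: clipped_periodic.
- by move=> x; apply: clipped_bound.
- by move=> x; rewrite normr0.
- by move=> h hP; apply: clipped_modulus.
- by move=> h hP; under eq_integral do rewrite subrr normr0; rewrite integral0 mul0r.
- by have := M0; lra.
- under eq_integral do rewrite subr0.
  by apply: integral_cell_fin => // x; apply: clipped_bound.
Qed.

(** The operator commutes with translations, and a translate of v has the same
    modulus of continuity as v. *)
Lemma clipped_source_dist u v m t s z L : bounded_solution u -> bounded_solution v ->
  0 < m -> `|z| <= P ->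
  (\int[mu]_(x in cell P) `|r u (t, x) - r v (s, x - z)|%:E <= L%:E)%E ->
  (\int[mu]_(x in cell P) `|g u (t, x) - g v (s, x - z)|%:E <=
    (2 * CK * (D + D) * P * expR (- m) + 4 * CK * m * L)%:E)%E.
Proof.
move=> Hu Hv m0 zP wL; have [[u_loc uL2 uC _ _] uTV uB] := Hu.
have [[v_loc vL2 vC _ _] vTV vB] := Hv.
have mut := clipped_slice_measurable t Hu.
have mvs := clipped_slice_measurable s Hv.
have rvP x : r v (s, x + 2 * P) = r v (s, x) by apply: clipped_periodic.
under eq_integral => x _.
  rewrite (_ : g v (s, x - z) = singular P K (fun y => r v (s, y - z)) x); last first.
    rewrite /clipped_source /singular /Rintegral; congr fine; apply: eq_integral => y _ /=.
    by congr (_ * (r v (s, _) - _))%:E; ring.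
  over.
rewrite [4 * CK * m * L]mulrAC.
have Dh := @clipped_modulus _ P T B M.
have mvz : measurable_fun [set: R] (fun x => r v (s, x - z)).
  by apply: (@measurableT_comp _ _ _ _ _ _ (fun y => r v (s, y))) => //; exact: measurable_addr.
apply: (singular_dist_le P0 K1 CK0 Kbd (B := B)) => //.
- by move=> x; apply: clipped_periodic.
- by move=> x; rewrite -(rvP (x - z)); congr (r v (s, _)); ring.
- by move=> x; apply: clipped_bound.
- by move=> x; apply: clipped_bound.
- by move=> h hP; apply: Dh.
- move=> h hP; apply: (le_trans _ (Dh v P0 vL2 vTV vB s h M0 hP)).
  rewrite le_eqVlt; apply/orP; left; apply/eqP.
  rewrite -(@integral_period_shift _ P (fun x => `|r v (s, x + h) - r v (s, x)|%:E) (- z) P0).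
  + by apply: eq_integral => x _; congr (`|r v (s, _) - _|%:E); ring.
  + have mvh : measurable_fun [set: R] (fun x => r v (s, x + h)).
      by apply: (@measurableT_comp _ _ _ _ _ _ (fun y => r v (s, y))) => //; exact: measurable_addr.
    by mfun.
  + by move=> x; rewrite lee_fin.
  + by move=> x; rewrite rvP -(rvP (x + h)); congr (`|r v (s, _) - _|%:E); ring.
- by have := M0; lra.
- by have := M0; lra.
Qed.

Lemma clipped_dist_continuous u v e : bounded_solution u -> bounded_solution v -> 0 < e ->
  exists2 d, 0 < d & forall t s, 0 <= t <= T -> 0 <= s <= T -> `|s - t| < d ->
    `|L1dist P (r u) (r v) s - L1dist P (r u) (r v) t| <= e.
Proof.
move=> Hu Hv e0; have [[u_loc uL2 uC _ _] uTV uB] := Hu.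
have [[v_loc vL2 vC _ _] vTV vB] := Hv.
have e2 : 0 < e / 2 by rewrite divr_gt0.
have [a a0 aP] := clipped_unif_continuous P0 uL2 uC uB e2.
have [b b0 bP] := clipped_unif_continuous P0 vL2 vC vB e2.
exists (Num.min a b); first by rewrite lt_min a0.
have half t s : 0 <= t <= T -> 0 <= s <= T -> `|s - t| < Num.min a b ->
    L1dist P (r u) (r v) s <= L1dist P (r u) (r v) t + e / 2 + e / 2.
  move=> tT sT; rewrite lt_min => /andP[sa sb].
  apply: (L1dist_increment (B := B)) => //.
  - exact: measurable_clipped.
  - exact: measurable_clipped.
  - by move=> z; apply: clipped_bound.
  - by move=> z; apply: clipped_bound.
  - exact: aP.
  - exact: bP.
move=> t s tT sT st; have h1 := half _ _ tT sT st.
rewrite distrC in st; have h2 := half _ _ sT tT st.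
by rewrite ler_norml; apply/andP; split; lra.
Qed.

Lemma clipped_dist_eq0 u v : bounded_solution u -> bounded_solution v ->
  forall t, 0 <= t <= T -> L1dist P (r u) (r v) t = 0.
Proof.
move=> Hu Hv; have [u_sol uTV uB] := Hu; have [v_sol vTV vB] := Hv.
have [u_loc uL2 uC u0 _] := u_sol; have [v_loc vL2 vC v0 _] := v_sol.
have mru := measurable_clipped T B u_loc; have mrv := measurable_clipped T B v_loc.
have ruB z : `|r u z| <= B by apply: clipped_bound.
have rvB z : `|r v z| <= B by apply: clipped_bound.
have mf : measurable_fun [set: R] f by exact: continuous_measurable_fun.
have [Bf fB] := continuous_bounded_on B0 cf.
have D0 : 0 <= D by have := M0; lra.
have A0 : 0 <= 2 * CK * (D + D) * P.
  by apply: mulr_ge0; [apply: mulr_ge0; [have := CK0; lra|exact: addr_ge0]|exact: ltW].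
have CK4 : 0 <= 4 * CK by have := CK0; lra.
apply: (@osgood_vanish _ T (2 * CK * (D + D) * P) (4 * CK) ((B + B) * (2 * P))).
- exact: T0.
- exact: A0.
- exact: CK4.
- exact: measurable_L1dist.
- by move=> t; exact: L1dist_ge0.
- move=> t; rewrite -lee_fin -(L1distE P0 mru mrv ruB rvB).
  have mut := clipped_slice_measurable t Hu; have mvt := clipped_slice_measurable t Hv.
  apply: (@integral_cell_fin _ P (fun x => r u (t, x) - r v (t, x)) (B + B) P0); first by mfun.
  by move=> x; apply: (le_trans (ler_normB _ _)); exact: lerD.
- move=> t e tT e0; have [d d0 dP] := clipped_dist_continuous Hu Hv e0.
  by exists d => // s sT st; exact: dP.
- apply: (@weak_inequality _ P T f (r u) (r v) (g u) (g v) B Bf _ D) => //.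
  + exact: (measurable_clipped_source T B P0 K1 u_sol).
  + exact: (measurable_clipped_source T B P0 K1 v_sol).
  + by move=> t x; apply: clipped_periodic.
  + by move=> t x; apply: clipped_periodic.
  + by move=> t x; exact: (clipped_source_periodic T B u_sol).
  + by move=> t x; exact: (clipped_source_periodic T B v_sol).
  + by move=> t; exact: clipped_source_bound.
  + by move=> t; exact: clipped_source_bound.
  + exact: (clipped_entropic P0 B0 M0 K1 Kodd CK0 Kbd u_sol).
  + exact: (clipped_entropic P0 B0 M0 K1 Kodd CK0 Kbd v_sol).
  + by move=> t h hP; exact: clipped_modulus.
  + exact: clipped_unif_continuous.
  + by move=> m t s z L m0 zP; exact: clipped_source_dist.
apply: EFin_inj; rewrite -(L1distE P0 mru mrv ruB rvB).
rewrite (@integral_ae_eq_any _ _ R mu (cell P) _ (fun=> 0%E)) ?integral0//.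
have T00 : 0 <= (0 : R) <= T by rewrite lexx ltW.
have init w : bounded_solution w -> {ae mu, forall x, r w (0, x) = ubar x}.
  move=> [[_ _ _ w0 _] _ wB].
  by apply: (@filterS2 _ _ ae_lebesgue_filter _ _ _ _ (clipped_ae wB T00) w0) => x -> ->.
apply: (@filterS2 _ _ ae_lebesgue_filter _ _ _ _ (init u Hu) (init v Hv)).
by move=> x -> -> _; rewrite subrr normr0.
Qed.

Lemma bounded_solution_unique u v : bounded_solution u -> bounded_solution v ->
  forall t, 0 <= t <= T -> {ae mu, forall x, u t x = v t x}.
Proof.
move=> Hu Hv t tT; have [[u_loc uL2 _ _ _] _ uB] := Hu; have [[v_loc vL2 _ _ _] _ vB] := Hv.
have t0 : 0 <= t by case/andP: tT.
have [_ uP _] := uL2 t t0; have [_ vP _] := vL2 t t0.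
apply: (ae_periodic P0) => [x|]; first by rewrite uP vP.
have mru := measurable_clipped T B u_loc; have mrv := measurable_clipped T B v_loc.
have ruB z : `|r u z| <= B by apply: clipped_bound.
have rvB z : `|r v z| <= B by apply: clipped_bound.
have mut := clipped_slice_measurable t Hu; have mvt := clipped_slice_measurable t Hv.
have := L1distE P0 mru mrv ruB rvB t; rewrite (clipped_dist_eq0 Hu Hv tT) => I0.
have mw : measurable_fun (cell P) (fun x => (r u (t, x) - r v (t, x))%:E).
  by apply: measurable_funTS; mfun.
have [+ _] := @ae_eq_integral_abs _ _ R mu (cell P) (measurable_cell P) _ mw.
move=> /(_ I0) w0.
apply: (@filterS3 _ _ ae_lebesgue_filter _ _ _ _ _ w0 (clipped_ae uB tT) (clipped_ae vB tT)).
by move=> x h <- <- /h [] /eqP; rewrite subr_eq0 => /eqP.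
Qed.

End comparison.

Theorem theorem3p3 (R : realType) (P T : R) (hP : 0 < P) (hT : 0 < T)
  (f K : R -> R) (hf : condF f) (hK : condK P K)
  (ubar : R -> R) (hubar : L2per P ubar)
  (u v : R -> R -> R)
  (hu : entropy_weak_solution P f K ubar u)
  (hv : entropy_weak_solution P f K ubar v)
  (hTV : exists M : R, forall t : R, 0 <= t <= T ->
     (ess_total_variation (- P) P (u t) <= M%:E)%E /\
     (ess_total_variation (- P) P (v t) <= M%:E)%E) :
  forall t : R, 0 <= t <= T ->
    {ae @lebesgue_measure R, forall x : R, u t x = v t x}.
Proof.
have [M0 TV] := hTV; pose M := Num.max M0 0.
have [K1 Kodd _ [CK [CK0 Kbd]]] := hK.
have M_ge0 : 0 <= M by rewrite le_max lexx orbT.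
have leM : (M0%:E <= M%:E)%E by rewrite lee_fin le_max lexx.
have cf : continuous f.
  by case: hf => df _ _ _ x; apply: differentiable_continuous; apply/derivable1_diffP.
have [_ uL2 uC _ _] := hu; have [_ vL2 vC _ _] := hv.
have [Lu Lu0 LuP] := L1_bounded hP uL2 uC T.
have [Lv Lv0 LvP] := L1_bounded hP vL2 vC T.
(* The essential bound of bv_sup, made common to both solutions. *)
pose B := (Lu + Lv) / (2 * P) + (M + 1).
have B0 : 0 <= B by apply: addr_ge0; [apply: divr_ge0; lra|lra].
have sup (w : R -> R -> R) L : 0 <= L -> L <= Lu + Lv ->
    (forall t, 0 <= t -> L2per P (w t)) ->
    (forall t, 0 <= t <= T -> (\int[lebesgue_measure]_(x in cell P) `|w t x|%:E <= L%:E)%E) ->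
    (forall t, 0 <= t <= T -> (ess_total_variation (- P) P (w t) <= M%:E)%E) ->
    forall t, 0 <= t <= T -> {ae @lebesgue_measure R, forall x, `|w t x| <= B}.
  move=> L0 LL wL2 wL wTV t tT.
  have t0 : 0 <= t by case/andP: tT.
  have [mw wP _] := wL2 t t0.
  apply: (ae_periodic hP) => [x|]; first by rewrite wP.
  apply: bv_sup => //; first exact: wTV.
  by apply: (le_trans (wL t tT)); rewrite lee_fin.
have uTV t : 0 <= t <= T -> (ess_total_variation (- P) P (u t) <= M%:E)%E.
  by move=> /TV[h _]; exact: le_trans leM.
have vTV t : 0 <= t <= T -> (ess_total_variation (- P) P (v t) <= M%:E)%E.
  by move=> /TV[_ h]; exact: le_trans leM.
apply: (bounded_solution_unique hP hT B0 M_ge0 cf K1 Kodd CK0 Kbd (ubar := ubar)).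
  split => //; apply: (sup u Lu) => //; lra.
split => //; apply: (sup v Lv) => //; lra.
Qed.
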